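(* Let $\omega_1(u),\omega_2(v)\in C^\infty(\mathbb{R})$ be such that $\omega_1(u)+\omega_2(v)\in(0,\pi)$ for all $(u,v)\in\mathbb{R}^2$. Then there exists an immersion $f(u,v):\mathbb{R}^2\to\mathbb{H}^3_1$ whose first, second and third fundamental forms are given by $$I=-\cos(2\omega_1)du^2-2\cos(\omega_1-\omega_2)dudv-\cos(2\omega_2)dv^2,\qquad II=2\sin(\omega_1+\omega_2)dudv,$$ $$III=\cos(2\omega_1)du^2-2\cos(\omega_1-\omega_2)dudv+\cos(2\omega_2)dv^2.\qquad(\mathrm{A})$$ In this way, $f$ describes a flat timelike surface in $\mathbb{H}^3_1$ whose asymptotic curves are the images of the coordinate curves in the $(u,v)$-plane. Moreover, $f$ represents an isometric immersion of $\mathbb{L}^2$ into $\mathbb{H}^3_1$ (i.e. $(\mathbb{R}^2,I)$ is isometric to $\mathbb{L}^2$) exactly when the local diffeomorphism $(u,v)\mapsto(x(u,v),y(u,v))$ of $\mathbb{R}^2$ given by $$x(u,v)=\int\cos\omega_1\,du+\int\cos\omega_2\,dv+c_1,\qquad y(u,v)=\int\sin\omega_1\,du-\int\sin\omega_2\,dv+c_2\qquad(\mathrm{B})$$ ($c_1,c_2$ integration constants) is actually a global diffeomorphism of $\mathbb{R}^2$. A sufficient condition for (B) to be a global diffeomorphism is that there are constants $m_1,m_2$ with $$0<m_1\le\omega_1(u)+\omega_2(v)\le m_2<\pi\qquad\forall(u,v)\in\mathbb{R}^2.$$ Conversely, any isometric immersion $f(x,y):\mathbb{L}^2\to\mathbb{H}^3_1$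 admits a parametrization $f(u,v):\mathbb{R}^2\to\mathbb{H}^3_1$ such that (A) holds for some $\omega_1(u),\omega_2(v)\in C^\infty(\mathbb{R})$ verifying $\omega_1(u)+\omega_2(v)\in(0,\pi)$ for all $(u,v)\in\mathbb{R}^2$. In that situation, the change of coordinates $(u,v)\mapsto(x(u,v),y(u,v))$ is given by (B).
   Context: $\mathbb{L}^2$ is $\mathbb{R}^2$ with canonical coordinates $(x,y)$ and the metric $-dx^2+dy^2$. $\mathbb{R}^4_2$ is $\mathbb{R}^4$ with the metric $\langle\ ,\ \rangle=-dx_0^2-dx_1^2+dx_2^2+dx_3^2$, and the anti-de Sitter space is $\mathbb{H}^3_1=\{z\in\mathbb{R}^4_2:\langle z,z\rangle=-1\}$ with the induced Lorentzian metric of curvature $-1$. For a timelike (i.e. Lorentzian induced metric) immersion $f$ into $\mathbb{H}^3_1$ with unit normal $N$ (with values in $\{x\in\mathbb{R}^4_2:\langle x,x\rangle=1\}$, tangent to $\mathbb{H}^3_1$ along $f$ and orthogonal to $df$), the fundamental forms are $I=\langle df,df\rangle$, $II=-\langle df,dN\rangle$, $III=\langle dN,dN\rangle$. Asymptotic curves are the curves whose tangent direction is null for $II$. *)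

(* Defs.v *)
From Stdlib Require Export Reals.
From Coquelicot Require Export Coquelicot.
Open Scope R_scope.

Definition smooth1 (w : R -> R) : Prop :=
  forall (n : nat) (t : R), ex_derive_n w n t.

(** [ex_diff_n h n] asks for continuity of all iterated partial derivatives of
    order at most [n], mixed ones in every order included. *)
Definition smooth_at (h : R -> R -> R) (u v : R) : Prop :=
  forall n : nat, ex_diff_n h n u v.

Definition smooth (h : R -> R -> R) : Prop := forall u v, smooth_at h u v.

Inductive coord : Set := Cu | Cv.

Definition partial (i : coord) (h : R -> R -> R) (u v : R) : R :=
  match i with
  | Cu => Derive (fun s => h s v) u
  | Cv => Derive (fun s => h u s) v
  end.

(** Maps of the plane: [phi u v] is the image of the point [(u, v)]. *)
Definition plane_map : Type := R -> R -> R * R.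

Definition smooth_map_at (phi : plane_map) (u v : R) : Prop :=
  smooth_at (fun s t => fst (phi s t)) u v /\
  smooth_at (fun s t => snd (phi s t)) u v.

Definition partial_map (i : coord) (phi : plane_map) (u v : R) : R * R :=
  (partial i (fun s t => fst (phi s t)) u v,
   partial i (fun s t => snd (phi s t)) u v).

Definition compose {A : Type} (f : R -> R -> A) (phi : plane_map)
  : R -> R -> A :=
  fun u v => f (fst (phi u v)) (snd (phi u v)).

(** [phi] restricts to a smooth diffeomorphism from [D] onto [D'], with
    inverse [psi]; the values of [phi] and [psi] elsewhere are irrelevant. *)
Definition diffeo_between (D D' : R * R -> Prop) (phi : plane_map) : Prop :=
  exists psi : plane_map,
    (forall u v, D (u, v) ->
       D' (phi u v) /\ compose psi phi u v = (u, v) /\ smooth_map_at phi u v) /\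
    (forall x y, D' (x, y) ->
       D (psi x y) /\ compose phi psi x y = (x, y) /\ smooth_map_at psi x y).

Definition global_diffeo (phi : plane_map) : Prop :=
  diffeo_between (fun _ => True) (fun _ => True) phi.

Definition local_diffeo (phi : plane_map) : Prop :=
  forall u v, exists D D' : R * R -> Prop,
    open D /\ open D' /\ D (u, v) /\ diffeo_between D D' phi.

(** [Sym2 E F G] is the quadratic form [E du^2 + 2 F du dv + G dv^2]. *)
Record sym2 : Type := Sym2 { cE : R; cF : R; cG : R }.

Definition entry (q : sym2) (i j : coord) : R :=
  match i, j with
  | Cu, Cu => cE q
  | Cv, Cv => cG q
  | _, _ => cF q
  end.

Definition bil (q : sym2) (a b : R * R) : R :=
  cE q * (fst a * fst b) + cF q * (fst a * snd b + snd a * fst b)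
  + cG q * (snd a * snd b).

Definition lorentzian (q : sym2) : Prop :=
  exists a b : R * R, bil q a a = -1 /\ bil q a b = 0 /\ bil q b b = 1.

(** The metric [- dx^2 + dy^2] of the Lorentz plane. *)
Definition gL2 : R -> R -> sym2 := fun _ _ => Sym2 (-1) 0 1.

Definition pullback (phi : plane_map) (g : R -> R -> sym2) (u v : R) : sym2 :=
  let q := compose g phi u v in
  let a := partial_map Cu phi u v in
  let b := partial_map Cv phi u v in
  Sym2 (bil q a a) (bil q a b) (bil q b b).

(** [phi] is an isometry of the plane with metric [g] onto the plane with
    metric [h]. *)
Definition isometry (g h : R -> R -> sym2) (phi : plane_map) : Prop :=
  global_diffeo phi /\ forall u v, pullback phi h u v = g u v.

Definition sum2 (F : coord -> R) : R := F Cu + F Cv.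

Definition inv_sym2 (q : sym2) : sym2 :=
  let d := cE q * cG q - cF q * cF q in
  Sym2 (cG q / d) (- cF q / d) (cE q / d).

(** [christoffel g k i j] is [Gamma^k_ij] for the Levi-Civita connection. *)
Definition christoffel (g : R -> R -> sym2) (k i j : coord) (u v : R) : R :=
  let dg m a b := partial m (fun s t => entry (g s t) a b) u v in
  / 2 * sum2 (fun l =>
    entry (inv_sym2 (g u v)) k l * (dg i j l + dg j i l - dg l i j)).

(** The [l]-component of [R(d_i, d_j) d_k]. *)
Definition riemann (g : R -> R -> sym2) (l i j k : coord) (u v : R) : R :=
  partial i (christoffel g l j k) u v - partial j (christoffel g l i k) u v
  + sum2 (fun m => christoffel g l i m u v * christoffel g m j k u v
                   - christoffel g l j m u v * christoffel g m i k u v).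

Definition flat (g : R -> R -> sym2) : Prop :=
  forall l i j k u v, riemann g l i j k u v = 0.

Definition R4 : Type := (R * R * R * R)%type.
Definition x0 (z : R4) : R := fst (fst (fst z)).
Definition x1 (z : R4) : R := snd (fst (fst z)).
Definition x2 (z : R4) : R := snd (fst z).
Definition x3 (z : R4) : R := snd z.

Definition ip (z w : R4) : R :=
  - (x0 z * x0 w) - x1 z * x1 w + x2 z * x2 w + x3 z * x3 w.

Definition smooth4 (f : R -> R -> R4) : Prop :=
  smooth (fun u v => x0 (f u v)) /\ smooth (fun u v => x1 (f u v)) /\
  smooth (fun u v => x2 (f u v)) /\ smooth (fun u v => x3 (f u v)).

Definition partial4 (i : coord) (f : R -> R -> R4) (u v : R) : R4 :=
  (partial i (fun s t => x0 (f s t)) u v,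
   partial i (fun s t => x1 (f s t)) u v,
   partial i (fun s t => x2 (f s t)) u v,
   partial i (fun s t => x3 (f s t)) u v).

Definition immersion_H31 (f : R -> R -> R4) : Prop :=
  smooth4 f /\
  (forall u v, ip (f u v) (f u v) = -1) /\
  (forall u v a b : R,
     plus (scal a (partial4 Cu f u v)) (scal b (partial4 Cv f u v)) = zero ->
     a = 0 /\ b = 0).

Definition unit_normal (f N : R -> R -> R4) : Prop :=
  smooth4 N /\
  forall u v, ip (N u v) (N u v) = 1 /\ ip (N u v) (f u v) = 0 /\
    forall i, ip (N u v) (partial4 i f u v) = 0.

(** [ip_d f h] is the quadratic form [<df, dh>] in [du, dv]; its mixed
    coefficient [<f_u, h_v> + <f_v, h_u>] is twice the entry [cF]. *)
Definition ip_d (f h : R -> R -> R4) (u v : R) : sym2 :=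
  let c i j := ip (partial4 i f u v) (partial4 j h u v) in
  Sym2 (c Cu Cu) ((c Cu Cv + c Cv Cu) / 2) (c Cv Cv).

Definition opp_sym2 (q : sym2) : sym2 := Sym2 (- cE q) (- cF q) (- cG q).

Definition form_I (f : R -> R -> R4) (u v : R) : sym2 := ip_d f f u v.
Definition form_II (f N : R -> R -> R4) (u v : R) : sym2 :=
  opp_sym2 (ip_d f N u v).
Definition form_III (N : R -> R -> R4) (u v : R) : sym2 := ip_d N N u v.

Definition timelike (f : R -> R -> R4) : Prop :=
  forall u v, lorentzian (form_I f u v).

(** A curve [c] in the parameter plane matters only on the open interval [(a, b)]. *)
Definition velocity (c : R -> R * R) (t : R) : R * R :=
  (Derive (fun s => fst (c s)) t, Derive (fun s => snd (c s)) t).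

Definition regular_curve (a b : Rbar) (c : R -> R * R) : Prop :=
  forall t : R, Rbar_lt a t -> Rbar_lt t b ->
    (forall n, ex_derive_n (fun s => fst (c s)) n t) /\
    (forall n, ex_derive_n (fun s => snd (c s)) n t) /\
    velocity c t <> (0, 0).

Definition asymptotic_curve (f N : R -> R -> R4) (a b : Rbar) (c : R -> R * R)
  : Prop :=
  forall t : R, Rbar_lt a t -> Rbar_lt t b ->
    bil (form_II f N (fst (c t)) (snd (c t))) (velocity c t) (velocity c t) = 0.

(** [c] runs along one of the lines [v = const] or [u = const]. *)
Definition in_coordinate_curve (a b : Rbar) (c : R -> R * R) : Prop :=
  (exists v, forall t : R, Rbar_lt a t -> Rbar_lt t b -> snd (c t) = v) \/
  (exists u, forall t : R, Rbar_lt a t -> Rbar_lt t b -> fst (c t) = u).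

Definition angle_pair (w1 w2 : R -> R) : Prop :=
  smooth1 w1 /\ smooth1 w2 /\ forall u v, 0 < w1 u + w2 v < PI.

Definition forms_A (w1 w2 : R -> R) (f N : R -> R -> R4) : Prop :=
  forall u v,
    form_I f u v =
      Sym2 (- cos (2 * w1 u)) (- cos (w1 u - w2 v)) (- cos (2 * w2 v)) /\
    form_II f N u v = Sym2 0 (sin (w1 u + w2 v)) 0 /\
    form_III N u v =
      Sym2 (cos (2 * w1 u)) (- cos (w1 u - w2 v)) (cos (2 * w2 v)).

Definition immersion_A (w1 w2 : R -> R) (f N : R -> R -> R4) : Prop :=
  immersion_H31 f /\ unit_normal f N /\ forms_A w1 w2 f N.

Definition map_B (w1 w2 : R -> R) (c1 c2 : R) : plane_map := fun u v =>
  (RInt (fun s => cos (w1 s)) 0 u + RInt (fun s => cos (w2 s)) 0 v + c1,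
   RInt (fun s => sin (w1 s)) 0 u - RInt (fun s => sin (w2 s)) 0 v + c2).

(* Main.v *)
Require Import Defs.
From Stdlib Require Import Lra Lia Psatz FunctionalExtensionality ClassicalEpsilon.

(** Existence. Identify R^4_2 with the real 2x2 matrices so that the metric
    becomes [- det]; then H^3_1 is SL(2, R). A surface with forms (A) is a
    product f(u, v) = a1(u) a2(v) of two curves of this group, its asymptotic
    curves, and its normal is N = - a1 xi a2 with xi = diag(1, -1). The forms (A)
    say that a1^-1 a1' and a2' a2^-1 are the vectors cos w1 e1 + sin w1 e2 and
    cos w2 e1 - sin w2 e2 of the plane orthogonal to xi in sl(2, R), for an
    orthonormal basis e1 (timelike), e2 (spacelike). So a1 and a2 are solutions
    of linear differential equations ([SL2_frame], [immersion_A_exists]).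

    Geometry of I. The form I is the pullback of the Lorentz metric by (B)
    ([pullback_map_B]). A map with the same pullback differs from (B) by a
    Lorentz transformation: by Koszul's formula the metric determines its second
    derivatives, and they force its derivatives along the parallel frame of I to
    be constant ([rigidity]). Hence I is isometric to the Lorentz plane exactly
    when (B) is a global diffeomorphism, and for the same reason every
    parametrization by asymptotic curves in the converse comes from (B).

    Diffeomorphisms. The matrix inverse to the differential of (B) has entries
    bounded by 1 / sin(w1 + w2). A map of the plane with bounded inverse
    differential is a homeomorphism: segments are lifted by solving a
    differential equation whose solutions cannot escape ([hadamard]), and its
    inverse is smooth when the map is ([inverse_smooth]). This proves the
    sufficient condition, and, after freezing the angles outside a square, that
    (B) is always a local diffeomorphism ([map_B_local]).

    Converse. For an isometric immersion of the Lorentz plane with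
    II = a dx^2 + 2 b dx dy + c dy^2 the Gauss and Codazzi equations are
    a c - b^2 = -1, a_y = b_x and b_y = c_x ([gauss_codazzi]). The first one
    allows to write II through two global angles W1 and W2 such that
    P = (cos W1, sin W1) and Q = (cos W2, - sin W2) are asymptotic directions
    ([asymptotic_angles]). The other two then say that W1 is constant along Q and
    W2 along P. Consequently P and Q commute, the dual forms du and dv are closed,
    and since P and Q have Euclidean length 1 the pair (u, v) is a global
    coordinate system by Hadamard's theorem. In these coordinates W1 depends on u
    only, W2 on v only, and (x, y) is given by (B) ([asymptotic_coordinates]). *)

(** * Regions of the plane *)

Lemma plane_ext (A : Type) (f g : R -> R -> A) : (forall x y, f x y = g x y) -> f = g.
Proof. intros H. do 2 (apply functional_extensionality; intro). apply H. Qed.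

Definition all_on (D : R -> R -> Prop) (P : R -> R -> Prop) : Prop :=
  forall x y, D x y -> P x y.

Definition everywhere : R -> R -> Prop := fun _ _ => True.

Definition open_region (D : R -> R -> Prop) : Prop :=
  forall x y, D x y -> locally_2d D x y.

Lemma open_everywhere : open_region everywhere.
Proof. intros x y _. exists (mkposreal 1 Rlt_0_1). intros; exact I. Qed.

Lemma locally_2d_weaken (P Q : R -> R -> Prop) x y :
  (forall u v, P u v -> Q u v) -> locally_2d P x y -> locally_2d Q x y.
Proof. intros H [d Hd]. exists d. intros; apply H, Hd; assumption. Qed.

(** * Partial derivatives *)

Definition slice {A : Type} (i : coord) (h : R -> R -> A) (u v : R) : R -> A :=
  match i with Cu => fun s => h s v | Cv => fun s => h u s end.

Definition at_coord (i : coord) (u v : R) : R :=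
  match i with Cu => u | Cv => v end.

(** The relational form of [partial], uniform in the direction [i]. *)
Definition is_partial (i : coord) (h : R -> R -> R) (u v l : R) : Prop :=
  is_derive (slice i h u v) (at_coord i u v) l.

Lemma is_partial_unique i h u v l : is_partial i h u v l -> partial i h u v = l.
Proof. destruct i; apply is_derive_unique. Qed.

Lemma is_partial_eq i h u v l m : is_partial i h u v l -> is_partial i h u v m -> l = m.
Proof. intros A B. rewrite <- (is_partial_unique i h u v l A). apply (is_partial_unique i h u v m B). Qed.

Lemma locally_slice i (P : R -> R -> Prop) u v :
  locally_2d P u v -> locally (at_coord i u v) (slice i P u v).
Proof.
  intros [d Hd]. exists d. intros s Hs.
  assert (Z : forall x, Rabs (x - x) < d)
    by (intros x; rewrite Rminus_diag, Rabs_R0; apply cond_pos).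
  destruct i; apply Hd; first [exact Hs | apply Z].
Qed.

Lemma is_partial_ext_on i D h k u v l : open_region D -> D u v -> all_on D (fun x y => h x y = k x y) ->
  is_partial i h u v l -> is_partial i k u v l.
Proof.
  intros HD Duv E. apply is_derive_ext_loc.
  generalize (locally_slice i D u v (HD u v Duv)). apply filter_imp.
  intros s. destruct i; apply E.
Qed.

Lemma is_partial_ext i h k u v l : (forall x y, h x y = k x y) -> is_partial i h u v l ->
  is_partial i k u v l.
Proof. intros E. rewrite (plane_ext _ h k E). auto. Qed.

Lemma is_partial_of_fst i (f : R -> R) u v l :
  is_derive f u l -> is_partial i (fun x _ => f x) u v (match i with Cu => l | Cv => 0 end).
Proof. intros H. destruct i; [exact H | apply (is_derive_const (f u))]. Qed.

Lemma is_partial_of_snd i (f : R -> R) u v l :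
  is_derive f v l -> is_partial i (fun _ y => f y) u v (match i with Cu => 0 | Cv => l end).
Proof. intros H. destruct i; [apply (is_derive_const (f v)) | exact H]. Qed.

Lemma is_partial_const i c u v : is_partial i (fun _ _ => c) u v 0.
Proof. destruct i; apply @is_derive_const. Qed.

Lemma is_partial_plus i h k u v l m : is_partial i h u v l -> is_partial i k u v m ->
  is_partial i (fun x y => h x y + k x y) u v (l + m).
Proof. destruct i; intros H K; apply (is_derive_plus _ _ _ _ _ H K). Qed.

Lemma is_partial_minus i h k u v l m : is_partial i h u v l -> is_partial i k u v m ->
  is_partial i (fun x y => h x y - k x y) u v (l - m).
Proof. destruct i; intros H K; apply (is_derive_minus _ _ _ _ _ H K). Qed.

Lemma is_partial_opp i h u v l : is_partial i h u v l -> is_partial i (fun x y => - h x y) u v (- l).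
Proof. destruct i; intros H; apply (is_derive_opp _ _ _ H). Qed.

Lemma is_derive_Rmult (f g : R -> R) x df dg :
  is_derive f x df -> is_derive g x dg ->
  is_derive (fun t => f t * g t) x (df * g x + f x * dg).
Proof. intros Hf Hg. apply (is_derive_mult f g x df dg Hf Hg Rmult_comm). Qed.

Lemma is_partial_mult i h k u v l m : is_partial i h u v l -> is_partial i k u v m ->
  is_partial i (fun x y => h x y * k x y) u v (l * k u v + h u v * m).
Proof. destruct i; apply is_derive_Rmult. Qed.

Lemma is_partial_comp i (g : R -> R) h u v l m : is_derive g (h u v) l -> is_partial i h u v m ->
  is_partial i (fun x y => g (h x y)) u v (l * m).
Proof.
  intros Hg Hh. rewrite Rmult_comm.
  destruct i; apply (is_derive_comp g _ _ _ _ Hg Hh).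
Qed.

Lemma is_partial_sin i h u v m : is_partial i h u v m ->
  is_partial i (fun x y => sin (h x y)) u v (cos (h u v) * m).
Proof. apply is_partial_comp, is_derive_sin. Qed.

Lemma is_partial_cos i h u v m : is_partial i h u v m ->
  is_partial i (fun x y => cos (h x y)) u v (- sin (h u v) * m).
Proof. apply is_partial_comp, is_derive_cos. Qed.

Lemma is_partial_div i h k u v l m : k u v <> 0 -> is_partial i h u v l -> is_partial i k u v m ->
  is_partial i (fun x y => h x y / k x y) u v ((l * k u v - h u v * m) / (k u v * k u v)).
Proof.
  intros Hn Hh Hk.
  replace ((l * k u v - h u v * m) / (k u v * k u v)) with
    (l * / k u v + h u v * (- / (k u v * k u v) * m)) by (field; exact Hn).
  apply (is_partial_mult i h (fun x y => / k x y)); [exact Hh |].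
  apply (is_partial_comp i Rinv); [| exact Hk]. auto_derive; [exact Hn |]. field. exact Hn.
Qed.

Lemma C1_filterdiff h hx hy x y :
  locally_2d (fun u v => is_derive (fun s => h s v) u (hx u v)) x y ->
  is_derive (fun s => h x s) y hy ->
  continuity_2d_pt hx x y ->
  filterdiff (fun u : R * R => h (fst u) (snd u)) (locally (x, y))
    (fun u : R * R => plus (scal (fst u) (hx x y)) (scal (snd u) hy)).
Proof.
  intros H1 H2 H3.
  apply is_derive_filterdiff; [apply locally_2d_locally in H1; exact H1 | exact H2 |].
  apply continuity_2d_pt_filterlim in H3. exact H3.
Qed.

Lemma C1_cont h hx hy x y :
  locally_2d (fun u v => is_derive (fun s => h s v) u (hx u v)) x y ->
  is_derive (fun s => h x s) y hy ->
  continuity_2d_pt hx x y -> continuity_2d_pt h x y.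
Proof.
  intros H1 H2 H3. apply continuity_2d_pt_filterlim.
  apply (filterdiff_continuous (fun u : R * R => h (fst u) (snd u)) (x, y)).
  exists (fun u : R * R => plus (scal (fst u) (hx x y)) (scal (snd u) hy)).
  exact (C1_filterdiff h hx hy x y H1 H2 H3).
Qed.

Lemma chain_rule (h hx : R -> R -> R) (hy : R) (r s : R -> R) (t dr ds : R) :
  locally_2d (fun u v => is_derive (fun z => h z v) u (hx u v)) (r t) (s t) ->
  is_derive (fun z => h (r t) z) (s t) hy ->
  continuity_2d_pt hx (r t) (s t) ->
  is_derive r t dr -> is_derive s t ds ->
  is_derive (fun z => h (r z) (s z)) t (hx (r t) (s t) * dr + hy * ds).
Proof.
  intros H1 H2 H3 H4 H5.
  unfold is_derive.
  refine (filterdiff_ext_lin _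
    (fun y : R => plus (scal (scal y dr) (hx (r t) (s t))) (scal (scal y ds) hy)) _ _ _).
  - apply (filterdiff_comp'_2 r s h t (fun y : R => scal y dr) (fun y : R => scal y ds)
      (fun a b : R => plus (scal a (hx (r t) (s t))) (scal b hy))).
    + exact H4.
    + exact H5.
    + apply C1_filterdiff; assumption.
  - intros y. unfold plus, scal; simpl. unfold mult; simpl. ring.
Qed.

Lemma is_partial_compose D g (gd : coord -> R -> R -> R) i p q u v dp dq :
  open_region D -> D (p u v) (q u v) -> (forall j, all_on D (fun x y => is_partial j g x y (gd j x y))) ->
  all_on D (continuity_2d_pt (gd Cu)) -> is_partial i p u v dp -> is_partial i q u v dq ->
  is_partial i (fun s t => g (p s t) (q s t)) u v
    (gd Cu (p u v) (q u v) * dp + gd Cv (p u v) (q u v) * dq).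
Proof.
  intros HD Dpq Hg Hc Hp Hq.
  assert (L : locally_2d (fun x y => is_derive (fun z => g z y) x (gd Cu x y)) (p u v) (q u v))
    by (apply (locally_2d_weaken D); [apply (Hg Cu) | apply HD, Dpq]).
  assert (L2 := Hg Cv _ _ Dpq). assert (C := Hc _ _ Dpq).
  destruct i.
  - apply (chain_rule g (gd Cu) (gd Cv (p u v) (q u v)) (fun s => p s v) (fun s => q s v)); assumption.
  - apply (chain_rule g (gd Cu) (gd Cv (p u v) (q u v)) (fun s => p u s) (fun s => q u s)); assumption.
Qed.

(** * Functions of class C^k and C^infinity on an open region *)

(** Asking for some partial derivatives of class C^m, rather than for smoothness
    of the total functions [partial i h], makes this notion depend on the values
    of [h] in [D] only, and its closure properties provable by plain induction. *)
Fixpoint Ck (n : nat) (D : R -> R -> Prop) (h : R -> R -> R) : Prop :=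
  all_on D (continuity_2d_pt h) /\
  match n with
  | O => True
  | S m => exists hd : coord -> R -> R -> R,
      (forall i, all_on D (fun x y => is_partial i h x y (hd i x y))) /\ forall i, Ck m D (hd i)
  end.

Definition Cinf (D : R -> R -> Prop) (h : R -> R -> R) : Prop := forall n, Ck n D h.

Lemma Ck_cont n D h : Ck n D h -> all_on D (continuity_2d_pt h).
Proof. destruct n; intros H; apply H. Qed.

Lemma Ck_pred n : forall D h, Ck (S n) D h -> Ck n D h.
Proof.
  induction n as [|n IH]; intros D h [Hc (hd & H1 & H2)].
  - split; [exact Hc | exact I].
  - split; [exact Hc |]. exists hd. auto.
Qed.

Lemma Ck_ext n D h k : open_region D -> all_on D (fun x y => h x y = k x y) -> Ck n D h -> Ck n D k.
Proof.
  intros HD E.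
  assert (Hcont : all_on D (continuity_2d_pt h) -> all_on D (continuity_2d_pt k)).
  { intros H x y Dxy. apply continuity_2d_pt_ext_loc with h; [| apply H, Dxy].
    apply (locally_2d_weaken D); auto. }
  destruct n as [|n]; intros [Hc Hd]; (split; [exact (Hcont Hc) |]); [exact I |].
  destruct Hd as (hd & H1 & H2). exists hd. split; [| exact H2].
  intros i x y Dxy. apply is_partial_ext_on with D h; auto. apply (H1 i x y Dxy).
Qed.

Lemma Ck_sub n : forall (D E : R -> R -> Prop) h,
  (forall x y, E x y -> D x y) -> Ck n D h -> Ck n E h.
Proof.
  induction n as [|n IH]; intros D E h S [Hc Hd];
    (split; [intros x y Exy; apply Hc, S, Exy |]); [exact I |].
  destruct Hd as (hd & H1 & H2). exists hd. split; [intros i x y Exy; apply (H1 i), S, Exy |].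
  intros i. apply IH with D; auto.
Qed.

Lemma Ck_partial n D h : open_region D -> Ck (S n) D h -> forall i, Ck n D (partial i h).
Proof.
  intros HD [_ (hd & H1 & H2)] i. apply Ck_ext with (hd i); auto.
  intros u v Duv. symmetry. apply is_partial_unique, (H1 i u v Duv).
Qed.

Lemma Ck_ex_diff n : forall D h, open_region D -> Ck n D h -> all_on D (ex_diff_n h n).
Proof.
  induction n as [|n IH]; intros D h HD H x y Dxy.
  - split; [apply H; assumption | exact I].
  - pose proof (Ck_partial n D h HD H) as Hp. destruct H as [Hc (hd & H1 & _)].
    split; [apply Hc; assumption |].
    split; [eexists; apply (H1 Cu x y Dxy) |]. split; [eexists; apply (H1 Cv x y Dxy) |].
    split; [apply (IH D _ HD (Hp Cu) x y Dxy) | apply (IH D _ HD (Hp Cv) x y Dxy)].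
Qed.

Lemma ex_diff_Ck n : forall D h, all_on D (ex_diff_n h n) -> Ck n D h.
Proof.
  induction n as [|n IH]; intros D h H; (split; [intros x y Dxy; apply (H x y Dxy) |]); [exact I |].
  exists (fun i => partial i h).
  split; intros i; [intros x y Dxy | apply IH; intros x y Dxy];
    destruct (H x y Dxy) as (_ & E1 & E2 & H1 & H2); destruct i;
    first [apply Derive_correct; assumption | assumption].
Qed.

Lemma Cinf_smooth_at D h : open_region D -> Cinf D h -> all_on D (smooth_at h).
Proof. intros HD H x y Dxy n. apply (Ck_ex_diff n D h HD (H n) x y Dxy). Qed.

Lemma smooth_at_Cinf D h : all_on D (smooth_at h) -> Cinf D h.
Proof. intros H n. apply ex_diff_Ck. intros x y Dxy. apply (H x y Dxy n). Qed.

Lemma Cinf_smooth h : Cinf everywhere h -> smooth h.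
Proof. intros H x y. apply (Cinf_smooth_at everywhere h open_everywhere H x y I). Qed.

Lemma smooth_Cinf h : smooth h -> Cinf everywhere h.
Proof. intros H. apply smooth_at_Cinf. intros x y _. apply H. Qed.

Lemma Cinf_is_partial D h : Cinf D h -> forall i,
  all_on D (fun u v => is_partial i h u v (partial i h u v)).
Proof.
  intros H i u v Duv. destruct (H 1%nat) as [_ (hd & H1 & _)].
  rewrite (is_partial_unique i h u v _ (H1 i u v Duv)). apply (H1 i u v Duv).
Qed.

Lemma Cinf_part h i u v : Cinf everywhere h -> is_partial i h u v (partial i h u v).
Proof. intros H. apply (Cinf_is_partial everywhere h H i u v I). Qed.

Lemma Cinf_partial D h : open_region D -> Cinf D h -> forall i, Cinf D (partial i h).
Proof. intros HD H i n. apply Ck_partial; auto. Qed.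

Lemma Cinf_cont D h : Cinf D h -> all_on D (continuity_2d_pt h).
Proof. intros H. apply (H O). Qed.

Lemma Cinf_schwarz D h : open_region D -> Cinf D h ->
  all_on D (fun u v => partial Cv (partial Cu h) u v = partial Cu (partial Cv h) u v).
Proof.
  intros HD H u v Duv. symmetry. unfold partial.
  pose proof (Cinf_partial D h HD H) as Hp.
  apply Schwarz.
  - apply (locally_2d_weaken D); [| apply HD, Duv].
    intros s t Dst. split; [| split; [| split]].
    + eexists. apply (Cinf_is_partial D h H Cu s t Dst).
    + eexists. apply (Cinf_is_partial D h H Cv s t Dst).
    + eexists. apply (Cinf_is_partial D _ (Hp Cv) Cu s t Dst).
    + eexists. apply (Cinf_is_partial D _ (Hp Cu) Cv s t Dst).
  - apply (Cinf_cont D _ (Cinf_partial D _ HD (Hp Cv) Cu) u v Duv).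
  - apply (Cinf_cont D _ (Cinf_partial D _ HD (Hp Cu) Cv) u v Duv).
Qed.

Lemma Ck_intro n D h (hd : coord -> R -> R -> R) : open_region D ->
  (forall i, all_on D (fun x y => is_partial i h x y (hd i x y))) ->
  (forall i, Ck n D (hd i)) -> Ck (S n) D h.
Proof.
  intros HD H1 H2. split; [| exists hd; auto].
  intros x y Dxy. apply C1_cont with (hd Cu) (hd Cv x y).
  - apply (locally_2d_weaken D); [apply (H1 Cu) | apply HD, Dxy].
  - apply (H1 Cv x y Dxy).
  - apply (Ck_cont n D _ (H2 Cu) x y Dxy).
Qed.

Lemma Ck_const n : forall D c, Ck n D (fun _ _ => c).
Proof.
  induction n as [|n IH]; intros D c; (split; [intros x y _; apply continuity_2d_pt_const |]); [exact I |].
  exists (fun _ _ _ => 0). split; [intros i x y _; apply is_partial_const | auto].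
Qed.

Lemma Ck_fst n D : Ck n D (fun x _ => x).
Proof.
  destruct n as [|n]; (split; [intros x y _; apply continuity_2d_pt_id1 |]); [exact I |].
  exists (fun i _ _ => match i with Cu => 1 | Cv => 0 end). split; [| intros i; apply Ck_const].
  intros i x y _. apply (is_partial_of_fst i (fun t => t)). apply @is_derive_id.
Qed.

Lemma Ck_snd n D : Ck n D (fun _ y => y).
Proof.
  destruct n as [|n]; (split; [intros x y _; apply continuity_2d_pt_id2 |]); [exact I |].
  exists (fun i _ _ => match i with Cu => 0 | Cv => 1 end). split; [| intros i; apply Ck_const].
  intros i x y _. apply (is_partial_of_snd i (fun t => t)). apply @is_derive_id.
Qed.

Lemma Ck_plus n : forall D h k, Ck n D h -> Ck n D k -> Ck n D (fun x y => h x y + k x y).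
Proof.
  induction n as [|n IH]; intros D h k [Hc Hd] [Kc Kd];
    (split; [intros x y Dxy; apply continuity_2d_pt_plus; auto |]); [exact I |].
  destruct Hd as (hd & H1 & H2), Kd as (kd & K1 & K2).
  exists (fun i x y => hd i x y + kd i x y). split; [| auto].
  intros i x y Dxy. apply is_partial_plus; [apply (H1 i x y Dxy) | apply (K1 i x y Dxy)].
Qed.

Lemma Ck_mult n : forall D h k, Ck n D h -> Ck n D k -> Ck n D (fun x y => h x y * k x y).
Proof.
  induction n as [|n IH]; intros D h k H K.
  - split; [intros x y Dxy; apply continuity_2d_pt_mult; [apply H | apply K]; exact Dxy | exact I].
  - pose proof (Ck_pred n D h H) as H'. pose proof (Ck_pred n D k K) as K'.
    destruct H as [Hc (hd & H1 & H2)], K as [Kc (kd & K1 & K2)].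
    split; [intros x y Dxy; apply continuity_2d_pt_mult; auto |].
    exists (fun i x y => hd i x y * k x y + h x y * kd i x y).
    split; [| intros i; apply Ck_plus; auto].
    intros i x y Dxy. apply is_partial_mult; [apply (H1 i x y Dxy) | apply (K1 i x y Dxy)].
Qed.

Lemma continuity_2d_comp g h k x y :
  continuity_2d_pt h x y -> continuity_2d_pt k x y ->
  continuity_2d_pt g (h x y) (k x y) ->
  continuity_2d_pt (fun u v => g (h u v) (k u v)) x y.
Proof.
  intros Hh Hk Hg eps. destruct (Hg eps) as [d Hd].
  destruct (Hh d) as [d1 H1], (Hk d) as [d2 H2].
  exists (mkposreal (Rmin d1 d2) (Rmin_pos _ _ (cond_pos d1) (cond_pos d2))).
  simpl. intros u v Hu Hv.
  pose proof (Rmin_l d1 d2). pose proof (Rmin_r d1 d2).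
  apply Hd; [apply H1 | apply H2]; lra.
Qed.

Lemma Ck_comp n : forall D E g h k, open_region E ->
  (forall x y, D x y -> E (h x y) (k x y)) ->
  Ck n E g -> Ck n D h -> Ck n D k -> Ck n D (fun x y => g (h x y) (k x y)).
Proof.
  induction n as [|n IH]; intros D E g h k HE Hm G H K.
  - split; [| exact I]. intros x y Dxy.
    apply continuity_2d_comp; [apply H | apply K | apply G]; auto.
  - pose proof (Ck_pred n _ _ H) as H'. pose proof (Ck_pred n _ _ K) as K'.
    destruct H as [Hc (hd & H1 & H2)], K as [Kc (kd & K1 & K2)], G as [Gc (gd & G1 & G2)].
    split; [intros x y Dxy; apply continuity_2d_comp; auto; apply Gc; auto |].
    exists (fun i x y => gd Cu (h x y) (k x y) * hd i x y + gd Cv (h x y) (k x y) * kd i x y). split.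
    + intros i x y Dxy. apply (is_partial_compose E g gd i h k); auto.
      * apply (Ck_cont n E _ (G2 Cu)).
      * apply (H1 i x y Dxy).
      * apply (K1 i x y Dxy).
    + intros i. apply Ck_plus; apply Ck_mult; auto; apply IH with E; auto.
Qed.

(** A smoothness theory for functions of one variable on an open set [P] is
    obtained by regarding them as functions of the plane constant in [y]. *)
Lemma Ck_lift n (g g' : R -> R) (P : R -> Prop) :
  (forall t, P t -> locally t P) -> (forall t, P t -> is_derive g t (g' t)) ->
  Ck n (fun x _ => P x) (fun x _ => g' x) -> Ck (S n) (fun x _ => P x) (fun x _ => g x).
Proof.
  intros HP H1 H2.
  apply Ck_intro with (fun i x _ => match i with Cu => g' x | Cv => 0 end).
  - intros x y Px. destruct (HP x Px) as [d Hd]. exists d. intros u v Hu _. apply Hd, Hu.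
  - intros i x y Px. apply is_partial_of_fst, H1, Px.
  - intros i. destruct i; [exact H2 | apply Ck_const].
Qed.

(** * Algebra of smooth functions *)

Section SmoothAlgebra.
Variable D : R -> R -> Prop.

Lemma Cinf_const c : Cinf D (fun _ _ => c).
Proof. intros n; apply Ck_const. Qed.
Lemma Cinf_fst : Cinf D (fun x _ => x).
Proof. intros n; apply Ck_fst. Qed.
Lemma Cinf_snd : Cinf D (fun _ y => y).
Proof. intros n; apply Ck_snd. Qed.
Lemma Cinf_plus h k : Cinf D h -> Cinf D k -> Cinf D (fun x y => h x y + k x y).
Proof. intros H K n; apply Ck_plus; auto. Qed.
Lemma Cinf_mult h k : Cinf D h -> Cinf D k -> Cinf D (fun x y => h x y * k x y).
Proof. intros H K n; apply Ck_mult; auto. Qed.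
Lemma Cinf_comp E g h k : open_region E -> (forall x y, D x y -> E (h x y) (k x y)) ->
  Cinf E g -> Cinf D h -> Cinf D k -> Cinf D (fun x y => g (h x y) (k x y)).
Proof. intros HE Hm G H K n; apply Ck_comp with E; auto. Qed.
End SmoothAlgebra.

Lemma Cinf_sub D E h : (forall x y, E x y -> D x y) -> Cinf D h -> Cinf E h.
Proof. intros S H n. apply Ck_sub with D; auto. Qed.

Lemma Cinf_everywhere D h : Cinf everywhere h -> Cinf D h.
Proof. apply Cinf_sub. intros; exact I. Qed.

Definition Cinf1 (P : R -> Prop) (g : R -> R) : Prop := Cinf (fun x _ => P x) (fun x _ => g x).

Lemma open_region_fst (P : R -> Prop) : (forall t, P t -> locally t P) -> open_region (fun x _ => P x).
Proof. intros HP x y Px. destruct (HP x Px) as [d Hd]. exists d. intros u v Hu _. apply Hd, Hu. Qed.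

Lemma Cinf_comp1 D (P : R -> Prop) g h : (forall t, P t -> locally t P) -> Cinf1 P g ->
  (forall x y, D x y -> P (h x y)) -> Cinf D h -> Cinf D (fun x y => g (h x y)).
Proof.
  intros HP Hg Hm Hh. apply (Cinf_comp D (fun x _ => P x) (fun x _ => g x) h h); auto.
  apply open_region_fst, HP.
Qed.

Lemma locally_true (t : R) : locally t (fun _ => True).
Proof. apply filter_true. Qed.

Lemma Cinf_scal D c h : Cinf D h -> Cinf D (fun x y => c * h x y).
Proof. intros H. apply (Cinf_mult D (fun _ _ => c)); [apply Cinf_const | exact H]. Qed.

Lemma Cinf_opp D h : Cinf D h -> Cinf D (fun x y => - h x y).
Proof.
  intros H n. replace (fun x y => - h x y) with (fun x y => -1 * h x y).
  - apply (Cinf_scal D (-1) h H).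
  - apply plane_ext; intros; ring.
Qed.

Lemma Cinf_minus D h k : Cinf D h -> Cinf D k -> Cinf D (fun x y => h x y - k x y).
Proof. intros H K. apply (Cinf_plus D h (fun x y => - k x y)); [| apply Cinf_opp]; auto. Qed.

Lemma Cinf1_sin_cos : Cinf1 (fun _ => True) sin /\ Cinf1 (fun _ => True) cos.
Proof.
  assert (H : forall n, Ck n (fun _ _ => True) (fun x _ => sin x) /\
                        Ck n (fun _ _ => True) (fun x _ => cos x)).
  { induction n as [|n [IHs IHc]].
    - split; (split; [| exact I]); intros x y _;
        apply (continuity_1d_2d_pt_comp _ (fun x _ => x)); try apply continuity_2d_pt_id1.
      + apply continuity_sin. + apply continuity_cos.
    - split.
      + apply (Ck_lift n sin cos (fun _ => True)); auto using locally_true.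
        intros t _. apply is_derive_sin.
      + apply (Ck_lift n cos (fun t => - sin t) (fun _ => True)); auto using locally_true.
        * intros t _. apply is_derive_cos.
        * replace (fun x (_ : R) => - sin x) with (fun x (_ : R) => -1 * sin x).
          -- apply (Ck_mult n _ (fun _ _ => -1)); [apply Ck_const | exact IHs].
          -- apply plane_ext; intros; ring. }
  split; intros n; apply H.
Qed.

Lemma Cinf_sin D h : Cinf D h -> Cinf D (fun x y => sin (h x y)).
Proof. apply (Cinf_comp1 D (fun _ => True)); auto using locally_true. apply Cinf1_sin_cos. Qed.
Lemma Cinf_cos D h : Cinf D h -> Cinf D (fun x y => cos (h x y)).
Proof. apply (Cinf_comp1 D (fun _ => True)); auto using locally_true. apply Cinf1_sin_cos. Qed.

Lemma locally_neq0 (t : R) : t <> 0 -> locally t (fun s => s <> 0).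
Proof.
  intros Ht. exists (mkposreal _ (Rabs_pos_lt t Ht)). intros s Hs E. subst s.
  change (Rabs (0 - t) < Rabs t) in Hs. rewrite Rminus_0_l, Rabs_Ropp in Hs. lra.
Qed.

Lemma Cinf1_inv : Cinf1 (fun t => t <> 0) Rinv.
Proof.
  intros n. induction n as [|n IH].
  - split; [| exact I]. intros x y Hx. apply (continuity_2d_pt_inv (fun x _ => x)); auto.
    apply continuity_2d_pt_id1.
  - apply (Ck_lift n Rinv (fun t => -1 * (/ t * / t)) (fun t => t <> 0)).
    + apply locally_neq0.
    + intros t Ht. auto_derive; auto. field. exact Ht.
    + apply (Ck_mult n _ (fun _ _ => -1)); [apply Ck_const |].
      apply (Ck_mult n _ (fun x _ => / x)); exact IH.
Qed.

Lemma Cinf_inv D h : (forall x y, D x y -> h x y <> 0) -> Cinf D h -> Cinf D (fun x y => / h x y).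
Proof.
  intros Hn. apply (Cinf_comp1 D (fun t => t <> 0)); auto using locally_neq0. apply Cinf1_inv.
Qed.

Lemma Cinf_div D h k : (forall x y, D x y -> k x y <> 0) -> Cinf D h -> Cinf D k ->
  Cinf D (fun x y => h x y / k x y).
Proof. intros Hn H K. apply (Cinf_mult D h (fun x y => / k x y)); [| apply Cinf_inv]; auto. Qed.

Lemma Cinf1_atan : Cinf1 (fun _ => True) atan.
Proof.
  assert (P : forall t : R, 1 + t * t <> 0) by (intros t; nra).
  assert (H : Cinf (fun _ _ => True) (fun x _ => / (1 + x * x))).
  { apply Cinf_inv; [intros x _ _; apply P |].
    apply (Cinf_plus _ (fun _ _ => 1)); [apply Cinf_const |].
    apply (Cinf_mult _ (fun x _ => x)); apply Cinf_fst. }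
  intros n. destruct n as [|n].
  - split; [| exact I]. intros x y _.
    apply (continuity_1d_2d_pt_comp atan (fun x _ => x)); [| apply continuity_2d_pt_id1].
    apply derivable_continuous_pt, derivable_pt_atan.
  - apply (Ck_lift n atan (fun t => / (1 + t * t)) (fun _ => True)); auto using locally_true.
    + intros t _. apply is_derive_Reals.
      replace (t * t) with (t ^ 2) by ring. apply derivable_pt_lim_atan.
Qed.

Lemma Cinf_atan D h : Cinf D h -> Cinf D (fun x y => atan (h x y)).
Proof. apply (Cinf_comp1 D (fun _ => True)); auto using locally_true. apply Cinf1_atan. Qed.

Lemma smooth1_Cinf w : smooth1 w -> Cinf everywhere (fun x _ => w x).
Proof.
  assert (H : forall n w, (forall k t, ex_derive_n w k t) -> Ck n everywhere (fun x _ => w x)).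
  { induction n as [|n IH]; intros g Hg.
    - split; [| exact I]. intros x y _.
      apply (continuity_1d_2d_pt_comp g (fun x _ => x)); [| apply continuity_2d_pt_id1].
      apply continuity_pt_filterlim. apply (ex_derive_continuous g). apply (Hg 1%nat x).
    - apply (Ck_lift n g (Derive g) (fun _ => True)); auto using locally_true.
      + intros t _. apply Derive_correct, (Hg 1%nat t).
      + apply IH. intros k t. destruct k as [|k]; [exact I |].
        simpl. apply ex_derive_ext with (Derive_n g (S k)).
        * intros s. symmetry. pose proof (Derive_n_comp g k 1 s) as E. simpl in E.
          replace (k + 1)%nat with (S k) in E by lia. exact E.
        * apply (Hg (S (S k)) t). }
  intros Hw n. apply H, Hw.
Qed.

Lemma Ck_Derive n g : Ck (S n) everywhere (fun x _ => g x) ->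
  (forall t, ex_derive g t) /\ Ck n everywhere (fun x _ => Derive g x).
Proof.
  intros H. split.
  - intros t. destruct H as [_ (hd & H1 & _)]. eexists. apply (H1 Cu t 0 I).
  - apply (Ck_partial n everywhere _ open_everywhere H Cu).
Qed.

Lemma Cinf_smooth1 w : Cinf everywhere (fun x _ => w x) -> smooth1 w.
Proof.
  assert (H : forall n, Cinf everywhere (fun x _ => w x) ->
     Cinf everywhere (fun x _ => Derive_n w n x)).
  { induction n as [|n IH]; intros Hw; [exact Hw |].
    intros k. apply Ck_Derive. apply (IH Hw). }
  intros Hw n t. destruct n as [|n]; [exact I |].
  apply (proj1 (Ck_Derive 0 (Derive_n w n) (H n Hw 1%nat))).
Qed.

Lemma Cinf_fun_fst D w : smooth1 w -> Cinf D (fun x _ => w x).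
Proof. intros H. apply Cinf_everywhere, smooth1_Cinf, H. Qed.

Lemma Cinf_fun_comp D w h : smooth1 w -> Cinf D h -> Cinf D (fun x y => w (h x y)).
Proof.
  intros H. apply (Cinf_comp1 D (fun _ => True)); auto using locally_true.
  apply smooth1_Cinf, H.
Qed.

Lemma smooth1_ex_derive w t : smooth1 w -> ex_derive w t.
Proof. intros H. apply (H 1%nat t). Qed.

Lemma smooth1_continuous w t : smooth1 w -> continuous w t.
Proof. intros H. apply (ex_derive_continuous w), smooth1_ex_derive, H. Qed.

(** * Derivatives of an inverse map *)

Lemma continuous_eps (f : R -> R) t :
  continuous f t <-> forall eps, 0 < eps -> exists d, 0 < d /\
    forall s, Rabs (s - t) < d -> Rabs (f s - f t) < eps.
Proof.
  split.
  - intros H eps He.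
    destruct (H (fun y => Rabs (y - f t) < eps)) as [d Hd].
    { exists (mkposreal eps He). intros y Hy. exact Hy. }
    exists d. split; [apply cond_pos |]. intros s Hs. apply (Hd s Hs).
  - intros H P [e He]. destruct (H e (cond_pos e)) as (d & Hd & Hs).
    exists (mkposreal d Hd). intros s Hb. apply He. apply (Hs s Hb).
Qed.

(** Caratheodory's form of differentiability has no quotients, so systems of
    equations between increments can be solved by Cramer's rule. *)
Lemma caratheodory (r Q : R -> R) t0 :
  locally t0 (fun t => r t - r t0 = Q t * (t - t0)) -> continuous Q t0 ->
  is_derive r t0 (Q t0).
Proof.
  intros HL HQ. apply is_derive_Reals. intros eps Heps.
  destruct HL as [d1 H1].
  apply continuity_pt_filterlim in HQ.
  assert (HQ' : locally t0 (fun t => Rabs (Q t - Q t0) < eps)).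
  { apply continuity_pt_filterlim in HQ.
    apply (HQ (fun y => Rabs (y - Q t0) < eps)). exists (mkposreal eps Heps).
    intros y Hy. exact Hy. }
  destruct HQ' as [d2 H2].
  assert (Hd : 0 < Rmin d1 d2) by (apply Rmin_pos; apply cond_pos).
  exists (mkposreal _ Hd). intros h Hh0 Hh. simpl in Hh.
  pose proof (Rmin_l d1 d2). pose proof (Rmin_r d1 d2).
  assert (Eh : t0 + h - t0 = h) by ring.
  assert (B1 : ball t0 d1 (t0 + h)).
  { change (Rabs (t0 + h - t0) < d1). rewrite Eh. lra. }
  assert (B2 : ball t0 d2 (t0 + h)).
  { change (Rabs (t0 + h - t0) < d2). rewrite Eh. lra. }
  specialize (H1 _ B1). specialize (H2 _ B2). simpl in H1.
  rewrite H1, Eh. replace (Q (t0 + h) * h / h) with (Q (t0 + h)) by (field; exact Hh0).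
  exact H2.
Qed.

Lemma caratheodory_slope (f : R -> R) t0 l : is_derive f t0 l ->
  exists Q, continuous Q t0 /\ Q t0 = l /\ forall t, f t - f t0 = Q t * (t - t0).
Proof.
  intros H. exists (fun t => if Req_EM_T t t0 then l else (f t - f t0) / (t - t0)).
  destruct (Req_EM_T t0 t0) as [_|n]; [| now contradiction n].
  split; [| split; [reflexivity |]].
  - apply continuous_eps. intros eps He. destruct (Req_EM_T t0 t0) as [_|n]; [| now contradiction n].
    apply is_derive_Reals in H. destruct (H eps He) as [d K]. exists d. split; [apply cond_pos |].
    intros t Ht. destruct (Req_EM_T t t0) as [_|n]; [rewrite Rminus_diag, Rabs_R0; exact He |].
    specialize (K (t - t0)). replace (t0 + (t - t0)) with t in K by ring. apply K; [lra | exact Ht].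
  - intros t. destruct (Req_EM_T t t0) as [->|n]; [ring | field; lra].
Qed.

(** Caratheodory slopes of [p] along a curve that is merely continuous; this is
    what makes the inverse of a smooth map differentiable. *)
Lemma curve_slopes (p px : R -> R -> R) py0 (r s : R -> R) t0 :
  locally_2d (fun x y => is_derive (fun z => p z y) x (px x y)) (r t0) (s t0) ->
  is_derive (fun z => p (r t0) z) (s t0) py0 ->
  continuity_2d_pt px (r t0) (s t0) ->
  continuous r t0 -> continuous s t0 ->
  exists A B : R -> R, continuous A t0 /\ A t0 = px (r t0) (s t0) /\
    continuous B t0 /\ B t0 = py0 /\
    forall t, p (r t) (s t) - p (r t0) (s t0) = A t * (r t - r t0) + B t * (s t - s t0).
Proof.
  intros H1 H2 H3 Hr Hs.
  destruct (caratheodory_slope _ _ _ H2) as (Q & CQ & EQ & HQ).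
  exists (fun t => if Req_EM_T (r t) (r t0) then px (r t0) (s t)
                   else (p (r t) (s t) - p (r t0) (s t)) / (r t - r t0)), (fun t => Q (s t)).
  destruct (Req_EM_T (r t0) (r t0)) as [_|n]; [| now contradiction n].
  split; [| split; [reflexivity | split; [exact (continuous_comp s Q t0 Hs CQ) | split; [exact EQ |]]]].
  - rewrite continuous_eps in Hr, Hs. apply continuous_eps. intros eps He.
    destruct (Req_EM_T (r t0) (r t0)) as [_|n]; [| now contradiction n].
    destruct (H3 (mkposreal eps He)) as [d1 K1]. destruct H1 as [d2 K2]. simpl in K1.
    assert (Hd : 0 < Rmin d1 d2) by (apply Rmin_pos; apply cond_pos).
    pose proof (Rmin_l d1 d2). pose proof (Rmin_r d1 d2).
    destruct (Hr _ Hd) as (e1 & He1 & L1). destruct (Hs _ Hd) as (e2 & He2 & L2).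
    exists (Rmin e1 e2). split; [apply Rmin_pos; assumption |].
    intros t Ht. pose proof (Rmin_l e1 e2). pose proof (Rmin_r e1 e2).
    specialize (L1 t). specialize (L2 t).
    destruct (Req_EM_T (r t) (r t0)) as [_|n].
    + apply K1; [rewrite Rminus_diag, Rabs_R0; apply cond_pos | lra].
    + (* the quotient is a value of px at an intermediate point *)
      destruct (MVT_cor4 (fun z => p z (s t)) (fun z => px z (s t)) (r t0)
        (Rabs (r t - r t0))) with (b := r t) as (c & Ec & Hc).
      * intros c Hc. apply K2; lra.
      * lra.
      * rewrite Ec. replace (px c (s t) * (r t - r t0) / (r t - r t0)) with (px c (s t)).
        -- apply K1; lra.
        -- field. lra.
  - intros t. transitivity ((p (r t) (s t) - p (r t0) (s t)) + Q (s t) * (s t - s t0)).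
    + rewrite <- HQ. ring.
    + destruct (Req_EM_T (r t) (r t0)) as [e|n]; [rewrite e; ring | field; lra].
Qed.

Lemma continuous_Rmult (f g : R -> R) t :
  continuous f t -> continuous g t -> continuous (fun s => f s * g s) t.
Proof. intros F G. apply (continuous_mult f g t F G). Qed.

Lemma continuous_Rminus (f g : R -> R) t :
  continuous f t -> continuous g t -> continuous (fun s => f s - g s) t.
Proof. intros F G. apply (continuous_minus f g t F G). Qed.

Lemma continuous_Rdiv (f g : R -> R) t :
  continuous f t -> continuous g t -> g t <> 0 -> continuous (fun s => f s / g s) t.
Proof.
  intros F G Hn. apply continuous_Rmult; [exact F |].
  apply continuity_pt_filterlim, continuity_pt_inv; [| exact Hn].
  apply continuity_pt_filterlim, G.
Qed.

Lemma cramer_derive (A B A' B' F F' r s : R -> R) t0 :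
  continuous A t0 -> continuous B t0 -> continuous A' t0 -> continuous B' t0 ->
  continuous F t0 -> continuous F' t0 -> A t0 * B' t0 - B t0 * A' t0 <> 0 ->
  (forall t, F t * (t - t0) = A t * (r t - r t0) + B t * (s t - s t0)) ->
  (forall t, F' t * (t - t0) = A' t * (r t - r t0) + B' t * (s t - s t0)) ->
  is_derive r t0 ((F t0 * B' t0 - F' t0 * B t0) / (A t0 * B' t0 - B t0 * A' t0)).
Proof.
  intros CA CB CA' CB' CF CF' HJ E E'.
  assert (CJ : continuous (fun t => A t * B' t - B t * A' t) t0)
    by (apply continuous_Rminus; apply continuous_Rmult; assumption).
  assert (NJ : locally t0 (fun t => A t * B' t - B t * A' t <> 0)).
  { apply (CJ (fun z => z <> 0)). apply locally_neq0, HJ. }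
  apply (caratheodory r (fun t => (F t * B' t - F' t * B t) / (A t * B' t - B t * A' t))).
  - generalize NJ. apply filter_imp. intros t K.
    apply Rmult_eq_reg_l with (A t * B' t - B t * A' t); [| exact K].
    field_simplify; [| exact K].
    transitivity (B' t * (F t * (t - t0)) - B t * (F' t * (t - t0))); [| ring].
    rewrite E, E'. ring.
  - apply continuous_Rdiv; auto. apply continuous_Rminus; apply continuous_Rmult; auto.
Qed.

(** The slopes of [p] and [q] along the curve [(r, s)] form a linear system for
    the increments of [r] and [s], of which only the continuity is known. *)
Lemma inverse_curve_derive (p q px qx : R -> R -> R) py qy (r s : R -> R) t0 e1 e2 :
  locally_2d (fun x y => is_derive (fun z => p z y) x (px x y)) (r t0) (s t0) ->
  locally_2d (fun x y => is_derive (fun z => q z y) x (qx x y)) (r t0) (s t0) ->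
  is_derive (fun z => p (r t0) z) (s t0) py ->
  is_derive (fun z => q (r t0) z) (s t0) qy ->
  continuity_2d_pt px (r t0) (s t0) -> continuity_2d_pt qx (r t0) (s t0) ->
  continuous r t0 -> continuous s t0 ->
  px (r t0) (s t0) * qy - py * qx (r t0) (s t0) <> 0 ->
  is_derive (fun t => p (r t) (s t)) t0 e1 -> is_derive (fun t => q (r t) (s t)) t0 e2 ->
  let J := px (r t0) (s t0) * qy - py * qx (r t0) (s t0) in
  is_derive r t0 ((e1 * qy - e2 * py) / J) /\
  is_derive s t0 ((e2 * px (r t0) (s t0) - e1 * qx (r t0) (s t0)) / J).
Proof.
  intros P1 Q1 P2 Q2 P3 Q3 Hr Hs HJ D1 D2 J.
  destruct (curve_slopes p px py r s t0 P1 P2 P3 Hr Hs) as (A & B & CA & EA & CB & EB & E1).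
  destruct (curve_slopes q qx qy r s t0 Q1 Q2 Q3 Hr Hs) as (A' & B' & CA' & EA' & CB' & EB' & E2).
  destruct (caratheodory_slope _ _ _ D1) as (F & CF & EF & HF).
  destruct (caratheodory_slope _ _ _ D2) as (F' & CF' & EF' & HF').
  unfold J in *. rewrite <- EA, <- EB, <- EA', <- EB', <- EF, <- EF' in *. split.
  - apply (cramer_derive A B A' B' F F' r s t0); auto; intros t; [rewrite <- HF | rewrite <- HF']; auto.
  - evar_last.
    + apply (cramer_derive B A B' A' F F' s r t0); auto; try lra; intros t;
        [rewrite <- HF, E1 | rewrite <- HF', E2]; ring.
    + field. split; lra.
Qed.

Lemma continuous_slice i h u v : continuity_2d_pt h u v -> continuous (slice i h u v) (at_coord i u v).
Proof.
  intros H. apply continuous_eps. intros eps He.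
  destruct (locally_slice i _ u v (H (mkposreal eps He))) as [d Hd].
  exists d. split; [apply cond_pos |]. intros s Hs. specialize (Hd s Hs). destruct i; exact Hd.
Qed.

Section InverseSmooth.
Variables D D' : R -> R -> Prop.
Hypothesis HD : open_region D.
Hypothesis HD' : open_region D'.
Variables p q r s : R -> R -> R.
Hypothesis Hp : Cinf D p.
Hypothesis Hq : Cinf D q.
Hypothesis HJ : forall x y, D x y ->
  partial Cu p x y * partial Cv q x y - partial Cv p x y * partial Cu q x y <> 0.
Hypothesis Hm : forall x y, D' x y -> D (r x y) (s x y).
Hypothesis Hcr : all_on D' (continuity_2d_pt r).
Hypothesis Hcs : all_on D' (continuity_2d_pt s).
Hypothesis Hinv : forall x y, D' x y -> p (r x y) (s x y) = x /\ q (r x y) (s x y) = y.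

Let J x y := partial Cu p x y * partial Cv q x y - partial Cv p x y * partial Cu q x y.

(** The columns of the inverse matrix of the differential of [(p, q)]. *)
Definition inverse_column (i : coord) : (R -> R -> R) * (R -> R -> R) :=
  match i with
  | Cu => (fun x y => partial Cv q x y / J x y, fun x y => - partial Cu q x y / J x y)
  | Cv => (fun x y => - partial Cv p x y / J x y, fun x y => partial Cu p x y / J x y)
  end.

Lemma inverse_partials i x y : D' x y ->
  is_partial i r x y (fst (inverse_column i) (r x y) (s x y)) /\
  is_partial i s x y (snd (inverse_column i) (r x y) (s x y)).
Proof.
  intros Dxy. pose proof (Hm x y Dxy) as Drs.
  assert (L : forall h, Cinf D h -> locally_2d (fun a b => is_derive (fun z => h z b) a
                (partial Cu h a b)) (r x y) (s x y)).
  { intros h Hh. apply (locally_2d_weaken D); [| apply HD, Drs].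
    intros a b Dab. apply (Cinf_is_partial D h Hh Cu a b Dab). }
  assert (P2 : forall h, Cinf D h -> is_derive (fun z => h (r x y) z) (s x y)
                 (partial Cv h (r x y) (s x y))).
  { intros h Hh. apply (Cinf_is_partial D h Hh Cv _ _ Drs). }
  assert (P3 : forall h, Cinf D h -> continuity_2d_pt (partial Cu h) (r x y) (s x y)).
  { intros h Hh. apply (Cinf_cont D _ (Cinf_partial D h HD Hh Cu) _ _ Drs). }
  assert (Dp : is_partial i (fun a b => p (r a b) (s a b)) x y (match i with Cu => 1 | Cv => 0 end)).
  { apply (is_partial_ext_on i D' (fun a _ => a)); auto.
    - intros a b Dab. symmetry. apply Hinv, Dab.
    - apply (is_partial_of_fst i (fun t => t)). apply @is_derive_id. }
  assert (Dq : is_partial i (fun a b => q (r a b) (s a b)) x y (match i with Cu => 0 | Cv => 1 end)).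
  { apply (is_partial_ext_on i D' (fun _ b => b)); auto.
    - intros a b Dab. symmetry. apply Hinv, Dab.
    - apply (is_partial_of_snd i (fun t => t)). apply @is_derive_id. }
  assert (Cr := continuous_slice i r x y (Hcr x y Dxy)).
  assert (Cs := continuous_slice i s x y (Hcs x y Dxy)).
  destruct i;
    destruct (inverse_curve_derive p q (partial Cu p) (partial Cu q)
      (partial Cv p (r x y) (s x y)) (partial Cv q (r x y) (s x y)) _ _ _ _ _
      (L p Hp) (L q Hq) (P2 p Hp) (P2 q Hq) (P3 p Hp) (P3 q Hq) Cr Cs (HJ _ _ Drs) Dp Dq) as [A1 A2];
    (split; [evar_last; [exact A1 |] | evar_last; [exact A2 |]]); unfold slice, at_coord;
    cbn [inverse_column fst snd]; unfold J; f_equal; ring.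
Qed.

(** The derivatives of the inverse are smooth functions of its values, so each
    degree of smoothness of the inverse yields the next one. *)
Lemma inverse_smooth : Cinf D' r /\ Cinf D' s.
Proof.
  assert (HSJ : Cinf D J).
  { apply (Cinf_minus D (fun x y => partial Cu p x y * partial Cv q x y)
      (fun x y => partial Cv p x y * partial Cu q x y));
    apply Cinf_mult; apply Cinf_partial; assumption. }
  assert (Hcol : forall i, Cinf D (fst (inverse_column i)) /\ Cinf D (snd (inverse_column i))).
  { intros i. destruct i; split; apply Cinf_div; auto; try (apply Cinf_partial; assumption);
      apply Cinf_opp, Cinf_partial; assumption. }
  assert (H : forall n, Ck n D' r /\ Ck n D' s).
  { induction n as [|n [IHr IHs]].
    - split; (split; [assumption | exact I]).
    - split.
      + apply Ck_intro with (fun i x y => fst (inverse_column i) (r x y) (s x y)); auto.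
        * intros i x y Dxy. apply inverse_partials, Dxy.
        * intros i. apply Ck_comp with D; auto. apply Hcol.
      + apply Ck_intro with (fun i x y => snd (inverse_column i) (r x y) (s x y)); auto.
        * intros i x y Dxy. exact (proj2 (inverse_partials i x y Dxy)).
        * intros i. apply Ck_comp with D; auto. apply Hcol. }
  split; intros n; apply H.
Qed.
End InverseSmooth.

(** * Potentials and angles *)

Lemma open_interval (a b : Rbar) (t : R) : Rbar_lt a t -> Rbar_lt t b ->
  locally t (fun s : R => Rbar_lt a s /\ Rbar_lt s b).
Proof.
  intros Ha Hb. apply (filter_and (F := locally t)).
  - apply (open_Rbar_gt' (Finite t) a Ha).
  - apply (open_Rbar_lt' (Finite t) b Hb).
Qed.

Lemma segment_in_interval (a b : Rbar) (s t z : R) : Rbar_lt a s -> Rbar_lt t b -> s <= z <= t ->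
  Rbar_lt a z /\ Rbar_lt z b.
Proof.
  intros Ha Hb Hz. split.
  - apply Rbar_lt_le_trans with s; [exact Ha | apply Hz].
  - apply Rbar_le_lt_trans with t; [apply Hz | exact Hb].
Qed.

Lemma const_on_interval (a b : Rbar) (f : R -> R) :
  (forall t : R, Rbar_lt a t -> Rbar_lt t b -> is_derive f t 0) ->
  forall s t : R, Rbar_lt a s -> Rbar_lt s b -> Rbar_lt a t -> Rbar_lt t b -> f s = f t.
Proof.
  intros H. assert (K : forall s t : R, Rbar_lt a s -> Rbar_lt t b -> s < t -> f s = f t).
  { intros s t Hs Ht Hst. apply eq_is_derive; [| exact Hst]. intros z Hz.
    destruct (segment_in_interval a b s t z Hs Ht Hz). apply H; assumption. }
  intros s t Hs1 Hs2 Ht1 Ht2. destruct (Rtotal_order s t) as [L|[L|L]].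
  - apply K; assumption. - now subst. - symmetry. apply K; assumption.
Qed.

(** Connectedness of an interval, obtained from the mean value theorem: the
    indicator function of a clopen set has derivative zero. *)
Lemma clopen_interval (a b : Rbar) (P : R -> Prop) :
  (forall t : R, Rbar_lt a t -> Rbar_lt t b -> P t -> locally t P) ->
  (forall t : R, Rbar_lt a t -> Rbar_lt t b -> ~ P t -> locally t (fun s => ~ P s)) ->
  forall s t : R, Rbar_lt a s -> Rbar_lt s b -> Rbar_lt a t -> Rbar_lt t b -> P s -> P t.
Proof.
  intros HO HC s t Hs1 Hs2 Ht1 Ht2 Ps.
  set (chi := fun t => if excluded_middle_informative (P t) then 1 else 0).
  assert (D : forall t : R, Rbar_lt a t -> Rbar_lt t b -> is_derive chi t 0).
  { intros z Hz1 Hz2. destruct (excluded_middle_informative (P z)) as [Pz|Pz].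
    - apply is_derive_ext_loc with (fun _ => 1); [| apply (is_derive_const 1)].
      generalize (HO z Hz1 Hz2 Pz). apply filter_imp. intros w Pw. unfold chi.
      destruct (excluded_middle_informative (P w)); [reflexivity | contradiction].
    - apply is_derive_ext_loc with (fun _ => 0); [| apply (is_derive_const 0)].
      generalize (HC z Hz1 Hz2 Pz). apply filter_imp. intros w Pw. unfold chi.
      destruct (excluded_middle_informative (P w)); [contradiction | reflexivity]. }
  pose proof (const_on_interval a b chi D s t Hs1 Hs2 Ht1 Ht2) as E. unfold chi in E.
  destruct (excluded_middle_informative (P s)); [| contradiction].
  destruct (excluded_middle_informative (P t)); [assumption | lra].
Qed.

Lemma const_of_derive_zero (f : R -> R) : (forall t, is_derive f t 0) -> forall a b, f a = f b.
Proof. intros H a b. apply (const_on_interval m_infty p_infty f); try exact I. intros t _ _. apply H. Qed.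

Lemma const_of_partials_zero h :
  (forall i u v, is_partial i h u v 0) -> forall u v u' v', h u v = h u' v'.
Proof.
  intros H u v u' v'. transitivity (h u' v).
  - apply (const_of_derive_zero (fun s => h s v)). intros t. apply (H Cu t v).
  - apply (const_of_derive_zero (fun s => h u' s)). intros t. apply (H Cv u' t).
Qed.

(** [cinf] and [partials] follow the syntax of an expression; at the leaves they
    use the hypotheses at hand. *)
Ltac cinf := lazymatch goal with
  | |- Cinf _ (fun x y => @?h x y + @?k x y) => apply (Cinf_plus _ h k); cinf
  | |- Cinf _ (fun x y => @?h x y - @?k x y) => apply (Cinf_minus _ h k); cinf
  | |- Cinf _ (fun x y => - @?h x y) => apply (Cinf_opp _ h); cinf
  | |- Cinf _ (fun x y => @?h x y * @?k x y) => apply (Cinf_mult _ h k); cinf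
  | |- Cinf _ (fun x y => @?h x y / @?k x y) => apply (Cinf_div _ h k); [intros; try lra; auto | cinf | cinf]
  | |- Cinf _ (fun x y => sin (@?h x y)) => apply (Cinf_sin _ h); cinf
  | |- Cinf _ (fun x y => cos (@?h x y)) => apply (Cinf_cos _ h); cinf
  | |- Cinf _ (fun x y => atan (@?h x y)) => apply (Cinf_atan _ h); cinf
  | |- Cinf _ (fun _ _ => ?c) => apply Cinf_const
  | |- Cinf ?D (fun x y => ?h x y) => change (Cinf D h); first [assumption | solve [auto] | idtac]
  | |- _ => first [assumption | apply Cinf_fst | apply Cinf_snd | solve [auto] | idtac]
  end.

Ltac partials := lazymatch goal with
  | |- is_partial ?i (fun x y => @?h x y + @?k x y) ?u ?v _ => apply (is_partial_plus i h k u v); partials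
  | |- is_partial ?i (fun x y => @?h x y - @?k x y) ?u ?v _ => apply (is_partial_minus i h k u v); partials
  | |- is_partial ?i (fun x y => - @?h x y) ?u ?v _ => apply (is_partial_opp i h u v); partials
  | |- is_partial ?i (fun x y => @?h x y * @?k x y) ?u ?v _ => apply (is_partial_mult i h k u v); partials
  | |- is_partial ?i (fun x y => @?h x y / @?k x y) ?u ?v _ =>
      apply (is_partial_div i h k u v); [cbv beta; auto | partials | partials]
  | |- is_partial ?i (fun x y => sin (@?h x y)) ?u ?v _ => apply (is_partial_sin i h u v); partials
  | |- is_partial ?i (fun x y => cos (@?h x y)) ?u ?v _ => apply (is_partial_cos i h u v); partials
  | |- is_partial ?i (fun _ _ => ?c) ?u ?v _ => apply is_partial_const
  | |- is_partial ?i (fun x y => ?h x y) ?u ?v ?l =>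
      change (is_partial i h u v l); first [eassumption | solve [eauto] | idtac]
  | |- _ => first [eassumption | solve [eauto] | idtac]
  end.

Lemma ex_RInt_cont (f : R -> R) a b : (forall t, continuous f t) -> ex_RInt f a b.
Proof. intros H. apply (ex_RInt_continuous f). intros z _. apply H. Qed.

Lemma is_derive_primitive (f : R -> R) a t : (forall s, continuous f s) ->
  is_derive (fun x => RInt f a x) t (f t).
Proof.
  intros H. apply (is_derive_RInt f (fun x => RInt f a x) a t).
  - apply filter_forall. intros x. apply (RInt_correct f), ex_RInt_cont, H.
  - apply H.
Qed.

Lemma Cinf_of_partials h hx hy :
  (forall u v, is_partial Cu h u v (hx u v)) -> (forall u v, is_partial Cv h u v (hy u v)) ->
  Cinf everywhere hx -> Cinf everywhere hy -> Cinf everywhere h.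
Proof.
  intros H1 H2 H3 H4 n. apply Ck_pred.
  apply Ck_intro with (fun i => match i with Cu => hx | Cv => hy end); [apply open_everywhere | |].
  - intros i u v _. destruct i; [apply H1 | apply H2].
  - intros i. destruct i; [apply H3 | apply H4].
Qed.

(** The potential is the integral of [M] along the x-axis followed by that of [N]
    along a vertical segment. Its x-derivative is [M x 0] plus the integral of
    N_x = M_y over the segment. *)
Lemma poincare M N : Cinf everywhere M -> Cinf everywhere N ->
  (forall u v, partial Cv M u v = partial Cu N u v) ->
  exists phi, Cinf everywhere phi /\
    (forall u v, is_partial Cu phi u v (M u v)) /\ (forall u v, is_partial Cv phi u v (N u v)).
Proof.
  intros HM HN Hcl.
  set (phi := fun x y => RInt (fun s => M s 0) 0 x + RInt (fun t => N x t) 0 y).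
  assert (CM : forall y s, continuous (fun s => M s y) s)
    by (intros y s; apply (continuous_slice Cu M s y), (Cinf_cont everywhere M HM s y I)).
  assert (CN : forall x s, continuous (fun t => N x t) s)
    by (intros x s; apply (continuous_slice Cv N x s), (Cinf_cont everywhere N HN x s I)).
  assert (Px : forall u v, is_partial Cu phi u v (M u v)).
  { intros x y. unfold is_partial, slice, at_coord, phi.
    assert (Hd : is_derive (fun z => RInt (fun t => N z t) 0 y) x
              (RInt (fun t => Derive (fun z => N z t) x) 0 y)).
    { apply (is_derive_RInt_param N 0 y x).
      - apply filter_forall. intros z t _. eexists. apply (Cinf_is_partial everywhere N HN Cu z t I).
      - intros t _. apply (Cinf_cont everywhere _ (Cinf_partial everywhere N open_everywhere HN Cu) x t I).
      - apply filter_forall. intros z. apply ex_RInt_cont, CN. }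
    assert (E : RInt (fun t => Derive (fun z => N z t) x) 0 y = M x y - M x 0).
    { rewrite (RInt_ext _ (Derive (fun t => M x t))).
      - apply (RInt_Derive (fun t => M x t)).
        + intros t _. eexists. apply (Cinf_is_partial everywhere M HM Cv x t I).
        + intros t _. apply (continuous_slice Cv (partial Cv M) x t).
          apply (Cinf_cont everywhere _ (Cinf_partial everywhere M open_everywhere HM Cv) x t I).
      - intros t _. symmetry. apply (Hcl x t). }
    rewrite E in Hd.
    evar_last; [apply @is_derive_plus; [| exact Hd] |].
    - apply (is_derive_primitive (fun s => M s 0) 0 x). intros s. apply (CM 0 s).
    - unfold plus; simpl. ring. }
  assert (Py : forall u v, is_partial Cv phi u v (N u v)).
  { intros x y. unfold is_partial, slice, at_coord, phi.
    evar_last; [apply @is_derive_plus; [apply @is_derive_const |] |].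
    - apply (is_derive_primitive (fun t => N x t) 0 y), CN.
    - apply Rplus_0_l. }
  exists phi. split; [| split]; auto.
  apply Cinf_of_partials with M N; assumption.
Qed.

Lemma circle_angle c s : c * c + s * s = 1 -> exists t, c = cos t /\ s = sin t.
Proof.
  intros H. assert (Hc : -1 <= c <= 1) by nra.
  assert (Hs : sin (acos c) * sin (acos c) = s * s).
  { pose proof (sin2_cos2 (acos c)) as E. rewrite (cos_acos c Hc) in E. unfold Rsqr in E. lra. }
  assert (F : (sin (acos c) - s) * (sin (acos c) + s) = 0) by lra.
  apply Rmult_integral in F. destruct F as [F|F].
  - exists (acos c). rewrite cos_acos by exact Hc. split; lra.
  - exists (- acos c). rewrite cos_neg, sin_neg, cos_acos by exact Hc. split; lra.
Qed.

(** The gradients of [X] and [Y] are parallel since the pair stays on the circle,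
    so the form X dY - Y dX is closed. Its potential is the angle, once the
    constant is adjusted at the origin. *)
Lemma angle_lift X Y : Cinf everywhere X -> Cinf everywhere Y ->
  (forall u v, X u v * X u v + Y u v * Y u v = 1) ->
  exists al, Cinf everywhere al /\ forall u v, X u v = cos (al u v) /\ Y u v = sin (al u v).
Proof.
  intros HX HY H1.
  assert (PX : forall i u v, is_partial i X u v (partial i X u v)) by (intros; apply Cinf_part, HX).
  assert (PY : forall i u v, is_partial i Y u v (partial i Y u v)) by (intros; apply Cinf_part, HY).
  assert (Hn : forall i u v, X u v * partial i X u v + Y u v * partial i Y u v = 0).
  { intros i u v.
    assert (P : is_partial i (fun x y => X x y * X x y + Y x y * Y x y) u v
      (partial i X u v * X u v + X u v * partial i X u v + (partial i Y u v * Y u v + Y u v * partial i Y u v)))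
      by partials.
    apply (is_partial_ext i _ (fun _ _ => 1)) in P; [| exact H1].
    pose proof (is_partial_eq i _ u v _ _ P (is_partial_const i 1 u v)). lra. }
  set (om := fun i u v => X u v * partial i Y u v - Y u v * partial i X u v).
  assert (Sp : forall h i, Cinf everywhere h -> Cinf everywhere (partial i h))
    by (intros h i Hh; apply Cinf_partial; auto using open_everywhere).
  assert (Hom : forall i, Cinf everywhere (om i)) by (intros i; unfold om; cinf).
  (* the derivatives of (X, Y) are multiples of (-Y, X) *)
  assert (HXp : forall i u v, partial i X u v = - Y u v * om i u v).
  { intros i u v. unfold om. specialize (Hn i u v). specialize (H1 u v).
    transitivity (partial i X u v * (X u v * X u v + Y u v * Y u v)
       - X u v * (X u v * partial i X u v + Y u v * partial i Y u v)).
    - rewrite H1, Hn. ring.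
    - ring. }
  assert (HYp : forall i u v, partial i Y u v = X u v * om i u v).
  { intros i u v. unfold om. specialize (Hn i u v). specialize (H1 u v).
    transitivity (partial i Y u v * (X u v * X u v + Y u v * Y u v)
       - Y u v * (X u v * partial i X u v + Y u v * partial i Y u v)).
    - rewrite H1, Hn. ring.
    - ring. }
  destruct (circle_angle (X 0 0) (Y 0 0) (H1 0 0)) as (t0 & Et1 & Et2).
  destruct (poincare (om Cu) (om Cv)) as (phi & Sphi & Pu & Pv); auto.
  { intros u v.
    assert (Q : forall i j, is_partial j (om i) u v
      (partial j X u v * partial i Y u v + X u v * partial j (partial i Y) u v
       - (partial j Y u v * partial i X u v + Y u v * partial j (partial i X) u v))).
    { intros i j. unfold om. partials; apply Cinf_part; auto. }
    rewrite (is_partial_unique _ _ _ _ _ (Q Cu Cv)), (is_partial_unique _ _ _ _ _ (Q Cv Cu)).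
    rewrite (Cinf_schwarz everywhere X open_everywhere HX u v I).
    rewrite (Cinf_schwarz everywhere Y open_everywhere HY u v I).
    rewrite !HXp, !HYp. ring. }
  set (al := fun u v => phi u v + (t0 - phi 0 0)).
  assert (Pal : forall i u v, is_partial i al u v (om i u v)).
  { intros i u v. replace (om i u v) with (om i u v + 0) by ring.
    apply is_partial_plus; [destruct i; auto | apply is_partial_const]. }
  assert (Hal : al 0 0 = t0) by (unfold al; ring).
  assert (K1 : forall u v, X u v * cos (al u v) + Y u v * sin (al u v) = 1).
  { intros u v. transitivity (X 0 0 * cos (al 0 0) + Y 0 0 * sin (al 0 0)).
    - apply (const_of_partials_zero (fun u v => X u v * cos (al u v) + Y u v * sin (al u v))).
      intros i a b. evar_last; [partials |]. cbv beta. rewrite HXp, HYp. ring.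
    - rewrite Hal, Et1, Et2. pose proof (sin2_cos2 t0). unfold Rsqr in *. lra. }
  assert (K2 : forall u v, Y u v * cos (al u v) - X u v * sin (al u v) = 0).
  { intros u v. transitivity (Y 0 0 * cos (al 0 0) - X 0 0 * sin (al 0 0)).
    - apply (const_of_partials_zero (fun u v => Y u v * cos (al u v) - X u v * sin (al u v))).
      intros i a b. evar_last; [partials |]. cbv beta. rewrite HXp, HYp. ring.
    - rewrite Hal, Et1, Et2. ring. }
  exists al. split.
  - unfold al. cinf.
  - intros u v. specialize (K1 u v). specialize (K2 u v).
    pose proof (sin2_cos2 (al u v)) as T. unfold Rsqr in T.
    set (c := cos (al u v)) in *. set (s := sin (al u v)) in *.
    split.
    + transitivity (X u v * (s * s + c * c)); [rewrite T; ring |].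
      transitivity (c * (X u v * c + Y u v * s) - s * (Y u v * c - X u v * s)); [ring |].
      rewrite K1, K2. ring.
    + transitivity (Y u v * (s * s + c * c)); [rewrite T; ring |].
      transitivity (s * (X u v * c + Y u v * s) + c * (Y u v * c - X u v * s)); [ring |].
      rewrite K1, K2. ring.
Qed.

(** * Global solutions of Lipschitz differential equations *)

Lemma is_derive_continuous (f : R -> R) t l : is_derive f t l -> continuous f t.
Proof. intros H. apply (ex_derive_continuous f). exists l. exact H. Qed.

Lemma derive_nonneg_incr (f f' : R -> R) a b : a <= b ->
  (forall t, a <= t <= b -> is_derive f t (f' t)) -> (forall t, a <= t <= b -> 0 <= f' t) ->
  f a <= f b.
Proof.
  intros Hab H1 H2.
  destruct (MVT_gen f a b f') as (c & Hc & E).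
  - intros x Hx. apply H1. rewrite Rmin_left, Rmax_right in Hx; lra.
  - intros x Hx. apply continuity_pt_filterlim.
    rewrite Rmin_left, Rmax_right in Hx by lra. apply (is_derive_continuous f x (f' x)), H1, Hx.
  - rewrite Rmin_left, Rmax_right in Hc by lra.
    pose proof (H2 c Hc). assert (0 <= f' c * (b - a)) by (apply Rmult_le_pos; lra). lra.
Qed.

Lemma geometric_limit (x : nat -> R) C :
  (forall n, Rabs (x (S n) - x n) <= C / 2 ^ n) ->
  forall n, Rabs (x n - Lim_seq x) <= 2 * C / 2 ^ n.
Proof.
  intros H.
  assert (Pp : forall n, 0 < 2 ^ n) by (intro n; apply pow_lt; lra).
  assert (C0 : 0 <= C).
  { specialize (H 0%nat). simpl in H. pose proof (Rabs_pos (x 1%nat - x 0%nat)). lra. }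
  assert (B : forall n m, Rabs (x (n + m)%nat - x n) <= 2 * C / 2 ^ n - 2 * C / 2 ^ (n + m)).
  { intros n m. induction m as [|m IH].
    - rewrite Nat.add_0_r, !Rminus_diag, Rabs_R0. lra.
    - replace (x (n + S m)%nat - x n) with
        ((x (S (n + m)) - x (n + m)%nat) + (x (n + m)%nat - x n))
        by (rewrite Nat.add_succ_r; ring).
      eapply Rle_trans; [apply Rabs_triang |].
      specialize (H (n + m)%nat). rewrite Nat.add_succ_r. simpl pow.
      replace (2 * C / (2 * 2 ^ (n + m))) with (C / 2 ^ (n + m))
        by (field; apply Rgt_not_eq, Pp).
      replace (2 * C / 2 ^ (n + m)) with (C / 2 ^ (n + m) + C / 2 ^ (n + m)) in IH
        by (field; apply Rgt_not_eq, Pp).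
      lra. }
  assert (B' : forall n m, (n <= m)%nat -> Rabs (x m - x n) <= 2 * C / 2 ^ n).
  { intros n m Hnm. replace m with (n + (m - n))%nat by lia.
    eapply Rle_trans; [apply B |].
    assert (0 <= 2 * C / 2 ^ (n + (m - n))).
    { apply Rmult_le_pos; [lra |]. apply Rlt_le, Rinv_0_lt_compat, Pp. }
    lra. }
  assert (HL : is_lim_seq x (Finite (Lim_seq x))).
  { apply Lim_seq_correct', ex_lim_seq_cauchy_corr. intros eps.
    assert (HG : is_lim_seq (fun n => (4 * C) * (/ 2) ^ n) 0).
    { evar_last; [apply is_lim_seq_scal_l, is_lim_seq_geom |].
      - rewrite Rabs_pos_eq; lra.
      - simpl. f_equal. ring. }
    apply is_lim_seq_spec in HG. destruct (HG eps) as [N HN].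
    exists N. intros n m Hn Hm. specialize (HN N (Nat.le_refl N)).
    rewrite Rminus_0_r, pow_inv in HN.
    assert (E : 4 * C * / 2 ^ N = 2 * C / 2 ^ N + 2 * C / 2 ^ N) by (field; apply Rgt_not_eq, Pp).
    apply Rabs_def2 in HN. rewrite E in HN.
    replace (x n - x m) with ((x n - x N) - (x m - x N)) by ring.
    eapply Rle_lt_trans; [apply Rabs_triang |]. rewrite Rabs_Ropp.
    pose proof (B' N n Hn). pose proof (B' N m Hm). lra. }
  intros n.
  assert (HA : is_lim_seq (fun m => Rabs (x n - x (m + n)%nat)) (Rabs (x n - Lim_seq x))).
  { apply (is_lim_seq_abs _ (Finite (x n - Lim_seq x))).
    apply is_lim_seq_minus'; [apply is_lim_seq_const | apply is_lim_seq_incr_n, HL]. }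
  apply (is_lim_seq_le _ (fun _ => 2 * C / 2 ^ n) _ _
    (fun m => eq_ind_r (fun z => z <= _) (B' n (m + n)%nat (Nat.le_add_l n m)) (Rabs_minus_sym _ _))
    HA (is_lim_seq_const _)).
Qed.

Section Picard.
Variables F1 F2 : R -> R -> R -> R.
Variables L M a b : R.
Hypothesis HL : 0 < L.
Hypothesis C1 : forall x y : R -> R, (forall t, continuous x t) -> (forall t, continuous y t) ->
  forall t, continuous (fun s => F1 s (x s) (y s)) t.
Hypothesis C2 : forall x y : R -> R, (forall t, continuous x t) -> (forall t, continuous y t) ->
  forall t, continuous (fun s => F2 s (x s) (y s)) t.
Hypothesis L1 : forall t x y x' y', Rabs (F1 t x y - F1 t x' y') <= L * (Rabs (x - x') + Rabs (y - y')).
Hypothesis L2 : forall t x y x' y', Rabs (F2 t x y - F2 t x' y') <= L * (Rabs (x - x') + Rabs (y - y')).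
Hypothesis M1 : forall t, Rabs (F1 t a b) <= M.
Hypothesis M2 : forall t, Rabs (F2 t a b) <= M.

Let k := 4 * L.
Let W t := exp (k * t) + exp (- (k * t)).

Lemma W_ge_1 t : 1 <= W t.
Proof.
  unfold W. pose proof (exp_pos (k * t)). pose proof (exp_pos (- (k * t))).
  destruct (Rle_dec 0 (k * t)) as [P|P].
  - pose proof (exp_ineq1_le (k * t)). lra.
  - pose proof (exp_ineq1_le (- (k * t))). lra.
Qed.

(** [W] is the derivative of an odd function bounded by [W / k]; integration from
    0 therefore gains a factor [1 / k] on both half-lines at once. *)
Lemma growth_bound (f f' : R -> R) c : 0 <= c -> f 0 = 0 ->
  (forall t, is_derive f t (f' t)) -> (forall t, Rabs (f' t) <= c * W t) ->
  forall t, Rabs (f t) <= c / k * W t.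
Proof.
  intros Hc H0 Hd Hb t.
  set (G := fun s => c / k * (exp (k * s) - exp (- (k * s)))).
  assert (Hk : k <> 0) by (unfold k; lra).
  assert (HG : forall s, is_derive G s (c * W s)).
  { intros s. unfold G, W. auto_derive; [exact I |]. field. exact Hk. }
  assert (HG0 : G 0 = 0) by (unfold G; rewrite Rmult_0_r, Ropp_0; ring).
  assert (Hm : forall s, is_derive (fun s => G s - f s) s (c * W s - f' s))
    by (intro s; apply (is_derive_minus G f); auto).
  assert (Hp : forall s, is_derive (fun s => G s + f s) s (c * W s + f' s))
    by (intro s; apply (is_derive_plus G f); auto).
  assert (Hb' : forall s, - (c * W s) <= f' s <= c * W s) by (intro s; apply Rabs_le_between, Hb).
  assert (Hck : 0 <= c / k).
  { apply Rmult_le_pos; [exact Hc |]. apply Rlt_le, Rinv_0_lt_compat. unfold k; lra. }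
  assert (HGW : - (c / k * W t) <= G t <= c / k * W t).
  { unfold G, W. pose proof (exp_pos (k * t)). pose proof (exp_pos (- (k * t))). split; nra. }
  apply Rabs_le_between.
  destruct (Rle_dec 0 t) as [Ht|Ht].
  - assert (A1 := derive_nonneg_incr _ _ 0 t Ht (fun s _ => Hm s)
      (fun s _ => ltac:(specialize (Hb' s); lra))).
    assert (A2 := derive_nonneg_incr _ _ 0 t Ht (fun s _ => Hp s)
      (fun s _ => ltac:(specialize (Hb' s); lra))).
    simpl in A1, A2. lra.
  - apply Rnot_le_lt, Rlt_le in Ht.
    assert (A1 := derive_nonneg_incr _ _ t 0 Ht (fun s _ => Hm s)
      (fun s _ => ltac:(specialize (Hb' s); lra))).
    assert (A2 := derive_nonneg_incr _ _ t 0 Ht (fun s _ => Hp s)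
      (fun s _ => ltac:(specialize (Hb' s); lra))).
    simpl in A1, A2. lra.
Qed.

Fixpoint picard (n : nat) : (R -> R) * (R -> R) :=
  match n with
  | O => (fun _ => a, fun _ => b)
  | S m => let (x, y) := picard m in
      (fun t => a + RInt (fun s => F1 s (x s) (y s)) 0 t,
       fun t => b + RInt (fun s => F2 s (x s) (y s)) 0 t)
  end.

Let X n := fst (picard n).
Let Y n := snd (picard n).

Lemma primitive_from (F : R -> R) c : (forall t, continuous F t) ->
  forall t, is_derive (fun t => c + RInt F 0 t) t (F t).
Proof.
  intros HF t. evar_last.
  - apply @is_derive_plus; [apply @is_derive_const | apply (is_derive_primitive F 0 t HF)].
  - apply Rplus_0_l.
Qed.

Lemma X_S n t : X (S n) t = a + RInt (fun s => F1 s (X n s) (Y n s)) 0 t.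
Proof. unfold X, Y. simpl. destruct (picard n). reflexivity. Qed.
Lemma Y_S n t : Y (S n) t = b + RInt (fun s => F2 s (X n s) (Y n s)) 0 t.
Proof. unfold X, Y. simpl. destruct (picard n). reflexivity. Qed.

Lemma picard_cont n : (forall t, continuous (X n) t) /\ (forall t, continuous (Y n) t).
Proof.
  induction n as [|n [IHx IHy]].
  - split; intros t; apply continuous_const.
  - split; intros t.
    + apply continuous_ext with (fun t => a + RInt (fun s => F1 s (X n s) (Y n s)) 0 t);
        [intro s; symmetry; apply X_S |].
      eapply is_derive_continuous, (primitive_from (fun s => F1 s (X n s) (Y n s))), C1; auto.
    + apply continuous_ext with (fun t => b + RInt (fun s => F2 s (X n s) (Y n s)) 0 t);
        [intro s; symmetry; apply Y_S |].
      eapply is_derive_continuous, (primitive_from (fun s => F2 s (X n s) (Y n s))), C2; auto.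
Qed.

Lemma X_derive n t : is_derive (X (S n)) t (F1 t (X n t) (Y n t)).
Proof.
  apply is_derive_ext with (fun t => a + RInt (fun s => F1 s (X n s) (Y n s)) 0 t);
    [intro s; symmetry; apply X_S |].
  apply (primitive_from (fun s => F1 s (X n s) (Y n s))), C1; apply picard_cont.
Qed.
Lemma Y_derive n t : is_derive (Y (S n)) t (F2 t (X n t) (Y n t)).
Proof.
  apply is_derive_ext with (fun t => b + RInt (fun s => F2 s (X n s) (Y n s)) 0 t);
    [intro s; symmetry; apply Y_S |].
  apply (primitive_from (fun s => F2 s (X n s) (Y n s))), C2; apply picard_cont.
Qed.

Lemma picard_0 n : X n 0 = a /\ Y n 0 = b.
Proof.
  destruct n as [|n]; [split; reflexivity |].
  rewrite X_S, Y_S, !RInt_point. unfold zero; simpl. split; ring.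
Qed.

Let C := M / k.

Lemma M_nonneg : 0 <= M.
Proof. eapply Rle_trans; [apply Rabs_pos | apply (M1 0)]. Qed.

Lemma C_nonneg : 0 <= C.
Proof. apply Rmult_le_pos; [apply M_nonneg |]. apply Rlt_le, Rinv_0_lt_compat. unfold k; lra. Qed.

(** As k = 4 L, each Picard step halves the distance of consecutive iterates
    relative to [W], so the iterates converge on the whole line. *)
Lemma picard_step n t :
  Rabs (X (S n) t - X n t) <= C * W t / 2 ^ n /\ Rabs (Y (S n) t - Y n t) <= C * W t / 2 ^ n.
Proof.
  assert (Hk : k <> 0) by (unfold k; lra).
  revert t. induction n as [|n IH]; intros t.
  - simpl pow. rewrite !Rdiv_1_r. unfold C. split.
    + apply (growth_bound (fun t => X 1 t - X 0 t) (fun t => F1 t a b)).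
      * apply M_nonneg.
      * rewrite !(proj1 (picard_0 _)). ring.
      * intros s. evar_last; [apply @is_derive_minus; [apply X_derive | apply (is_derive_const a)] |].
        apply Rminus_0_r.
      * intros s. pose proof (W_ge_1 s). pose proof (M1 s). pose proof M_nonneg. nra.
    + apply (growth_bound (fun t => Y 1 t - Y 0 t) (fun t => F2 t a b)).
      * apply M_nonneg.
      * rewrite !(proj2 (picard_0 _)). ring.
      * intros s. evar_last; [apply @is_derive_minus; [apply Y_derive | apply (is_derive_const b)] |].
        apply Rminus_0_r.
      * intros s. pose proof (W_ge_1 s). pose proof (M2 s). pose proof M_nonneg. nra.
  - assert (Pn : 0 < 2 ^ n) by (apply pow_lt; lra).
    set (c := L * (2 * C / 2 ^ n)).
    assert (Hc : 0 <= c).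
    { unfold c. pose proof C_nonneg. apply Rmult_le_pos; [lra |].
      apply Rmult_le_pos; [lra |]. apply Rlt_le, Rinv_0_lt_compat, Pn. }
    assert (E : forall s, C * W s / 2 ^ S n = c / k * W s).
    { intros s. unfold c. simpl pow. unfold k. field. split; lra. }
    assert (E' : forall s, L * (C * W s / 2 ^ n + C * W s / 2 ^ n) = c * W s).
    { intros s. unfold c. field. lra. }
    rewrite E. split.
    + apply (growth_bound (fun t => X (S (S n)) t - X (S n) t)
        (fun t => F1 t (X (S n) t) (Y (S n) t) - F1 t (X n t) (Y n t))); auto.
      * rewrite !(proj1 (picard_0 _)). ring.
      * intros s. apply @is_derive_minus; apply X_derive.
      * intros s. eapply Rle_trans; [apply L1 |]. rewrite <- E'.
        apply Rmult_le_compat_l; [lra |]. apply Rplus_le_compat; apply IH.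
    + apply (growth_bound (fun t => Y (S (S n)) t - Y (S n) t)
        (fun t => F2 t (X (S n) t) (Y (S n) t) - F2 t (X n t) (Y n t))); auto.
      * rewrite !(proj2 (picard_0 _)). ring.
      * intros s. apply @is_derive_minus; apply Y_derive.
      * intros s. eapply Rle_trans; [apply L2 |]. rewrite <- E'.
        apply Rmult_le_compat_l; [lra |]. apply Rplus_le_compat; apply IH.
Qed.

Let Xl t := real (Lim_seq (fun n => X n t)).
Let Yl t := real (Lim_seq (fun n => Y n t)).

Lemma picard_limit n t :
  Rabs (X n t - Xl t) <= 2 * (C * W t) / 2 ^ n /\ Rabs (Y n t - Yl t) <= 2 * (C * W t) / 2 ^ n.
Proof.
  split.
  - apply (geometric_limit (fun m => X m t)). intros m. apply picard_step.
  - apply (geometric_limit (fun m => Y m t)). intros m. apply picard_step.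
Qed.

Lemma W_cont t : continuous W t.
Proof. apply (ex_derive_continuous W). unfold W. auto_derive. exact I. Qed.

Lemma small_power K eps : 0 <= K -> 0 < eps -> exists n, K / 2 ^ n < eps.
Proof.
  intros HK He.
  assert (HG : is_lim_seq (fun n => K * (/ 2) ^ n) 0).
  { evar_last; [apply is_lim_seq_scal_l, is_lim_seq_geom |].
    - rewrite Rabs_pos_eq; lra.
    - simpl. f_equal. ring. }
  apply is_lim_seq_spec in HG. destruct (HG (mkposreal eps He)) as [N HN].
  exists N. specialize (HN N (Nat.le_refl N)). simpl in HN.
  rewrite Rminus_0_r, pow_inv in HN. apply Rabs_def2 in HN. unfold Rdiv. lra.
Qed.

Lemma limit_cont (Z : nat -> R -> R) (Zl : R -> R) :
  (forall n t, continuous (Z n) t) ->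
  (forall n t, Rabs (Z n t - Zl t) <= 2 * (C * W t) / 2 ^ n) -> forall t, continuous Zl t.
Proof.
  intros HZ HB t. apply continuous_eps. intros eps He.
  pose proof C_nonneg as HC. pose proof (W_ge_1 t) as HW.
  destruct (small_power (2 * (C * (W t + 1))) (eps / 3)) as [n Hn].
  - apply Rmult_le_pos; [lra |]. apply Rmult_le_pos; lra.
  - lra.
  - destruct (proj1 (continuous_eps W t) (W_cont t) 1 Rlt_0_1) as (d1 & Hd1 & K1).
    assert (He3 : 0 < eps / 3) by lra.
    destruct (proj1 (continuous_eps (Z n) t) (HZ n t) (eps / 3) He3) as (d2 & Hd2 & K2).
    exists (Rmin d1 d2). split; [apply Rmin_pos; assumption |].
    intros s Hs. pose proof (Rmin_l d1 d2). pose proof (Rmin_r d1 d2).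
    assert (Ks := K1 s ltac:(lra)). apply Rabs_def2 in Ks.
    specialize (K2 s ltac:(lra)).
    assert (Pn : 0 < / 2 ^ n) by (apply Rinv_0_lt_compat, pow_lt; lra).
    assert (Q : forall r, W r <= W t + 1 -> Rabs (Z n r - Zl r) < eps / 3).
    { intros r Hr. eapply Rle_lt_trans; [apply HB |]. eapply Rle_lt_trans; [| apply Hn].
      apply Rmult_le_compat_r; [lra |]. apply Rmult_le_compat_l; [lra |].
      apply Rmult_le_compat_l; lra. }
    pose proof (Q s ltac:(lra)) as Q1. pose proof (Q t ltac:(lra)) as Q2.
    apply Rabs_def2 in Q1. apply Rabs_def2 in Q2. apply Rabs_def2 in K2.
    apply Rabs_def1; lra.
Qed.

(** The primitive of the limiting right-hand side is also the limit of the
    iterates, by [growth_bound] again. *)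
Lemma limit_solves (F : R -> R -> R -> R) c (Z : nat -> R -> R) (Zl : R -> R) :
  (forall x y : R -> R, (forall t, continuous x t) -> (forall t, continuous y t) ->
    forall t, continuous (fun s => F s (x s) (y s)) t) ->
  (forall t x y x' y', Rabs (F t x y - F t x' y') <= L * (Rabs (x - x') + Rabs (y - y'))) ->
  (forall n, Z n 0 = c) ->
  (forall n t, is_derive (Z (S n)) t (F t (X n t) (Y n t))) ->
  (forall n t, Rabs (Z n t - Zl t) <= 2 * (C * W t) / 2 ^ n) ->
  (forall t, continuous Xl t) -> (forall t, continuous Yl t) ->
  forall t, is_derive Zl t (F t (Xl t) (Yl t)).
Proof.
  intros HC HLip HZ0 HZd HZl CX CY.
  set (I := fun t => c + RInt (fun s => F s (Xl s) (Yl s)) 0 t).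
  assert (HI : forall t, is_derive I t (F t (Xl t) (Yl t))).
  { apply (primitive_from (fun s => F s (Xl s) (Yl s))), HC; assumption. }
  assert (HI0 : I 0 = c) by (unfold I; rewrite RInt_point; unfold zero; simpl; ring).
  assert (Hk : 0 < k) by (unfold k; lra).
  assert (E : forall t, Zl t = I t).
  { intros t. pose proof C_nonneg as HC0. pose proof (W_ge_1 t) as HW.
    assert (B : forall n, Rabs (Zl t - I t) <= 4 * (C * W t) / 2 ^ n).
    { intros n.
      assert (Pn : 0 < / 2 ^ n) by (apply Rinv_0_lt_compat, pow_lt; lra).
      assert (P0 : 0 <= 4 * C / 2 ^ n) by (apply Rmult_le_pos; lra).
      assert (G := growth_bound (fun t => Z (S n) t - I t)
        (fun t => F t (X n t) (Y n t) - F t (Xl t) (Yl t)) (L * (4 * C / 2 ^ n))).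
      assert (G' : Rabs (Z (S n) t - I t) <= L * (4 * C / 2 ^ n) / k * W t).
      { apply G.
        - apply Rmult_le_pos; lra.
        - rewrite HZ0, HI0. ring.
        - intros s. apply @is_derive_minus; auto.
        - intros s. eapply Rle_trans; [apply HLip |].
          rewrite Rmult_assoc. apply Rmult_le_compat_l; [lra |].
          destruct (picard_limit n s) as [q1 q2].
          replace (4 * C / 2 ^ n * W s) with (2 * (C * W s) / 2 ^ n + 2 * (C * W s) / 2 ^ n)
            by (unfold Rdiv; ring).
          lra. }
      replace (L * (4 * C / 2 ^ n) / k * W t) with (C * W t * / 2 ^ n) in G'
        by (unfold k; field; split; [apply pow_nonzero |]; lra).
      specialize (HZl (S n) t). simpl pow in HZl.
      replace (2 * (C * W t) / (2 * 2 ^ n)) with (C * W t * / 2 ^ n) in HZl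
        by (field; apply pow_nonzero; lra).
      apply Rabs_le_between in G'. apply Rabs_le_between in HZl.
      assert (0 <= C * W t * / 2 ^ n) by (apply Rmult_le_pos; [apply Rmult_le_pos |]; lra).
      apply Rabs_le_between. unfold Rdiv. split; lra. }
    destruct (Req_dec (Zl t - I t) 0) as [E|E]; [lra |].
    apply Rabs_pos_lt in E.
    destruct (small_power (4 * (C * W t)) (Rabs (Zl t - I t))) as [n Hn]; auto.
    - apply Rmult_le_pos; [lra |]. apply Rmult_le_pos; lra.
    - specialize (B n). lra. }
  intros t. apply is_derive_ext with I; [intro s; symmetry; apply E | apply HI].
Qed.

Lemma ode_solution : exists x y : R -> R, x 0 = a /\ y 0 = b /\
  (forall t, is_derive x t (F1 t (x t) (y t))) /\ (forall t, is_derive y t (F2 t (x t) (y t))).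
Proof.
  assert (CX : forall t, continuous Xl t).
  { apply (limit_cont X Xl); [intro n; apply picard_cont | intros n t; apply picard_limit]. }
  assert (CY : forall t, continuous Yl t).
  { apply (limit_cont Y Yl); [intro n; apply picard_cont | intros n t; apply picard_limit]. }
  exists Xl, Yl. split; [| split; [| split]].
  - unfold Xl. rewrite (Lim_seq_ext _ (fun _ => a)); [rewrite Lim_seq_const; reflexivity |].
    intros n. apply picard_0.
  - unfold Yl. rewrite (Lim_seq_ext _ (fun _ => b)); [rewrite Lim_seq_const; reflexivity |].
    intros n. apply picard_0.
  - apply (limit_solves F1 a X Xl); auto.
    + intro n; apply picard_0. + apply X_derive. + intros n t; apply picard_limit.
  - apply (limit_solves F2 b Y Yl); auto.
    + intro n; apply picard_0. + apply Y_derive. + intros n t; apply picard_limit.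
Qed.
End Picard.

(** * Hadamard's global inverse theorem in the plane *)

Definition lipschitz_on_boxes (h : R -> R -> R) : Prop :=
  forall R0, exists L, 0 < L /\ forall x y x' y',
    Rabs x <= R0 -> Rabs y <= R0 -> Rabs x' <= R0 -> Rabs y' <= R0 ->
    Rabs (h x y - h x' y') <= L * (Rabs (x - x') + Rabs (y - y')).

(** The radius of continuity at each point is chosen below 1 / (1 + |h|), so a
    lower bound for the radii, given by compactness, bounds |h|. *)
Lemma bounded_on_box h R0 : (forall x y, continuity_2d_pt h x y) ->
  exists B, 0 < B /\ forall x y, Rabs x <= R0 -> Rabs y <= R0 -> Rabs (h x y) <= B.
Proof.
  intros Hc.
  assert (Hd : forall u v, exists d : posreal, d <= / (1 + Rabs (h u v)) /\
    forall x y, Rabs (x - u) < d -> Rabs (y - v) < d -> Rabs (h x y - h u v) < 1).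
  { intros u v. destruct (Hc u v (mkposreal 1 Rlt_0_1)) as [d Hd].
    assert (P : 0 < / (1 + Rabs (h u v)))
      by (apply Rinv_0_lt_compat; pose proof (Rabs_pos (h u v)); lra).
    exists (mkposreal _ (Rmin_pos _ _ (cond_pos d) P)). simpl.
    split; [apply Rmin_r |]. intros x y Hx Hy. pose proof (Rmin_l d (/ (1 + Rabs (h u v)))).
    apply Hd; lra. }
  set (dl := fun u v => proj1_sig (constructive_indefinite_description _ (Hd u v))).
  assert (Hdl : forall u v, dl u v <= / (1 + Rabs (h u v)) /\
    forall x y, Rabs (x - u) < dl u v -> Rabs (y - v) < dl u v -> Rabs (h x y - h u v) < 1).
  { intros u v. apply (proj2_sig (constructive_indefinite_description _ (Hd u v))). }
  destruct (compactness_value_2d (- R0) R0 (- R0) R0 dl) as [d K].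
  assert (Pd : 0 < / d) by (apply Rinv_0_lt_compat, cond_pos).
  exists (/ d + 1). split; [lra |]. intros x y Hx Hy.
  apply Rabs_le_between in Hx. apply Rabs_le_between in Hy.
  apply Rnot_lt_le. intros Hlt. apply (K x y Hx Hy). intros (u & v & _ & _ & H1 & H2 & H3).
  destruct (Hdl u v) as [H4 H5]. specialize (H5 x y H1 H2).
  assert (H6 : 1 + Rabs (h u v) <= / d).
  { pose proof (Rabs_pos (h u v)). rewrite <- (Rinv_inv (1 + Rabs (h u v))).
    apply Rinv_le_contravar; [apply cond_pos | lra]. }
  pose proof (Rabs_triang (h x y - h u v) (h u v)) as T.
  replace (h x y - h u v + h u v) with (h x y) in T by ring. lra.
Qed.

Lemma Cinf_lipschitz_on_boxes h : Cinf everywhere h -> lipschitz_on_boxes h.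
Proof.
  intros Hh R0.
  destruct (bounded_on_box (partial Cu h) R0) as (B1 & P1 & H1).
  { intros x y. apply (Cinf_cont everywhere _ (Cinf_partial everywhere h open_everywhere Hh Cu) x y I). }
  destruct (bounded_on_box (partial Cv h) R0) as (B2 & P2 & H2).
  { intros x y. apply (Cinf_cont everywhere _ (Cinf_partial everywhere h open_everywhere Hh Cv) x y I). }
  exists (B1 + B2). split; [lra |]. intros x y x' y' Hx Hy Hx' Hy'.
  assert (Hbox : forall a b c, Rabs a <= R0 -> Rabs b <= R0 -> Rmin a b <= c <= Rmax a b -> Rabs c <= R0).
  { intros a b c Ha Hb [Hc1 Hc2]. apply Rabs_le_between in Ha. apply Rabs_le_between in Hb.
    apply Rabs_le_between. unfold Rmin, Rmax in *. destruct (Rle_dec a b); lra. }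
  destruct (MVT_gen (fun s => h s y) x' x (fun s => partial Cu h s y)) as (c & Hc & E1).
  { intros s _. apply (Cinf_part h Cu s y Hh). }
  { intros s _. apply continuity_pt_filterlim, (continuous_slice Cu h s y), (Cinf_cont everywhere h Hh s y I). }
  destruct (MVT_gen (fun s => h x' s) y' y (fun s => partial Cv h x' s)) as (e & He & E2).
  { intros s _. apply (Cinf_part h Cv x' s Hh). }
  { intros s _. apply continuity_pt_filterlim, (continuous_slice Cv h x' s), (Cinf_cont everywhere h Hh x' s I). }
  replace (h x y - h x' y') with ((h x y - h x' y) + (h x' y - h x' y')) by ring.
  eapply Rle_trans; [apply Rabs_triang |]. rewrite E1, E2, !Rabs_mult.
  pose proof (H1 c y (Hbox _ _ _ Hx' Hx Hc) Hy). pose proof (H2 x' e Hx' (Hbox _ _ _ Hy' Hy He)).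
  pose proof (Rabs_pos (x - x')). pose proof (Rabs_pos (y - y')). nra.
Qed.

Definition clamp (R0 x : R) : R := Rmax (- R0) (Rmin R0 x).

Lemma clamp_bound R0 x : 0 <= R0 -> Rabs (clamp R0 x) <= R0.
Proof.
  intros H. apply Rabs_le_between. unfold clamp, Rmax, Rmin.
  destruct (Rle_dec R0 x); destruct (Rle_dec (- R0) _); lra.
Qed.

Lemma clamp_id R0 x : Rabs x <= R0 -> clamp R0 x = x.
Proof.
  intros H. apply Rabs_le_between in H. unfold clamp, Rmax, Rmin.
  destruct (Rle_dec R0 x); destruct (Rle_dec (- R0) _); lra.
Qed.

Lemma clamp_lipschitz R0 x x' : Rabs (clamp R0 x - clamp R0 x') <= Rabs (x - x').
Proof.
  unfold clamp, Rmax, Rmin, Rabs. destruct (Rle_dec R0 x), (Rle_dec R0 x').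
  all: repeat match goal with |- context [if ?b then _ else _] => destruct b end; lra.
Qed.

Lemma square_bound a b : 0 <= b -> a * a <= b * b -> Rabs a <= b.
Proof. intros Hb H. apply Rsqr_le_abs_0 in H. rewrite (Rabs_pos_eq b Hb) in H. exact H. Qed.

(** [P] and [Q] are the columns of the matrix inverse to the differential of
    [(g, h)]. They are only asked to be Lipschitz on boxes, so that the result
    applies to angle functions frozen outside a square. *)
Section Hadamard.
Variables g h gx gy hx hy P1 P2 Q1 Q2 : R -> R -> R.
Variable K : R.
Hypothesis Dgx : forall x y, is_derive (fun s => g s y) x (gx x y).
Hypothesis Dgy : forall x y, is_derive (fun s => g x s) y (gy x y).
Hypothesis Dhx : forall x y, is_derive (fun s => h s y) x (hx x y).
Hypothesis Dhy : forall x y, is_derive (fun s => h x s) y (hy x y).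
Hypothesis Cgx : forall x y, continuity_2d_pt gx x y.
Hypothesis Cgy : forall x y, continuity_2d_pt gy x y.
Hypothesis Chx : forall x y, continuity_2d_pt hx x y.
Hypothesis Chy : forall x y, continuity_2d_pt hy x y.
Hypothesis gP : forall x y, gx x y * P1 x y + gy x y * P2 x y = 1.
Hypothesis hP : forall x y, hx x y * P1 x y + hy x y * P2 x y = 0.
Hypothesis gQ : forall x y, gx x y * Q1 x y + gy x y * Q2 x y = 0.
Hypothesis hQ : forall x y, hx x y * Q1 x y + hy x y * Q2 x y = 1.
Hypothesis LP1 : lipschitz_on_boxes P1.
Hypothesis LP2 : lipschitz_on_boxes P2.
Hypothesis LQ1 : lipschitz_on_boxes Q1.
Hypothesis LQ2 : lipschitz_on_boxes Q2.
Hypothesis BP1 : forall x y, Rabs (P1 x y) <= K.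
Hypothesis BP2 : forall x y, Rabs (P2 x y) <= K.
Hypothesis BQ1 : forall x y, Rabs (Q1 x y) <= K.
Hypothesis BQ2 : forall x y, Rabs (Q2 x y) <= K.

Let K_nonneg : 0 <= K.
Proof. eapply Rle_trans; [apply Rabs_pos | apply (BP1 0 0)]. Qed.

(** A curve from the origin that [(g, h)] maps to a segment of direction [(a, b)],
    see [lift_endpoint]. *)
Definition lift (a b : R) (x y : R -> R) : Prop :=
  x 0 = 0 /\ y 0 = 0 /\ forall t, 0 <= t <= 1 ->
    is_derive x t (a * P1 (x t) (y t) + b * Q1 (x t) (y t)) /\
    is_derive y t (a * P2 (x t) (y t) + b * Q2 (x t) (y t)) /\
    Rabs (x t) <= K * (Rabs a + Rabs b) /\ Rabs (y t) <= K * (Rabs a + Rabs b).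

Lemma common_lipschitz R0 : exists L, 0 < L /\ forall x y x' y',
    Rabs x <= R0 -> Rabs y <= R0 -> Rabs x' <= R0 -> Rabs y' <= R0 ->
    Rabs (P1 x y - P1 x' y') <= L * (Rabs (x - x') + Rabs (y - y')) /\
    Rabs (P2 x y - P2 x' y') <= L * (Rabs (x - x') + Rabs (y - y')) /\
    Rabs (Q1 x y - Q1 x' y') <= L * (Rabs (x - x') + Rabs (y - y')) /\
    Rabs (Q2 x y - Q2 x' y') <= L * (Rabs (x - x') + Rabs (y - y')).
Proof.
  destruct (LP1 R0) as (l1 & p1 & H1), (LP2 R0) as (l2 & p2 & H2),
    (LQ1 R0) as (l3 & p3 & H3), (LQ2 R0) as (l4 & p4 & H4).
  exists (l1 + l2 + l3 + l4). split; [lra |]. intros x y x' y' a b c d.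
  specialize (H1 x y x' y' a b c d). specialize (H2 x y x' y' a b c d).
  specialize (H3 x y x' y' a b c d). specialize (H4 x y x' y' a b c d).
  pose proof (Rabs_pos (x - x')). pose proof (Rabs_pos (y - y')).
  set (m := Rabs (x - x') + Rabs (y - y')) in *. assert (0 <= m) by (unfold m; lra).
  split; [| split; [| split]]; nra.
Qed.

Lemma combination_bound a b p q B : Rabs p <= B -> Rabs q <= B ->
  Rabs (a * p + b * q) <= (Rabs a + Rabs b) * B.
Proof.
  intros Hp Hq. eapply Rle_trans; [apply Rabs_triang |]. rewrite !Rabs_mult.
  pose proof (Rabs_pos a). pose proof (Rabs_pos b). nra.
Qed.

Lemma speed_bound (x x' : R -> R) B : 0 <= B -> x 0 = 0 -> (forall t, is_derive x t (x' t)) ->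
  (forall t, Rabs (x' t) <= B) -> forall t, 0 <= t <= 1 -> Rabs (x t) <= B.
Proof.
  intros HB H0 Hd Hb t Ht.
  pose proof (bounded_variation x x' B 0 t) as V.
  rewrite H0, !Rminus_0_r in V. eapply Rle_trans; [apply V |].
  - intros s _. split; auto.
  - rewrite Rabs_pos_eq by lra. nra.
Qed.

(** Since [P] and [Q] are bounded, solutions stay in a box for time 1. Clamping the
    argument to this box makes the equation globally Lipschitz. *)
Lemma lift_exists a b : exists x y, lift a b x y.
Proof.
  set (A := Rabs a + Rabs b). set (R0 := K * A).
  assert (HA : 0 <= A) by (unfold A; pose proof (Rabs_pos a); pose proof (Rabs_pos b); lra).
  assert (HR : 0 <= R0) by (apply Rmult_le_pos; assumption).
  destruct (common_lipschitz R0) as (L & HL & Lip).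
  set (F := fun (P Q : R -> R -> R) (_ x y : R) =>
    a * P (clamp R0 x) (clamp R0 y) + b * Q (clamp R0 x) (clamp R0 y)).
  assert (LF : forall P Q, (forall x y x' y',
      Rabs x <= R0 -> Rabs y <= R0 -> Rabs x' <= R0 -> Rabs y' <= R0 ->
      Rabs (P x y - P x' y') <= L * (Rabs (x - x') + Rabs (y - y')) /\
      Rabs (Q x y - Q x' y') <= L * (Rabs (x - x') + Rabs (y - y'))) ->
    forall t x y x' y', Rabs (F P Q t x y - F P Q t x' y') <=
      (A * L + 1) * (Rabs (x - x') + Rabs (y - y'))).
  { intros P Q HPQ t x y x' y'. unfold F.
    destruct (HPQ (clamp R0 x) (clamp R0 y) (clamp R0 x') (clamp R0 y')) as [U V];
      try (apply clamp_bound; exact HR).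
    set (m := Rabs (clamp R0 x - clamp R0 x') + Rabs (clamp R0 y - clamp R0 y')) in *.
    assert (Hm : 0 <= m <= Rabs (x - x') + Rabs (y - y')).
    { unfold m. split.
      - apply Rplus_le_le_0_compat; apply Rabs_pos.
      - apply Rplus_le_compat; apply clamp_lipschitz. }
    replace (a * P (clamp R0 x) (clamp R0 y) + b * Q (clamp R0 x) (clamp R0 y) -
      (a * P (clamp R0 x') (clamp R0 y') + b * Q (clamp R0 x') (clamp R0 y'))) with
      (a * (P (clamp R0 x) (clamp R0 y) - P (clamp R0 x') (clamp R0 y')) +
       b * (Q (clamp R0 x) (clamp R0 y) - Q (clamp R0 x') (clamp R0 y'))) by ring.
    eapply Rle_trans; [apply combination_bound; [exact U | exact V] |]. fold A.
    assert (0 <= A * L) by (apply Rmult_le_pos; lra). nra. }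
  assert (CF : forall P Q, (forall t x y x' y', Rabs (F P Q t x y - F P Q t x' y') <=
      (A * L + 1) * (Rabs (x - x') + Rabs (y - y'))) ->
    forall x y : R -> R, (forall t, continuous x t) -> (forall t, continuous y t) ->
    forall t, continuous (fun s => F P Q s (x s) (y s)) t).
  { intros P Q HF x y Cx Cy t. apply continuous_eps. intros eps He.
    assert (PL : 0 < A * L + 1) by (pose proof (Rmult_le_pos A L HA (Rlt_le _ _ HL)); lra).
    assert (He' : 0 < eps / (2 * (A * L + 1))) by (apply Rdiv_lt_0_compat; lra).
    destruct (proj1 (continuous_eps x t) (Cx t) _ He') as (d1 & Hd1 & K1).
    destruct (proj1 (continuous_eps y t) (Cy t) _ He') as (d2 & Hd2 & K2).
    exists (Rmin d1 d2). split; [apply Rmin_pos; assumption |].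
    intros s Hs. pose proof (Rmin_l d1 d2). pose proof (Rmin_r d1 d2).
    specialize (K1 s ltac:(lra)). specialize (K2 s ltac:(lra)).
    eapply Rle_lt_trans; [apply (HF t) |].
    replace eps with ((A * L + 1) * (eps / (2 * (A * L + 1)) + eps / (2 * (A * L + 1))))
      by (field; lra).
    apply Rmult_lt_compat_l; [exact PL | lra]. }
  assert (LFP := LF P1 Q1 ltac:(intros; split; apply Lip; assumption)).
  assert (LFQ := LF P2 Q2 ltac:(intros; split; apply Lip; assumption)).
  assert (BF : forall P Q, (forall x y, Rabs (P x y) <= K) -> (forall x y, Rabs (Q x y) <= K) ->
    forall t x y, Rabs (F P Q t x y) <= R0).
  { intros P Q HP HQ t x y. unfold F, R0. rewrite (Rmult_comm K). apply combination_bound; auto. }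
  destruct (ode_solution (F P1 Q1) (F P2 Q2) (A * L + 1) R0 0 0) as (x & y & x0 & y0 & Dx & Dy); auto.
  { pose proof (Rmult_le_pos A L HA (Rlt_le _ _ HL)); lra. }
  assert (Bx := speed_bound x _ R0 HR x0 Dx (fun t => BF P1 Q1 BP1 BQ1 t _ _)).
  assert (By := speed_bound y _ R0 HR y0 Dy (fun t => BF P2 Q2 BP2 BQ2 t _ _)).
  exists x, y. split; [exact x0 |]. split; [exact y0 |]. intros t Ht.
  specialize (Dx t). specialize (Dy t). specialize (Bx t Ht). specialize (By t Ht).
  unfold F in Dx, Dy. rewrite !(clamp_id R0) in Dx, Dy by assumption.
  split; [exact Dx |]. split; [exact Dy |]. split; assumption.
Qed.

Lemma lift_endpoint a b x y : lift a b x y ->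
  g (x 1) (y 1) = g 0 0 + a /\ h (x 1) (y 1) = h 0 0 + b.
Proof.
  intros (x0 & y0 & H).
  assert (Hall : forall (p px py : R -> R -> R) c,
    (forall x y, is_derive (fun s => p s y) x (px x y)) ->
    (forall x y, is_derive (fun s => p x s) y (py x y)) ->
    (forall x y, continuity_2d_pt px x y) ->
    (forall x y, a * (px x y * P1 x y + py x y * P2 x y) +
                 b * (px x y * Q1 x y + py x y * Q2 x y) = c) ->
    p (x 1) (y 1) = p 0 0 + c).
  { intros p px py c Dx Dy Cx E.
    assert (EE := eq_is_derive (fun t => p (x t) (y t) - c * t) 0 1).
    simpl in EE. rewrite x0, y0 in EE.
    assert (EE' : p 0 0 - c * 0 = p (x 1) (y 1) - c * 1); [| lra].
    apply EE; [| lra]. intros t Ht. destruct (H t Ht) as (H1 & H2 & _).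
    evar_last.
    - apply @is_derive_minus.
      + apply (chain_rule p px (py (x t) (y t)) x y t); [| apply Dy | apply Cx | exact H1 | exact H2].
        apply locally_2d_forall. intros u v. apply Dx.
      + apply (is_derive_scal (fun t => t) t c 1). apply @is_derive_id.
    - unfold minus, plus, opp; simpl. rewrite <- (E (x t) (y t)). unfold zero; simpl. ring. }
  split.
  - apply (Hall g gx gy); auto. intros u v. rewrite gP, gQ. ring.
  - apply (Hall h hx hy); auto. intros u v. rewrite hP, hQ. ring.
Qed.

(** Gronwall's inequality for the squared distance of two lifts; the term
    [K * dl] accounts for the difference of the two directions. *)
Lemma lift_dependence a b x y : lift a b x y -> exists C, 0 < C /\
  forall a' b' x' y', Rabs (a' - a) <= 1 -> Rabs (b' - b) <= 1 -> lift a' b' x' y' ->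
    Rabs (x' 1 - x 1) <= C * (Rabs (a' - a) + Rabs (b' - b)) /\
    Rabs (y' 1 - y 1) <= C * (Rabs (a' - a) + Rabs (b' - b)).
Proof.
  intros (x0 & y0 & H).
  set (A := Rabs a + Rabs b). set (R0 := K * (A + 2)).
  assert (HA : 0 <= A) by (unfold A; pose proof (Rabs_pos a); pose proof (Rabs_pos b); lra).
  destruct (common_lipschitz R0) as (L & HL & Lip).
  set (k := 4 * A * L + 2).
  assert (HAL : 0 <= A * L) by (apply Rmult_le_pos; lra).
  exists ((K + 1) * exp (k / 2)). split.
  { apply Rmult_lt_0_compat; [lra | apply exp_pos]. }
  intros a' b' x' y' Ha Hb (x0' & y0' & H').
  set (dl := Rabs (a' - a) + Rabs (b' - b)).
  assert (Hdl : 0 <= dl) by (unfold dl; pose proof (Rabs_pos (a' - a)); pose proof (Rabs_pos (b' - b)); lra).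
  assert (HA' : Rabs a' + Rabs b' <= A + 2).
  { unfold A. pose proof (Rabs_triang (a' - a) a). pose proof (Rabs_triang (b' - b) b).
    replace (a' - a + a) with a' in * by ring. replace (b' - b + b) with b' in * by ring. lra. }
  set (E := fun t => (x' t - x t) * (x' t - x t) + (y' t - y t) * (y' t - y t) + K * dl * (K * dl)).
  assert (Hdiff : forall m p q p' q', Rabs (p' - p) <= L * m -> Rabs (q' - q) <= L * m ->
     Rabs p' <= K -> Rabs q' <= K ->
     Rabs ((a' * p' + b' * q') - (a * p + b * q)) <= A * L * m + K * dl).
  { intros m p q p' q' U V Bp Bq.
    replace (a' * p' + b' * q' - (a * p + b * q)) with
      ((a * (p' - p) + b * (q' - q)) + ((a' - a) * p' + (b' - b) * q')) by ring.
    eapply Rle_trans; [apply Rabs_triang |].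
    pose proof (combination_bound a b _ _ _ U V) as B1.
    pose proof (combination_bound (a' - a) (b' - b) _ _ _ Bp Bq) as B2.
    fold A in B1. fold dl in B2. lra. }
  assert (HE : forall t, 0 <= t <= 1 -> exists e, is_derive E t e /\ e <= k * E t).
  { intros t Ht. destruct (H t Ht) as (d1 & d2 & b1 & b2), (H' t Ht) as (d1' & d2' & b1' & b2').
    eexists. split.
    - unfold E. apply @is_derive_plus; [apply @is_derive_plus; apply is_derive_Rmult;
        apply @is_derive_minus; eassumption | apply @is_derive_const].
    - unfold plus, minus, zero, opp; simpl. unfold E, k.
      assert (RR : K * A <= R0) by (unfold R0; apply Rmult_le_compat_l; lra).
      assert (RR' : K * (Rabs a' + Rabs b') <= R0) by (unfold R0; apply Rmult_le_compat_l; lra).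
      fold A in b1, b2.
      destruct (Lip (x' t) (y' t) (x t) (y t)) as (l1 & l2 & l3 & l4); try lra.
      set (m := Rabs (x' t - x t) + Rabs (y' t - y t)) in *.
      pose proof (Hdiff m _ _ _ _ l1 l3 (BP1 _ _) (BQ1 _ _)) as q1.
      pose proof (Hdiff m _ _ _ _ l2 l4 (BP2 _ _) (BQ2 _ _)) as q2.
      match type of q1 with Rabs (?A - ?B) <= _ => set (v1 := A - B) in q1;
        change (plus A (- B)) with v1 end.
      match type of q2 with Rabs (?A - ?B) <= _ => set (v2 := A - B) in q2;
        change (plus A (- B)) with v2 end.
      set (ex := x' t - x t) in *. set (ey := y' t - y t) in *.
      assert (Hm2 : m * m <= 2 * (ex * ex + ey * ey)).
      { unfold m. rewrite <- (Rabs_pos_eq (ex * ex)), <- (Rabs_pos_eq (ey * ey)) by nra.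
        rewrite !Rabs_mult. pose proof (Rle_0_sqr (Rabs ex - Rabs ey)) as S. unfold Rsqr in S. lra. }
      assert (T : ex * v1 + ey * v2 <= m * (A * L * m + K * dl)).
      { eapply Rle_trans; [apply Rle_abs |]. eapply Rle_trans; [apply Rabs_triang |].
        rewrite !Rabs_mult. unfold m at 1. pose proof (Rabs_pos ex). pose proof (Rabs_pos ey). nra. }
      assert (T2 : m * (K * dl) <= (m * m + K * dl * (K * dl)) / 2)
        by (pose proof (Rle_0_sqr (m - K * dl)) as S; unfold Rsqr in S; lra).
      assert (T3 : A * L * (m * m) <= A * L * (2 * (ex * ex + ey * ey)))
        by (apply Rmult_le_compat_l; assumption).
      assert (T4 : 0 <= A * L * (K * dl * (K * dl))) by (apply Rmult_le_pos; [assumption | apply Rle_0_sqr]).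
      pose proof (Rle_0_sqr (K * dl)) as S. unfold Rsqr in S.
      lra. }
  (* E exp (- k t) is nonincreasing *)
  set (G := fun t => - (E t * exp (- (k * t)))).
  assert (HG : G 0 <= G 1).
  { apply (derive_nonneg_incr G (fun t => (k * E t - Derive E t) * exp (- (k * t))) 0 1); [lra | |];
      intros t Ht; destruct (HE t Ht) as (e & He & Hle); rewrite (is_derive_unique _ _ _ He).
    - unfold G. evar_last.
      + apply @is_derive_opp, is_derive_Rmult; [exact He |].
        instantiate (1 := - k * exp (- (k * t))). auto_derive; [exact I | ring].
      + unfold opp; simpl. ring.
    - apply Rmult_le_pos; [lra | apply Rlt_le, exp_pos]. }
  set (B := K * dl * exp (k / 2)).
  assert (HE1 : E 1 <= B * B).
  { unfold G in HG. rewrite Rmult_0_r, Ropp_0, exp_0, Rmult_1_r, Rmult_1_r in HG.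
    assert (E0 : E 0 = K * dl * (K * dl)) by (unfold E; rewrite x0, y0, x0', y0'; ring).
    rewrite E0 in HG. apply Ropp_le_cancel in HG.
    apply Rmult_le_compat_r with (r := exp k) in HG; [| apply Rlt_le, exp_pos].
    rewrite Rmult_assoc, <- exp_plus, Rplus_opp_l, exp_0, Rmult_1_r in HG.
    replace (exp k) with (exp (k / 2) * exp (k / 2)) in HG by (rewrite <- exp_plus; f_equal; field).
    unfold B. lra. }
  assert (HB0 : 0 <= B) by (unfold B; apply Rmult_le_pos; [apply Rmult_le_pos; assumption | apply Rlt_le, exp_pos]).
  assert (BC : B <= (K + 1) * exp (k / 2) * dl).
  { unfold B. pose proof (exp_pos (k / 2)). assert (0 <= exp (k / 2) * dl) by (apply Rmult_le_pos; lra). lra. }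
  unfold E in HE1. pose proof (Rle_0_sqr (K * dl)) as S. pose proof (Rle_0_sqr (x' 1 - x 1)) as Sx.
  pose proof (Rle_0_sqr (y' 1 - y 1)) as Sy. unfold Rsqr in *.
  split; (eapply Rle_trans; [apply (square_bound _ B HB0); lra | exact BC]).
Qed.

Definition endpoint (a b : R) : R * R :=
  epsilon (inhabits (0, 0)) (fun z => exists x y, lift a b x y /\ z = (x 1, y 1)).

Let r u v := fst (endpoint (u - g 0 0) (v - h 0 0)).
Let s u v := snd (endpoint (u - g 0 0) (v - h 0 0)).

Lemma endpoint_spec u v : exists x y,
  lift (u - g 0 0) (v - h 0 0) x y /\ r u v = x 1 /\ s u v = y 1.
Proof.
  destruct (lift_exists (u - g 0 0) (v - h 0 0)) as (x & y & Hl).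
  destruct (epsilon_spec (inhabits (0, 0))
    (fun z => exists x y, lift (u - g 0 0) (v - h 0 0) x y /\ z = (x 1, y 1))) as (x' & y' & Hl' & E).
  { exists (x 1, y 1), x, y. auto. }
  exists x', y'. split; [exact Hl' |].
  unfold r, s, endpoint. rewrite E. split; reflexivity.
Qed.

Lemma section_right u v : g (r u v) (s u v) = u /\ h (r u v) (s u v) = v.
Proof.
  destruct (endpoint_spec u v) as (x & y & Hl & -> & ->).
  destruct (lift_endpoint _ _ _ _ Hl) as [-> ->]. split; ring.
Qed.

Lemma section_cont u v : continuity_2d_pt r u v /\ continuity_2d_pt s u v.
Proof.
  destruct (endpoint_spec u v) as (x & y & Hl & Er & Es).
  destruct (lift_dependence _ _ _ _ Hl) as (C & HC & HB).
  assert (B : forall u' v', Rabs (u' - u) <= 1 -> Rabs (v' - v) <= 1 ->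
    Rabs (r u' v' - r u v) <= C * (Rabs (u' - u) + Rabs (v' - v)) /\
    Rabs (s u' v' - s u v) <= C * (Rabs (u' - u) + Rabs (v' - v))).
  { intros u' v' Hu Hv. destruct (endpoint_spec u' v') as (x' & y' & Hl' & -> & ->).
    rewrite Er, Es.
    assert (E1 : u' - g 0 0 - (u - g 0 0) = u' - u) by ring.
    assert (E2 : v' - h 0 0 - (v - h 0 0) = v' - v) by ring.
    specialize (HB _ _ x' y' ltac:(rewrite E1; exact Hu) ltac:(rewrite E2; exact Hv) Hl').
    rewrite E1, E2 in HB. exact HB. }
  assert (Pd : forall eps : posreal, 0 < Rmin 1 (eps / (2 * C))).
  { intros eps. apply Rmin_pos; [lra |]. apply Rdiv_lt_0_compat; [apply cond_pos | lra]. }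
  assert (Hs : forall (eps : posreal) u' v', Rabs (u' - u) < Rmin 1 (eps / (2 * C)) ->
     Rabs (v' - v) < Rmin 1 (eps / (2 * C)) -> Rabs (u' - u) <= 1 /\ Rabs (v' - v) <= 1 /\
     C * (Rabs (u' - u) + Rabs (v' - v)) < eps).
  { intros eps u' v' Hu Hv. pose proof (Rmin_l 1 (eps / (2 * C))). pose proof (Rmin_r 1 (eps / (2 * C))).
    split; [lra |]. split; [lra |].
    replace (pos eps) with (C * (eps / (2 * C) + eps / (2 * C))) by (field; lra).
    apply Rmult_lt_compat_l; lra. }
  split; intros eps; exists (mkposreal _ (Pd eps)); simpl; intros u' v' Hu Hv;
    destruct (Hs eps u' v' Hu Hv) as (q1 & q2 & q3); destruct (B u' v' q1 q2); lra.
Qed.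

(** The mean value theorem expresses the increments of [g] and [h] through partial
    derivatives at points of the square, and a matrix with entries close to those
    of the differential at the centre is invertible. *)
Lemma locally_injective x0 y0 : exists d, 0 < d /\ forall x y x' y',
  Rabs (x - x0) < d -> Rabs (y - y0) < d -> Rabs (x' - x0) < d -> Rabs (y' - y0) < d ->
  g x y = g x' y' -> h x y = h x' y' -> x = x' /\ y = y'.
Proof.
  set (J := gx x0 y0 * hy x0 y0 - gy x0 y0 * hx x0 y0).
  assert (HJ : J <> 0).
  { intros E.
    assert (X : (gx x0 y0 * P1 x0 y0 + gy x0 y0 * P2 x0 y0) * (hx x0 y0 * Q1 x0 y0 + hy x0 y0 * Q2 x0 y0)
      - (hx x0 y0 * P1 x0 y0 + hy x0 y0 * P2 x0 y0) * (gx x0 y0 * Q1 x0 y0 + gy x0 y0 * Q2 x0 y0)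
      = J * (P1 x0 y0 * Q2 x0 y0 - P2 x0 y0 * Q1 x0 y0)) by (unfold J; ring).
    rewrite gP, hP, gQ, hQ, E in X. lra. }
  set (S := 1 + Rabs (gx x0 y0) + Rabs (gy x0 y0) + Rabs (hx x0 y0) + Rabs (hy x0 y0)).
  assert (HS : 1 <= S).
  { unfold S. pose proof (Rabs_pos (gx x0 y0)). pose proof (Rabs_pos (gy x0 y0)).
    pose proof (Rabs_pos (hx x0 y0)). pose proof (Rabs_pos (hy x0 y0)). lra. }
  apply Rabs_pos_lt in HJ.
  set (e := Rmin 1 (Rabs J / (4 * S))).
  assert (He : 0 < e) by (apply Rmin_pos; [lra | apply Rdiv_lt_0_compat; lra]).
  assert (He1 : e <= 1) by apply Rmin_l.
  assert (HeJ : 4 * S * e <= Rabs J).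
  { assert (X : e <= Rabs J / (4 * S)) by apply Rmin_r.
    apply Rmult_le_compat_l with (r := 4 * S) in X; [| lra].
    replace (4 * S * (Rabs J / (4 * S))) with (Rabs J) in X by (field; lra). exact X. }
  assert (HJ' : forall p q p' q', Rabs (p - gx x0 y0) < e -> Rabs (q - gy x0 y0) < e ->
     Rabs (p' - hx x0 y0) < e -> Rabs (q' - hy x0 y0) < e -> p * q' - q * p' <> 0).
  { intros p q p' q' h1 h2 h3 h4 E0.
    assert (X : - J = (p - gx x0 y0) * hy x0 y0 + (q' - hy x0 y0) * p
                      - (q - gy x0 y0) * hx x0 y0 - (p' - hx x0 y0) * q).
    { transitivity (p * q' - q * p' - J); [rewrite E0; ring | unfold J; ring]. }
    assert (Y : Rabs J <= e * Rabs (hy x0 y0) + e * Rabs p + e * Rabs (hx x0 y0) + e * Rabs q).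
    { rewrite <- Rabs_Ropp, X.
      assert (T : forall a b c, Rabs a < e -> Rabs b <= c -> Rabs (a * b) <= e * c).
      { intros a b c U V. rewrite Rabs_mult. pose proof (Rabs_pos a). pose proof (Rabs_pos b). nra. }
      pose proof (T _ (hy x0 y0) _ h1 (Rle_refl _)). pose proof (T _ p _ h4 (Rle_refl _)).
      pose proof (T _ (hx x0 y0) _ h2 (Rle_refl _)). pose proof (T _ q _ h3 (Rle_refl _)).
      unfold Rminus. eapply Rle_trans; [apply Rabs_triang |]. rewrite Rabs_Ropp.
      eapply Rle_trans; [apply Rplus_le_compat_r, Rabs_triang |]. rewrite Rabs_Ropp.
      eapply Rle_trans; [apply Rplus_le_compat_r, Rplus_le_compat_r, Rabs_triang |].
      unfold Rminus in *. lra. }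
    assert (Zp : Rabs p < Rabs (gx x0 y0) + 1).
    { pose proof (Rabs_triang (p - gx x0 y0) (gx x0 y0)) as T.
      replace (p - gx x0 y0 + gx x0 y0) with p in T by ring. lra. }
    assert (Zq : Rabs q < Rabs (gy x0 y0) + 1).
    { pose proof (Rabs_triang (q - gy x0 y0) (gy x0 y0)) as T.
      replace (q - gy x0 y0 + gy x0 y0) with q in T by ring. lra. }
    assert (W : Rabs J < e * (S + S)).
    { eapply Rle_lt_trans; [apply Y |]. rewrite <- !Rmult_plus_distr_l.
      apply Rmult_lt_compat_l; [exact He |]. unfold S. unfold S in HS.
      pose proof (Rabs_pos (gx x0 y0)). pose proof (Rabs_pos (gy x0 y0)).
      pose proof (Rabs_pos (hx x0 y0)). pose proof (Rabs_pos (hy x0 y0)). lra. }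
    nra. }
  destruct (Cgx x0 y0 (mkposreal e He)) as [d1 D1], (Cgy x0 y0 (mkposreal e He)) as [d2 D2],
    (Chx x0 y0 (mkposreal e He)) as [d3 D3], (Chy x0 y0 (mkposreal e He)) as [d4 D4].
  simpl in D1, D2, D3, D4.
  set (d := Rmin (Rmin d1 d2) (Rmin d3 d4)).
  assert (Hd : d <= d1 /\ d <= d2 /\ d <= d3 /\ d <= d4).
  { unfold d. pose proof (Rmin_l (Rmin d1 d2) (Rmin d3 d4)). pose proof (Rmin_r (Rmin d1 d2) (Rmin d3 d4)).
    pose proof (Rmin_l d1 d2). pose proof (Rmin_r d1 d2). pose proof (Rmin_l d3 d4).
    pose proof (Rmin_r d3 d4). lra. }
  exists d. split; [unfold d; repeat apply Rmin_pos; apply cond_pos |].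
  intros x y x' y' Hx Hy Hx' Hy' Eg Eh.
  assert (Hbox : forall z0 a b c, Rabs (a - z0) < d -> Rabs (b - z0) < d ->
    Rmin a b <= c <= Rmax a b -> Rabs (c - z0) < d).
  { intros z0 a b c Ha Hb Hc. apply Rabs_def2 in Ha. apply Rabs_def2 in Hb. apply Rabs_def1;
    unfold Rmin, Rmax in Hc; destruct (Rle_dec a b); lra. }
  assert (HM : forall (p px py : R -> R -> R),
    (forall x y, is_derive (fun s => p s y) x (px x y)) ->
    (forall x y, is_derive (fun s => p x s) y (py x y)) -> p x y = p x' y' ->
    exists c e', Rabs (c - x0) < d /\ Rabs (e' - y0) < d /\
      px c y * (x - x') + py x' e' * (y - y') = 0).
  { intros p px py Dx Dy E.
    destruct (MVT_gen (fun s => p s y) x' x (fun s => px s y)) as (c & Hc & E1).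
    { intros z _. apply Dx. }
    { intros z _. apply continuity_pt_filterlim. apply (is_derive_continuous _ z _ (Dx z y)). }
    destruct (MVT_gen (fun s => p x' s) y' y (fun s => py x' s)) as (e' & He' & E2).
    { intros z _. apply Dy. }
    { intros z _. apply continuity_pt_filterlim. apply (is_derive_continuous _ z _ (Dy x' z)). }
    exists c, e'. split; [apply (Hbox x0 x' x); assumption |].
    split; [apply (Hbox y0 y' y); assumption |]. lra. }
  destruct (HM g gx gy Dgx Dgy Eg) as (c & e' & Hc & He' & E1).
  destruct (HM h hx hy Dhx Dhy Eh) as (c2 & e2 & Hc2 & He2 & E2).
  assert (NJ : gx c y * hy x' e2 - gy x' e' * hx c2 y <> 0).
  { apply HJ'; [apply D1 | apply D2 | apply D3 | apply D4]; lra. }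
  split.
  - apply Rminus_diag_uniq.
    apply Rmult_eq_reg_l with (gx c y * hy x' e2 - gy x' e' * hx c2 y); [| exact NJ].
    transitivity (hy x' e2 * (gx c y * (x - x') + gy x' e' * (y - y'))
       - gy x' e' * (hx c2 y * (x - x') + hy x' e2 * (y - y'))); [ring |]. rewrite E1, E2. ring.
  - apply Rminus_diag_uniq.
    apply Rmult_eq_reg_l with (gx c y * hy x' e2 - gy x' e' * hx c2 y); [| exact NJ].
    transitivity (gx c y * (hx c2 y * (x - x') + hy x' e2 * (y - y'))
       - hx c2 y * (gx c y * (x - x') + gy x' e' * (y - y'))); [ring |]. rewrite E1, E2. ring.
Qed.

Let g_cont x y : continuity_2d_pt g x y.
Proof. apply (C1_cont g gx (gy x y)); auto. apply locally_2d_forall; auto. Qed.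
Let h_cont x y : continuity_2d_pt h x y.
Proof. apply (C1_cont h hx (hy x y)); auto. apply locally_2d_forall; auto. Qed.

Lemma continuity_2d_ray (p : R -> R -> R) a b t :
  continuity_2d_pt p (t * a) (t * b) -> continuous (fun z => p (z * a) (z * b)) t.
Proof.
  intros Hp. apply continuous_eps. intros eps He. destruct (Hp (mkposreal eps He)) as [d Hd].
  assert (L : forall c, exists e, 0 < e /\ forall z, Rabs (z - t) < e -> Rabs (z * c - t * c) < d).
  { intros c. apply (proj1 (continuous_eps (fun z => z * c) t)); [| apply cond_pos].
    apply (ex_derive_continuous (fun z => z * c)). auto_derive. exact I. }
  destruct (L a) as (e1 & He1 & L1), (L b) as (e2 & He2 & L2).
  exists (Rmin e1 e2). split; [apply Rmin_pos; assumption |]. intros z Hz.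
  pose proof (Rmin_l e1 e2). pose proof (Rmin_r e1 e2). apply Hd; [apply L1 | apply L2]; lra.
Qed.

(** On a ray from the origin, the points fixed by the section composed with
    [(g, h)] form an open set by local injectivity and a closed set by continuity,
    and the origin is one of them. *)
Lemma section_left x y : r (g x y) (h x y) = x /\ s (g x y) (h x y) = y.
Proof.
  set (rr := fun x y => r (g x y) (h x y)). set (ss := fun x y => s (g x y) (h x y)).
  assert (Crr : forall x y, continuity_2d_pt rr x y)
    by (intros; apply (continuity_2d_comp r g h); auto; apply section_cont).
  assert (Css : forall x y, continuity_2d_pt ss x y)
    by (intros; apply (continuity_2d_comp s g h); auto; apply section_cont).
  set (P := fun t => rr (t * x) (t * y) = t * x /\ ss (t * x) (t * y) = t * y).
  assert (Cr : forall t, continuous (fun z => rr (z * x) (z * y) - z * x) t).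
  { intros t. apply continuous_Rminus; [apply (continuity_2d_ray rr), Crr |].
    apply (continuity_2d_ray (fun u _ => u) x y), continuity_2d_pt_id1. }
  assert (Cs : forall t, continuous (fun z => ss (z * x) (z * y) - z * y) t).
  { intros t. apply continuous_Rminus; [apply (continuity_2d_ray ss), Css |].
    apply (continuity_2d_ray (fun _ u => u) x y), continuity_2d_pt_id2. }
  assert (H1 : P 1).
  { refine (clopen_interval m_infty p_infty P _ _ 0 1 I I I I _).
    - intros t _ _ [Pr Ps].
      destruct (locally_injective (t * x) (t * y)) as (d & Hd & Inj).
      assert (L : forall (z0 : R) (f : R -> R), continuous f t -> f t = z0 ->
        locally t (fun z => Rabs (f z - z0) < d)).
      { intros z0 f Cf Ef. apply (Cf (fun w => Rabs (w - z0) < d)). rewrite Ef.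
        exists (mkposreal d Hd). intros w Hw. exact Hw. }
      assert (La := L (t * x) (fun z => z * x) (continuity_2d_ray (fun u _ => u) x y t (continuity_2d_pt_id1 _ _)) eq_refl).
      assert (Lb := L (t * y) (fun z => z * y) (continuity_2d_ray (fun _ u => u) x y t (continuity_2d_pt_id2 _ _)) eq_refl).
      assert (Lc := L (t * x) _ (continuity_2d_ray rr x y t (Crr _ _)) Pr).
      assert (Ld := L (t * y) _ (continuity_2d_ray ss x y t (Css _ _)) Ps).
      generalize (filter_and _ _ (filter_and _ _ La Lb) (filter_and _ _ Lc Ld)).
      apply filter_imp. intros z [[a b] [c e]].
      destruct (section_right (g (z * x) (z * y)) (h (z * x) (z * y))) as [R1 R2].
      apply Inj; auto.
    - intros t _ _ NP.
      destruct (Req_dec (rr (t * x) (t * y) - t * x) 0) as [E1|E1].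
      + destruct (Req_dec (ss (t * x) (t * y) - t * y) 0) as [E2|E2].
        * exfalso. apply NP. split; lra.
        * assert (LL : locally t (fun z => ss (z * x) (z * y) - z * y <> 0))
             by exact (Cs t (fun w => w <> 0) (locally_neq0 _ E2)).
           generalize LL. apply filter_imp.
          intros z Hz [_ Pz]. apply Hz. lra.
      + assert (LL : locally t (fun z => rr (z * x) (z * y) - z * x <> 0))
          by exact (Cr t (fun w => w <> 0) (locally_neq0 _ E1)).
        generalize LL. apply filter_imp.
        intros z Hz [Pz _]. apply Hz. lra.
    - unfold P, rr, ss. rewrite !Rmult_0_l.
      destruct (endpoint_spec (g 0 0) (h 0 0)) as (x1 & y1 & (z1 & z2 & Hl) & -> & ->).
      rewrite !Rminus_diag in Hl.
      assert (V : forall f : R -> R, f 0 = 0 -> (forall t, 0 <= t <= 1 -> is_derive f t 0) -> f 1 = 0).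
      { intros f F0 Fd. rewrite <- F0. symmetry. apply eq_is_derive; [exact Fd | lra]. }
      split; apply V; auto; intros t Ht; destruct (Hl t Ht) as (D1 & D2 & _).
      + evar_last; [exact D1 | ring]. + evar_last; [exact D2 | ring]. }
  unfold P, rr, ss in H1. rewrite !Rmult_1_l in H1. exact H1.
Qed.

Theorem hadamard : exists r s : R -> R -> R,
  (forall u v, continuity_2d_pt r u v) /\ (forall u v, continuity_2d_pt s u v) /\
  (forall u v, g (r u v) (s u v) = u /\ h (r u v) (s u v) = v) /\
  (forall x y, r (g x y) (h x y) = x /\ s (g x y) (h x y) = y).
Proof.
  exists r, s. split; [intros; apply section_cont |]. split; [intros; apply section_cont |].
  split; [apply section_right | apply section_left].
Qed.
End Hadamard.

(** * The map (B) *)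

Definition form_A (w1 w2 : R -> R) (u v : R) : sym2 :=
  Sym2 (- cos (2 * w1 u)) (- cos (w1 u - w2 v)) (- cos (2 * w2 v)).

Definition map_x (w1 w2 : R -> R) c u v := RInt (fun s => cos (w1 s)) 0 u + RInt (fun s => cos (w2 s)) 0 v + c.
Definition map_y (w1 w2 : R -> R) c u v := RInt (fun s => sin (w1 s)) 0 u - RInt (fun s => sin (w2 s)) 0 v + c.

Lemma continuous_cos_comp (w : R -> R) t : continuous w t -> continuous (fun s => cos (w s)) t.
Proof. intros H. apply (continuous_comp w cos); [exact H | apply continuous_cos]. Qed.
Lemma continuous_sin_comp (w : R -> R) t : continuous w t -> continuous (fun s => sin (w s)) t.
Proof. intros H. apply (continuous_comp w sin); [exact H | apply continuous_sin]. Qed.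

Section MapB.
Variables w1 w2 : R -> R.
Hypothesis C1 : forall t, continuous w1 t.
Hypothesis C2 : forall t, continuous w2 t.

Lemma map_x_partial c i u v : is_partial i (map_x w1 w2 c) u v
  (match i with Cu => cos (w1 u) | Cv => cos (w2 v) end).
Proof.
  unfold map_x. evar_last.
  - apply is_partial_plus; [apply is_partial_plus |].
    + apply (is_partial_of_fst i (fun x => RInt (fun s => cos (w1 s)) 0 x)).
      apply (is_derive_primitive (fun s => cos (w1 s))). intros s. apply continuous_cos_comp, C1.
    + apply (is_partial_of_snd i (fun x => RInt (fun s => cos (w2 s)) 0 x)).
      apply (is_derive_primitive (fun s => cos (w2 s))). intros s. apply continuous_cos_comp, C2.
    + apply is_partial_const.
  - destruct i; ring.
Qed.

Lemma map_y_partial c i u v : is_partial i (map_y w1 w2 c) u v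
  (match i with Cu => sin (w1 u) | Cv => - sin (w2 v) end).
Proof.
  unfold map_y. evar_last.
  - apply is_partial_plus; [apply is_partial_minus |].
    + apply (is_partial_of_fst i (fun x => RInt (fun s => sin (w1 s)) 0 x)).
      apply (is_derive_primitive (fun s => sin (w1 s))). intros s. apply continuous_sin_comp, C1.
    + apply (is_partial_of_snd i (fun x => RInt (fun s => sin (w2 s)) 0 x)).
      apply (is_derive_primitive (fun s => sin (w2 s))). intros s. apply continuous_sin_comp, C2.
    + apply is_partial_const.
  - destruct i; ring.
Qed.
End MapB.

Lemma Cinf_snd_fun D w : smooth1 w -> Cinf D (fun _ y => w y).
Proof. intros H. apply (Cinf_fun_comp D w (fun _ y => y)); [exact H | apply Cinf_snd]. Qed.

Section SmoothMapB.
Variables w1 w2 : R -> R.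
Hypothesis S1 : smooth1 w1.
Hypothesis S2 : smooth1 w2.

Let C1 t : continuous w1 t := smooth1_continuous w1 t S1.
Let C2 t : continuous w2 t := smooth1_continuous w2 t S2.

Lemma map_x_Cinf c : Cinf everywhere (map_x w1 w2 c).
Proof.
  apply Cinf_of_partials with (fun u _ => cos (w1 u)) (fun _ v => cos (w2 v)).
  - intros u v. apply (map_x_partial w1 w2 C1 C2 c Cu).
  - intros u v. apply (map_x_partial w1 w2 C1 C2 c Cv).
  - apply Cinf_cos, Cinf_fun_fst, S1.
  - apply Cinf_cos, Cinf_snd_fun, S2.
Qed.

Lemma map_y_Cinf c : Cinf everywhere (map_y w1 w2 c).
Proof.
  apply Cinf_of_partials with (fun u _ => sin (w1 u)) (fun _ v => - sin (w2 v)).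
  - intros u v. apply (map_y_partial w1 w2 C1 C2 c Cu).
  - intros u v. apply (map_y_partial w1 w2 C1 C2 c Cv).
  - apply Cinf_sin, Cinf_fun_fst, S1.
  - apply Cinf_opp, Cinf_sin, Cinf_snd_fun, S2.
Qed.

(** So (B) is a local isometry to the Lorentz plane; the isometry statements rest
    on this fact. *)
Lemma pullback_map_B c1 c2 u v : pullback (map_B w1 w2 c1 c2) gL2 u v = form_A w1 w2 u v.
Proof.
  unfold pullback, compose, partial_map.
  change (fun s t => fst (map_B w1 w2 c1 c2 s t)) with (map_x w1 w2 c1).
  change (fun s t => snd (map_B w1 w2 c1 c2 s t)) with (map_y w1 w2 c2).
  rewrite !(is_partial_unique _ _ _ _ _ (map_x_partial w1 w2 C1 C2 c1 _ u v)).
  rewrite !(is_partial_unique _ _ _ _ _ (map_y_partial w1 w2 C1 C2 c2 _ u v)).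
  unfold bil, gL2, form_A; simpl. rewrite !cos_2a, cos_minus. f_equal; ring.
Qed.
End SmoothMapB.

(** * Diffeomorphisms of the plane *)

Lemma diffeo_of_inverse (D D' : R -> R -> Prop) (p q r s : R -> R -> R) :
  open_region D -> open_region D' -> Cinf D p -> Cinf D q ->
  (forall x y, D x y -> partial Cu p x y * partial Cv q x y - partial Cv p x y * partial Cu q x y <> 0) ->
  all_on D' (continuity_2d_pt r) -> all_on D' (continuity_2d_pt s) ->
  (forall x y, D x y -> D' (p x y) (q x y) /\ r (p x y) (q x y) = x /\ s (p x y) (q x y) = y) ->
  (forall x y, D' x y -> D (r x y) (s x y) /\ p (r x y) (s x y) = x /\ q (r x y) (s x y) = y) ->
  diffeo_between (fun z => D (fst z) (snd z)) (fun z => D' (fst z) (snd z)) (fun u v => (p u v, q u v)).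
Proof.
  intros HD HD' Hp Hq HJ Hr Hs H1 H2.
  destruct (inverse_smooth D D' HD HD' p q r s Hp Hq HJ) as [Sr Ss]; auto.
  - intros x y Dxy. apply H2, Dxy.
  - intros x y Dxy. apply H2, Dxy.
  - exists (fun x y => (r x y, s x y)). split.
    + intros u v Duv. destruct (H1 u v Duv) as (E1 & E2 & E3). unfold compose; simpl.
      split; [exact E1 |]. split; [f_equal; assumption |].
      split; simpl; apply (Cinf_smooth_at D); assumption.
    + intros u v Duv. destruct (H2 u v Duv) as (E1 & E2 & E3). unfold compose; simpl.
      split; [exact E1 |]. split; [f_equal; assumption |].
      split; simpl; apply (Cinf_smooth_at D'); assumption.
Qed.

Lemma global_diffeo_of_inverse (p q r s : R -> R -> R) :
  Cinf everywhere p -> Cinf everywhere q ->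
  (forall x y, partial Cu p x y * partial Cv q x y - partial Cv p x y * partial Cu q x y <> 0) ->
  (forall x y, continuity_2d_pt r x y) -> (forall x y, continuity_2d_pt s x y) ->
  (forall x y, r (p x y) (q x y) = x /\ s (p x y) (q x y) = y) ->
  (forall x y, p (r x y) (s x y) = x /\ q (r x y) (s x y) = y) ->
  global_diffeo (fun u v => (p u v, q u v)).
Proof.
  intros Hp Hq HJ Hr Hs H1 H2.
  apply (diffeo_of_inverse everywhere everywhere p q r s open_everywhere open_everywhere Hp Hq).
  - intros x y _. apply HJ.
  - intros x y _. apply Hr.
  - intros x y _. apply Hs.
  - intros x y _. split; [exact I | apply H1].
  - intros x y _. split; [exact I | apply H2].
Qed.

Definition smooth_map (phi : plane_map) : Prop :=
  Cinf everywhere (fun u v => fst (phi u v)) /\ Cinf everywhere (fun u v => snd (phi u v)).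

Lemma global_diffeo_inverse phi : global_diffeo phi -> exists psi,
  smooth_map phi /\ smooth_map psi /\ (forall u v, compose psi phi u v = (u, v)) /\
  (forall u v, compose phi psi u v = (u, v)).
Proof.
  intros (psi & H1 & H2). exists psi.
  split; [| split; [| split]].
  - split; apply smooth_at_Cinf; intros u v _; apply (H1 u v I).
  - split; apply smooth_at_Cinf; intros u v _; apply (H2 u v I).
  - intros u v. apply (H1 u v I).
  - intros u v. apply (H2 u v I).
Qed.

Lemma global_diffeo_intro phi psi : smooth_map phi -> smooth_map psi ->
  (forall u v, compose psi phi u v = (u, v)) -> (forall u v, compose phi psi u v = (u, v)) ->
  global_diffeo phi.
Proof.
  intros [S1 S2] [T1 T2] E1 E2. exists psi. split.
  - intros u v _. split; [exact I |]. split; [apply E1 |].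
    split; apply (Cinf_smooth_at everywhere); auto using open_everywhere; exact I.
  - intros u v _. split; [exact I |]. split; [apply E2 |].
    split; apply (Cinf_smooth_at everywhere); auto using open_everywhere; exact I.
Qed.

Lemma smooth_map_comp phi T : smooth_map phi -> smooth_map T -> smooth_map (compose T phi).
Proof.
  intros [S1 S2] [T1 T2]. split.
  - apply (Cinf_comp everywhere everywhere (fun u v => fst (T u v))); auto using open_everywhere.
  - apply (Cinf_comp everywhere everywhere (fun u v => snd (T u v))); auto using open_everywhere.
Qed.

Lemma global_diffeo_comp phi T : global_diffeo phi -> global_diffeo T -> global_diffeo (compose T phi).
Proof.
  intros H1 H2. destruct (global_diffeo_inverse phi H1) as (psi & A1 & A2 & A3 & A4).
  destruct (global_diffeo_inverse T H2) as (U & B1 & B2 & B3 & B4).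
  apply global_diffeo_intro with (compose psi U); try (apply smooth_map_comp; assumption).
  - intros u v. unfold compose in *. specialize (B3 (fst (phi u v)) (snd (phi u v))).
    rewrite B3; simpl. apply A3.
  - intros u v. unfold compose in *. specialize (A4 (fst (U u v)) (snd (U u v))).
    rewrite A4; simpl. apply B4.
Qed.

Definition affine (a b t c d t' : R) : plane_map := fun x y => (a * x + b * y + t, c * x + d * y + t').

Lemma affine_smooth a b t c d t' : smooth_map (affine a b t c d t').
Proof.
  assert (H : forall a b t, Cinf everywhere (fun x y => a * x + b * y + t)) by (intros; cinf).
  split; apply H.
Qed.

Lemma affine_diffeo a b t c d t' : a * d - b * c <> 0 ->
  exists a' b' s c' d' s', global_diffeo (affine a' b' s c' d' s') /\
    global_diffeo (affine a b t c d t') /\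
    (forall u v, compose (affine a' b' s c' d' s') (affine a b t c d t') u v = (u, v)).
Proof.
  intros H. set (k := a * d - b * c) in *.
  exists (d / k), (- b / k), ((b * t' - d * t) / k), (- c / k), (a / k), ((c * t - a * t') / k).
  assert (E1 : forall u v, compose (affine (d / k) (- b / k) ((b * t' - d * t) / k) (- c / k) (a / k)
     ((c * t - a * t') / k)) (affine a b t c d t') u v = (u, v)).
  { intros u v. unfold compose, affine; simpl. unfold k in *. f_equal; field; exact H. }
  assert (E2 : forall u v, compose (affine a b t c d t') (affine (d / k) (- b / k) ((b * t' - d * t) / k)
     (- c / k) (a / k) ((c * t - a * t') / k)) u v = (u, v)).
  { intros u v. unfold compose, affine; simpl. unfold k in *. f_equal; field; exact H. }
  split; [| split]; [| | exact E1].
  - apply global_diffeo_intro with (affine a b t c d t'); auto using affine_smooth.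
  - apply global_diffeo_intro with (affine (d / k) (- b / k) ((b * t' - d * t) / k) (- c / k) (a / k)
     ((c * t - a * t') / k)); auto using affine_smooth.
Qed.

(** * Global and local invertibility of (B) *)

(** The angle functions are only continuous here; they will be smooth ones, or
    smooth ones frozen outside an interval. *)
Lemma map_B_inverse (w1 w2 : R -> R) c1 c2 K :
  (forall t, continuous w1 t) -> (forall t, continuous w2 t) ->
  (forall u v, sin (w1 u + w2 v) <> 0) -> (forall u v, Rabs (/ sin (w1 u + w2 v)) <= K) ->
  lipschitz_on_boxes (fun u v => sin (w2 v) / sin (w1 u + w2 v)) ->
  lipschitz_on_boxes (fun u v => sin (w1 u) / sin (w1 u + w2 v)) ->
  lipschitz_on_boxes (fun u v => cos (w2 v) / sin (w1 u + w2 v)) ->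
  lipschitz_on_boxes (fun u v => - cos (w1 u) / sin (w1 u + w2 v)) ->
  exists r s : R -> R -> R,
  (forall u v, continuity_2d_pt r u v) /\ (forall u v, continuity_2d_pt s u v) /\
  (forall x y, map_x w1 w2 c1 (r x y) (s x y) = x /\ map_y w1 w2 c2 (r x y) (s x y) = y) /\
  (forall u v, r (map_x w1 w2 c1 u v) (map_y w1 w2 c2 u v) = u /\
               s (map_x w1 w2 c1 u v) (map_y w1 w2 c2 u v) = v).
Proof.
  intros C1 C2 Hs HK L1 L2 L3 L4.
  assert (HB : forall z u v, -1 <= z <= 1 -> Rabs (z / sin (w1 u + w2 v)) <= K).
  { intros z u v Hz. unfold Rdiv. rewrite Rabs_mult. specialize (HK u v).
    apply Rabs_le_between in Hz. pose proof (Rabs_pos (/ sin (w1 u + w2 v))).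
    pose proof (Rabs_pos z). nra. }
  assert (cont1 : forall f : R -> R, (forall t, continuous f t) -> forall u v, continuity_2d_pt (fun u _ => f u) u v).
  { intros f Cf u v. apply (continuity_1d_2d_pt_comp f (fun x _ => x)); [| apply continuity_2d_pt_id1].
    apply continuity_pt_filterlim, Cf. }
  assert (cont2 : forall f : R -> R, (forall t, continuous f t) -> forall u v, continuity_2d_pt (fun _ v => f v) u v).
  { intros f Cf u v. apply (continuity_1d_2d_pt_comp f (fun _ x => x)); [| apply continuity_2d_pt_id2].
    apply continuity_pt_filterlim, Cf. }
  apply (hadamard (map_x w1 w2 c1) (map_y w1 w2 c2)
    (fun u _ => cos (w1 u)) (fun _ v => cos (w2 v)) (fun u _ => sin (w1 u)) (fun _ v => - sin (w2 v))
    (fun u v => sin (w2 v) / sin (w1 u + w2 v)) (fun u v => sin (w1 u) / sin (w1 u + w2 v))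
    (fun u v => cos (w2 v) / sin (w1 u + w2 v)) (fun u v => - cos (w1 u) / sin (w1 u + w2 v)) K);
    try assumption.
  - intros u v. apply (map_x_partial w1 w2 C1 C2 c1 Cu).
  - intros u v. apply (map_x_partial w1 w2 C1 C2 c1 Cv).
  - intros u v. apply (map_y_partial w1 w2 C1 C2 c2 Cu).
  - intros u v. apply (map_y_partial w1 w2 C1 C2 c2 Cv).
  - apply cont1. intros t. apply continuous_cos_comp, C1.
  - apply cont2. intros t. apply continuous_cos_comp, C2.
  - apply cont1. intros t. apply continuous_sin_comp, C1.
  - apply (cont2 (fun v => - sin (w2 v))). intros t.
    apply (continuous_opp (fun v => sin (w2 v))), continuous_sin_comp, C2.
  - intros u v. specialize (Hs u v). rewrite sin_plus in *. field. exact Hs.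
  - intros u v. specialize (Hs u v). rewrite sin_plus in *. field. exact Hs.
  - intros u v. specialize (Hs u v). rewrite sin_plus in *. field. exact Hs.
  - intros u v. specialize (Hs u v). rewrite sin_plus in *. field. exact Hs.
  - intros u v. apply HB, SIN_bound.
  - intros u v. apply HB, SIN_bound.
  - intros u v. apply HB, COS_bound.
  - intros u v. apply HB. pose proof (COS_bound (w1 u)). lra.
Qed.

Section AnglePair.
Variables w1 w2 : R -> R.
Hypothesis HA : angle_pair w1 w2.

Let S1 : smooth1 w1 := proj1 HA.
Let S2 : smooth1 w2 := proj1 (proj2 HA).

Lemma sin_sum_pos u v : 0 < sin (w1 u + w2 v).
Proof. pose proof (proj2 (proj2 HA) u v) as H. apply sin_gt_0; lra. Qed.

Lemma sin_sum_neq u v : sin (w1 u + w2 v) <> 0.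
Proof. apply Rgt_not_eq, sin_sum_pos. Qed.

Lemma Cinf_sum : Cinf everywhere (fun u v => w1 u + w2 v).
Proof. apply (Cinf_plus _ (fun u _ => w1 u) (fun _ v => w2 v)); [apply Cinf_fun_fst | apply Cinf_snd_fun]; assumption. Qed.

Lemma Cinf_over_sin h : Cinf everywhere h -> Cinf everywhere (fun u v => h u v / sin (w1 u + w2 v)).
Proof.
  intros H. apply (Cinf_div _ h (fun u v => sin (w1 u + w2 v))); auto.
  - intros u v _. apply sin_sum_neq.
  - apply Cinf_sin, Cinf_sum.
Qed.

Lemma frame_Cinf :
  Cinf everywhere (fun u v => sin (w2 v) / sin (w1 u + w2 v)) /\
  Cinf everywhere (fun u v => sin (w1 u) / sin (w1 u + w2 v)) /\
  Cinf everywhere (fun u v => cos (w2 v) / sin (w1 u + w2 v)) /\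
  Cinf everywhere (fun u v => - cos (w1 u) / sin (w1 u + w2 v)).
Proof.
  split; [| split; [| split]].
  - apply (Cinf_over_sin (fun _ v => sin (w2 v))), Cinf_sin, Cinf_snd_fun, S2.
  - apply (Cinf_over_sin (fun u _ => sin (w1 u))), Cinf_sin, Cinf_fun_fst, S1.
  - apply (Cinf_over_sin (fun _ v => cos (w2 v))), Cinf_cos, Cinf_snd_fun, S2.
  - apply (Cinf_over_sin (fun u _ => - cos (w1 u))), Cinf_opp, Cinf_cos, Cinf_fun_fst, S1.
Qed.

Lemma map_B_jacobian c1 c2 u v :
  partial Cu (map_x w1 w2 c1) u v * partial Cv (map_y w1 w2 c2) u v
  - partial Cv (map_x w1 w2 c1) u v * partial Cu (map_y w1 w2 c2) u v <> 0.
Proof.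
  assert (C1 : forall t, continuous w1 t) by (intro; apply smooth1_continuous, S1).
  assert (C2 : forall t, continuous w2 t) by (intro; apply smooth1_continuous, S2).
  rewrite !(is_partial_unique _ _ _ _ _ (map_x_partial w1 w2 C1 C2 c1 _ u v)).
  rewrite !(is_partial_unique _ _ _ _ _ (map_y_partial w1 w2 C1 C2 c2 _ u v)).
  pose proof (sin_sum_neq u v) as H. rewrite sin_plus in H. lra.
Qed.

Lemma sin_interval_bound m1 m2 t : 0 < m1 -> m2 < PI -> m1 <= t <= m2 ->
  Rmin (sin m1) (sin m2) <= sin t.
Proof.
  intros H1 H2 Ht. destruct (Rle_dec t (PI / 2)) as [L|L].
  - eapply Rle_trans; [apply Rmin_l |]. apply sin_incr_1; lra.
  - eapply Rle_trans; [apply Rmin_r |]. apply sin_decr_1; lra.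
Qed.

Lemma map_B_global_of_bounds m1 m2 c1 c2 : 0 < m1 -> m2 < PI ->
  (forall u v, m1 <= w1 u + w2 v <= m2) -> global_diffeo (map_B w1 w2 c1 c2).
Proof.
  intros H1 H2 Hb.
  set (m := Rmin (sin m1) (sin m2)).
  assert (Hm : 0 < m).
  { specialize (Hb 0 0). apply Rmin_pos; apply sin_gt_0; lra. }
  destruct frame_Cinf as (F1 & F2 & F3 & F4).
  destruct (map_B_inverse w1 w2 c1 c2 (/ m)) as (r & s & R1 & R2 & R3 & R4);
    try (apply Cinf_lipschitz_on_boxes; assumption).
  - intro; apply smooth1_continuous, S1.
  - intro; apply smooth1_continuous, S2.
  - apply sin_sum_neq.
  - intros u v. pose proof (sin_sum_pos u v) as P.
    rewrite Rabs_pos_eq by (apply Rlt_le, Rinv_0_lt_compat, P).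
    apply Rinv_le_contravar; [exact Hm |]. apply sin_interval_bound; auto.
  - apply (global_diffeo_of_inverse (map_x w1 w2 c1) (map_y w1 w2 c2) r s); auto.
    + apply map_x_Cinf; assumption. + apply map_y_Cinf; assumption.
    + intros x y. apply map_B_jacobian.
Qed.

Lemma lipschitz_clamp h R0 : 0 <= R0 -> lipschitz_on_boxes h ->
  lipschitz_on_boxes (fun x y => h (clamp R0 x) (clamp R0 y)).
Proof.
  intros H0 Hh R1. destruct (Hh R0) as (L & HL & H). exists L. split; [exact HL |].
  intros x y x' y' _ _ _ _. eapply Rle_trans; [apply H; apply clamp_bound, H0 |].
  apply Rmult_le_compat_l; [lra |]. apply Rplus_le_compat; apply clamp_lipschitz.
Qed.

Lemma clamp_continuous R0 t : continuous (clamp R0) t.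
Proof.
  apply continuous_eps. intros eps He. exists eps. split; [exact He |].
  intros s Hs. eapply Rle_lt_trans; [apply clamp_lipschitz | exact Hs].
Qed.

Lemma RInt_clamp (f : R -> R) R0 u : Rabs u < R0 ->
  RInt (fun s => f (clamp R0 s)) 0 u = RInt f 0 u.
Proof.
  intros Hu. apply Rabs_def2 in Hu. apply (RInt_ext (fun s => f (clamp R0 s)) f).
  intros x Hx. rewrite clamp_id; [reflexivity |]. apply Rabs_le_between.
  unfold Rmin, Rmax in Hx. destruct (Rle_dec 0 u); lra.
Qed.

(** Freezing the angles outside a square around the point yields a global
    homeomorphism that coincides with (B) in the square. *)
Lemma map_B_local c1 c2 : local_diffeo (map_B w1 w2 c1 c2).
Proof.
  intros u0 v0. set (R0 := Rabs u0 + Rabs v0 + 1).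
  pose proof (Rabs_pos u0). pose proof (Rabs_pos v0).
  assert (HR : 0 <= R0) by (unfold R0; lra).
  set (t1 := fun s => w1 (clamp R0 s)). set (t2 := fun s => w2 (clamp R0 s)).
  destruct frame_Cinf as (F1 & F2 & F3 & F4).
  destruct (bounded_on_box (fun u v => / sin (w1 u + w2 v)) R0) as (K & HK & BK).
  { intros x y. apply continuity_2d_pt_inv; [| apply sin_sum_neq].
    apply (Cinf_cont everywhere (fun u v => sin (w1 u + w2 v)) (Cinf_sin _ _ Cinf_sum) x y I). }
  destruct (map_B_inverse t1 t2 c1 c2 K) as (r & s & R1 & R2 & R3 & R4).
  - intro t. apply (continuous_comp (clamp R0) w1); [apply clamp_continuous | apply smooth1_continuous, S1].
  - intro t. apply (continuous_comp (clamp R0) w2); [apply clamp_continuous | apply smooth1_continuous, S2].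
  - intros u v. apply sin_sum_neq.
  - intros u v. apply BK; apply clamp_bound, HR.
  - apply (lipschitz_clamp _ R0 HR (Cinf_lipschitz_on_boxes _ F1)).
  - apply (lipschitz_clamp _ R0 HR (Cinf_lipschitz_on_boxes _ F2)).
  - apply (lipschitz_clamp _ R0 HR (Cinf_lipschitz_on_boxes _ F3)).
  - apply (lipschitz_clamp _ R0 HR (Cinf_lipschitz_on_boxes _ F4)).
  - set (D := fun u v => Rabs u < R0 /\ Rabs v < R0).
    set (D' := fun x y => D (r x y) (s x y)).
    assert (HO : open_region D).
    { intros u v [Hu Hv].
      assert (Pd : 0 < Rmin (R0 - Rabs u) (R0 - Rabs v)) by (apply Rmin_pos; lra).
      exists (mkposreal _ Pd). simpl. intros u' v' Hu' Hv'.
      pose proof (Rmin_l (R0 - Rabs u) (R0 - Rabs v)). pose proof (Rmin_r (R0 - Rabs u) (R0 - Rabs v)).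
      pose proof (Rabs_triang (u' - u) u) as T1. pose proof (Rabs_triang (v' - v) v) as T2.
      replace (u' - u + u) with u' in T1 by ring. replace (v' - v + v) with v' in T2 by ring.
      split; lra. }
    assert (HO' : open_region D').
    { intros x y Dxy. destruct (HO _ _ Dxy) as [d Hd].
      destruct (R1 x y d) as [d1 H1], (R2 x y d) as [d2 H2].
      exists (mkposreal _ (Rmin_pos _ _ (cond_pos d1) (cond_pos d2))). simpl. intros x' y' Hx Hy.
      pose proof (Rmin_l d1 d2). pose proof (Rmin_r d1 d2).
      apply Hd; [apply H1 | apply H2]; lra. }
    assert (Ex : forall u v, D u v -> map_x t1 t2 c1 u v = map_x w1 w2 c1 u v).
    { intros u v [Hu Hv]. unfold map_x, t1, t2.
      rewrite (RInt_clamp (fun s => cos (w1 s)) R0 u Hu), (RInt_clamp (fun s => cos (w2 s)) R0 v Hv).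
      reflexivity. }
    assert (Ey : forall u v, D u v -> map_y t1 t2 c2 u v = map_y w1 w2 c2 u v).
    { intros u v [Hu Hv]. unfold map_y, t1, t2.
      rewrite (RInt_clamp (fun s => sin (w1 s)) R0 u Hu), (RInt_clamp (fun s => sin (w2 s)) R0 v Hv).
      reflexivity. }
    assert (HOP : forall E : R -> R -> Prop, open_region E -> open (fun z : R * R => E (fst z) (snd z))).
    { intros E HE [x y] Exy. apply (proj1 (locally_2d_locally E x y)), HE, Exy. }
    exists (fun z => D (fst z) (snd z)), (fun z => D' (fst z) (snd z)).
    split; [apply HOP, HO |]. split; [apply HOP, HO' |].
    split; [unfold D, R0; simpl; lra |].
    apply (diffeo_of_inverse D D' (map_x w1 w2 c1) (map_y w1 w2 c2) r s HO HO').
    + apply Cinf_everywhere, map_x_Cinf; assumption.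
    + apply Cinf_everywhere, map_y_Cinf; assumption.
    + intros x y _. apply map_B_jacobian.
    + intros x y _. apply R1. + intros x y _. apply R2.
    + intros u v Duv. unfold D'. rewrite <- (Ex u v Duv), <- (Ey u v Duv).
      destruct (R4 u v) as [E1 E2]. rewrite E1, E2. split; [exact Duv | split; reflexivity].
    + intros x y Dxy. split; [exact Dxy |]. rewrite <- (Ex _ _ Dxy), <- (Ey _ _ Dxy). apply R3.
Qed.
End AnglePair.

(** * Intrinsic geometry of the form I *)

Lemma pythagoras t : sin t * sin t + cos t * cos t = 1.
Proof. pose proof (sin2_cos2 t) as H. unfold Rsqr in H. exact H. Qed.

Section Consequences.
Variables w1 w2 : R -> R.
Hypothesis HA : angle_pair w1 w2.

Let S1 : smooth1 w1 := proj1 HA.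
Let S2 : smooth1 w2 := proj1 (proj2 HA).

Lemma w1_partial i u v : is_partial i (fun x _ => w1 x) u v (match i with Cu => Derive w1 u | Cv => 0 end).
Proof. apply (is_partial_of_fst i w1). apply Derive_correct, smooth1_ex_derive, S1. Qed.
Lemma w2_partial i u v : is_partial i (fun _ y => w2 y) u v (match i with Cu => 0 | Cv => Derive w2 v end).
Proof. apply (is_partial_of_snd i w2). apply Derive_correct, smooth1_ex_derive, S2. Qed.

Local Hint Resolve w1_partial w2_partial : core.

Let dw1 i u := match i with Cu => Derive w1 u | Cv => 0 end.
Let dw2 i v := match i with Cu => 0 | Cv => Derive w2 v end.

(** The orthonormal basis is the parallel frame: (B) maps it to the coordinate
    vectors of the Lorentz plane. *)
Lemma form_A_lorentzian u v : lorentzian (form_A w1 w2 u v).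
Proof.
  pose proof (sin_sum_neq w1 w2 HA u v) as H.
  exists (sin (w2 v) / sin (w1 u + w2 v), sin (w1 u) / sin (w1 u + w2 v)),
    (cos (w2 v) / sin (w1 u + w2 v), - cos (w1 u) / sin (w1 u + w2 v)).
  unfold bil, form_A; simpl. rewrite !cos_2a, cos_minus. rewrite sin_plus in *.
  split; [| split]; field; exact H.
Qed.

Definition dform_A (m i j : coord) (u v : R) : R :=
  match i, j with
  | Cu, Cu => 2 * dw1 m u * sin (2 * w1 u)
  | Cv, Cv => 2 * dw2 m v * sin (2 * w2 v)
  | _, _ => (dw1 m u - dw2 m v) * sin (w1 u - w2 v)
  end.

Lemma form_A_partial m i j u v : is_partial m (fun s t => entry (form_A w1 w2 s t) i j) u v (dform_A m i j u v).
Proof.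
  assert (HE : is_partial m (fun s _ => - cos (2 * w1 s)) u v (2 * dw1 m u * sin (2 * w1 u)))
    by (evar_last; [partials | unfold dw1; destruct m; ring]).
  assert (HG : is_partial m (fun _ t => - cos (2 * w2 t)) u v (2 * dw2 m v * sin (2 * w2 v)))
    by (evar_last; [partials | unfold dw2; destruct m; ring]).
  assert (HF : is_partial m (fun s t => - cos (w1 s - w2 t)) u v ((dw1 m u - dw2 m v) * sin (w1 u - w2 v)))
    by (evar_last; [partials | unfold dw1, dw2; destruct m; ring]).
  destruct i, j; assumption.
Qed.

Definition christoffel_A (k i j : coord) (u v : R) : R :=
  match k, i, j with
  | Cu, Cu, Cu => Derive w1 u * cos (w1 u + w2 v) / sin (w1 u + w2 v)
  | Cv, Cu, Cu => - Derive w1 u / sin (w1 u + w2 v)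
  | Cv, Cv, Cv => Derive w2 v * cos (w1 u + w2 v) / sin (w1 u + w2 v)
  | Cu, Cv, Cv => - Derive w2 v / sin (w1 u + w2 v)
  | _, _, _ => 0
  end.

Lemma form_A_christoffel k i j u v : christoffel (form_A w1 w2) k i j u v = christoffel_A k i j u v.
Proof.
  pose proof (sin_sum_neq w1 w2 HA u v) as H.
  unfold christoffel, sum2.
  rewrite !(is_partial_unique _ _ _ _ _ (form_A_partial _ _ _ u v)).
  unfold inv_sym2.
  assert (Ed : cE (form_A w1 w2 u v) * cG (form_A w1 w2 u v) - cF (form_A w1 w2 u v) * cF (form_A w1 w2 u v)
     = - (sin (w1 u + w2 v) * sin (w1 u + w2 v))).
  { unfold form_A; simpl. rewrite !cos_2a, cos_minus, sin_plus. ring. }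
  rewrite Ed. pose proof (pythagoras (w1 u)) as P1. pose proof (pythagoras (w2 v)) as P2.
  assert (T1 : - cos (w1 u - w2 v) * sin (2 * w1 u) + cos (2 * w1 u) * sin (w1 u - w2 v)
     = - sin (w1 u + w2 v)).
  { replace (w1 u + w2 v) with (2 * w1 u - (w1 u - w2 v)) by ring. rewrite (sin_minus (2 * w1 u)). ring. }
  assert (T2 : - cos (w1 u - w2 v) * sin (2 * w2 v) - cos (2 * w2 v) * sin (w1 u - w2 v)
     = - sin (w1 u + w2 v)).
  { replace (w1 u + w2 v) with (2 * w2 v + (w1 u - w2 v)) by ring. rewrite (sin_plus (2 * w2 v)). ring. }
  assert (T3 : cos (2 * w2 v) * sin (2 * w1 u) - cos (w1 u - w2 v) * sin (w1 u - w2 v)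
     = sin (w1 u + w2 v) * cos (w1 u + w2 v)).
  { rewrite !cos_2a, !sin_2a, cos_minus, sin_minus, cos_plus, sin_plus. ring. }
  assert (T4 : cos (2 * w1 u) * sin (2 * w2 v) + cos (w1 u - w2 v) * sin (w1 u - w2 v)
     = sin (w1 u + w2 v) * cos (w1 u + w2 v)).
  { rewrite !cos_2a, !sin_2a, cos_minus, sin_minus, cos_plus, sin_plus. ring. }
  set (S := sin (w1 u + w2 v)) in *. set (C := cos (w1 u + w2 v)) in *.
  destruct k, i, j; unfold form_A, dform_A, dw1, dw2, christoffel_A; simpl; fold S; fold C;
    try (field; exact H).
  - transitivity (Derive w1 u * (cos (2 * w2 v) * sin (2 * w1 u) - cos (w1 u - w2 v) * sin (w1 u - w2 v)) / (S * S)).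
    + field; exact H. + rewrite T3. field; exact H.
  - transitivity (Derive w2 v * (- cos (w1 u - w2 v) * sin (2 * w2 v) - cos (2 * w2 v) * sin (w1 u - w2 v)) / (S * S)).
    + field; exact H. + rewrite T2. field; exact H.
  - transitivity (Derive w1 u * (- cos (w1 u - w2 v) * sin (2 * w1 u) + cos (2 * w1 u) * sin (w1 u - w2 v)) / (S * S)).
    + field; exact H. + rewrite T1. field; exact H.
  - transitivity (Derive w2 v * (cos (2 * w1 u) * sin (2 * w2 v) + cos (w1 u - w2 v) * sin (w1 u - w2 v)) / (S * S)).
    + field; exact H. + rewrite T4. field; exact H.
Qed.

Lemma sum_partial i u v : is_partial i (fun x y => w1 x + w2 y) u v (dw1 i u + dw2 i v).
Proof. apply is_partial_plus; [apply w1_partial | apply w2_partial]. Qed.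

Lemma form_A_flat : flat (form_A w1 w2).
Proof.
  intros l i j k u v. unfold riemann, sum2.
  assert (E : christoffel (form_A w1 w2) = christoffel_A).
  { do 5 (apply functional_extensionality; intro). apply form_A_christoffel. }
  rewrite E. pose proof (sin_sum_neq w1 w2 HA u v) as H.
  set (S := sin (w1 u + w2 v)) in *. set (C := cos (w1 u + w2 v)).
  assert (Pv : forall l k, is_partial Cv (christoffel_A l Cu k) u v
    (match l, k with
     | Cu, Cu => - Derive w1 u * Derive w2 v / (S * S)
     | Cv, Cu => Derive w1 u * Derive w2 v * C / (S * S)
     | _, _ => 0 end)).
  { intros l' k'. destruct l', k'; try apply (is_partial_const Cv 0).
    - evar_last.
      + apply (is_partial_div Cv (fun u v => Derive w1 u * cos (w1 u + w2 v)) (fun u v => sin (w1 u + w2 v)));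
          [exact H | apply is_partial_mult; [apply (is_derive_const (Derive w1 u)) | apply is_partial_cos, sum_partial]
          | apply is_partial_sin, sum_partial].
      + unfold dw1, dw2, zero; simpl.
        transitivity (- Derive w1 u * Derive w2 v * (S * S + C * C) / (S * S)).
        * unfold S, C. field; exact H.
        * unfold S, C. rewrite pythagoras. field; exact H.
    - evar_last.
      + apply (is_partial_div Cv (fun u v => - Derive w1 u) (fun u v => sin (w1 u + w2 v)));
          [exact H | apply (is_derive_const (- Derive w1 u)) | apply is_partial_sin, sum_partial].
      + unfold dw1, dw2, zero, S, C; simpl. field; exact H. }
  assert (Pu : forall l k, is_partial Cu (christoffel_A l Cv k) u v
    (match l, k with
     | Cv, Cv => - Derive w1 u * Derive w2 v / (S * S)
     | Cu, Cv => Derive w1 u * Derive w2 v * C / (S * S)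
     | _, _ => 0 end)).
  { intros l' k'. destruct l', k'; try apply (is_partial_const Cu 0).
    - evar_last.
      + apply (is_partial_div Cu (fun u v => - Derive w2 v) (fun u v => sin (w1 u + w2 v)));
          [exact H | apply (is_derive_const (- Derive w2 v)) | apply is_partial_sin, sum_partial].
      + unfold dw1, dw2, zero, S, C; simpl. field; exact H.
    - evar_last.
      + apply (is_partial_div Cu (fun u v => Derive w2 v * cos (w1 u + w2 v)) (fun u v => sin (w1 u + w2 v)));
          [exact H | apply is_partial_mult; [apply (is_derive_const (Derive w2 v)) | apply is_partial_cos, sum_partial]
          | apply is_partial_sin, sum_partial].
      + unfold dw1, dw2, zero; simpl.
        transitivity (- Derive w1 u * Derive w2 v * (S * S + C * C) / (S * S)).
        * unfold S, C. field; exact H.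
        * unfold S, C. rewrite pythagoras. field; exact H. }
  destruct i, j; try ring;
    rewrite (is_partial_unique _ _ _ _ _ (Pu l k)), (is_partial_unique _ _ _ _ _ (Pv l k));
    destruct l, k; unfold christoffel_A; fold S; fold C; field; exact H.
Qed.

(** The three equations say that the covariant Hessian of [a] vanishes; [l] and [m]
    are the derivatives of [a] along the parallel frame of the form I. *)
Lemma frame_coefficients_constant (a : R -> R -> R) : Cinf everywhere a ->
  (forall u v, partial Cu (partial Cv a) u v = 0) ->
  (forall u v, partial Cu (partial Cu a) u v = Derive w1 u *
     (cos (w1 u + w2 v) * partial Cu a u v - partial Cv a u v) / sin (w1 u + w2 v)) ->
  (forall u v, partial Cv (partial Cv a) u v = Derive w2 v *
     (cos (w1 u + w2 v) * partial Cv a u v - partial Cu a u v) / sin (w1 u + w2 v)) ->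
  exists l m, forall u v,
    partial Cu a u v = l * cos (w1 u) + m * sin (w1 u) /\
    partial Cv a u v = l * cos (w2 v) - m * sin (w2 v).
Proof.
  intros Ha Huv Huu Hvv.
  assert (Sp : forall i, Cinf everywhere (partial i a)) by (intro; apply Cinf_partial; auto using open_everywhere).
  (* l is the value at 0, m the value at PI / 2 *)
  set (l := fun th u v => (sin (w2 v + th) * partial Cu a u v + sin (w1 u - th) * partial Cv a u v) / sin (w1 u + w2 v)).
  assert (Dl : forall th i u v, is_partial i (l th) u v 0).
  { intros th i u v. pose proof (sin_sum_neq w1 w2 HA u v) as H.
    assert (Sw : partial Cv (partial Cu a) u v = 0)
      by (rewrite (Cinf_schwarz everywhere a open_everywhere Ha u v I); apply Huv).
    evar_last; [unfold l; partials; apply Cinf_part, Sp | cbv beta].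
    set (S := sin (w1 u + w2 v)) in *. set (C := cos (w1 u + w2 v)).
    destruct i; cbv iota; rewrite ?Sw, ?Huv, ?Huu, ?Hvv; fold S; fold C.
    - replace (sin (w2 v + th)) with (S * cos (w1 u - th) - C * sin (w1 u - th))
        by (unfold S, C; rewrite <- sin_minus; f_equal; ring).
      field. exact H.
    - replace (sin (w1 u - th)) with (S * cos (w2 v + th) - C * sin (w2 v + th))
        by (unfold S, C; rewrite <- sin_minus; f_equal; ring).
      field. exact H. }
  exists (l 0 0 0), (l (PI / 2) 0 0). intros u v.
  rewrite (const_of_partials_zero (l 0) (Dl 0) 0 0 u v), (const_of_partials_zero (l (PI / 2)) (Dl _) 0 0 u v).
  unfold l. rewrite Rplus_0_r, Rminus_0_r, (sin_plus _ (PI / 2)), (sin_minus _ (PI / 2)), sin_PI2, cos_PI2.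
  pose proof (sin_sum_neq w1 w2 HA u v) as H. rewrite sin_plus in *.
  split; field; exact H.
Qed.

(** Koszul's formula: the derivatives of the metric coefficients determine the
    scalar products of the second derivatives of [(a, b)] with the first ones. So
    [a] and [b] satisfy the same linear equations as the components of (B). *)
Lemma rigidity (a b : R -> R -> R) c1 c2 : Cinf everywhere a -> Cinf everywhere b ->
  (forall u v, pullback (fun u v => (a u v, b u v)) gL2 u v = form_A w1 w2 u v) ->
  exists l m t l' m' t', - (l * l) + l' * l' = -1 /\ - (l * m) + l' * m' = 0 /\ - (m * m) + m' * m' = 1 /\
    forall u v, (a u v, b u v) = compose (affine l m t l' m' t') (map_B w1 w2 c1 c2) u v.
Proof.
  intros Sa Sb HP.
  assert (Sp : forall h i, Cinf everywhere h -> Cinf everywhere (partial i h))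
    by (intros h i Hh; apply Cinf_partial; auto using open_everywhere).
  assert (HM : forall i j u v, - (partial i a u v * partial j a u v) + partial i b u v * partial j b u v
     = entry (form_A w1 w2 u v) i j).
  { intros i j u v. rewrite <- (HP u v). unfold pullback, bil, compose, partial_map, gL2.
    destruct i, j; simpl; unfold partial; ring. }
  assert (DM : forall k i j u v,
      - (partial k (partial i a) u v * partial j a u v + partial i a u v * partial k (partial j a) u v)
      + (partial k (partial i b) u v * partial j b u v + partial i b u v * partial k (partial j b) u v)
      = dform_A k i j u v).
  { intros k i j u v. apply (is_partial_eq k (fun u v => entry (form_A w1 w2 u v) i j) u v);
      [| apply form_A_partial].
    apply (is_partial_ext k (fun u v => - (partial i a u v * partial j a u v) + partial i b u v * partial j b u v));
      [intros; apply HM |].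
    partials; apply Cinf_part; auto. }
  assert (HE := HM Cu Cu). assert (HF := HM Cu Cv). assert (HG := HM Cv Cv). cbn [entry form_A cE cF cG] in HE, HF, HG.
  assert (ND : forall u v x y, - (partial Cu a u v * x) + partial Cu b u v * y = 0 ->
    - (partial Cv a u v * x) + partial Cv b u v * y = 0 -> x = 0 /\ y = 0).
  { intros u v x y E1 E2. pose proof (sin_sum_neq w1 w2 HA u v) as H.
    set (d := partial Cu a u v * partial Cv b u v - partial Cv a u v * partial Cu b u v).
    assert (Hd : d * d = sin (w1 u + w2 v) * sin (w1 u + w2 v)).
    { transitivity ((- cos (w1 u - w2 v)) * (- cos (w1 u - w2 v)) - (- cos (2 * w1 u)) * (- cos (2 * w2 v))).
      - rewrite <- (HE u v), <- (HG u v), <- (HF u v). unfold d. ring.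
      - rewrite !cos_2a, cos_minus, sin_plus. ring. }
    assert (Hd0 : d <> 0).
    { intros E. rewrite E in Hd. apply H. apply Rsqr_0_uniq. unfold Rsqr. lra. }
    split; apply Rmult_eq_reg_l with d; auto; unfold d.
    - transitivity (partial Cu b u v * (- (partial Cv a u v * x) + partial Cv b u v * y)
       - partial Cv b u v * (- (partial Cu a u v * x) + partial Cu b u v * y)); [ring | rewrite E1, E2; ring].
    - transitivity (partial Cu a u v * (- (partial Cv a u v * x) + partial Cv b u v * y)
       - partial Cv a u v * (- (partial Cu a u v * x) + partial Cu b u v * y)); [ring | rewrite E1, E2; ring]. }
  assert (Huv : forall u v, partial Cu (partial Cv a) u v = 0 /\ partial Cu (partial Cv b) u v = 0).
  { intros u v. apply (ND u v).
    - pose proof (DM Cv Cu Cu u v) as E. unfold dform_A, dw1 in E.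
      rewrite (Cinf_schwarz everywhere a open_everywhere Sa u v I), (Cinf_schwarz everywhere b open_everywhere Sb u v I) in E. lra.
    - pose proof (DM Cu Cv Cv u v) as E. unfold dform_A, dw2 in E. lra. }
  assert (Hvu : forall u v, partial Cv (partial Cu a) u v = 0 /\ partial Cv (partial Cu b) u v = 0).
  { intros u v.
    rewrite (Cinf_schwarz everywhere a open_everywhere Sa u v I), (Cinf_schwarz everywhere b open_everywhere Sb u v I).
    apply Huv. }
  assert (Huu : forall u v,
    partial Cu (partial Cu a) u v = Derive w1 u * (cos (w1 u + w2 v) * partial Cu a u v - partial Cv a u v) / sin (w1 u + w2 v) /\
    partial Cu (partial Cu b) u v = Derive w1 u * (cos (w1 u + w2 v) * partial Cu b u v - partial Cv b u v) / sin (w1 u + w2 v)).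
  { intros u v. pose proof (sin_sum_neq w1 w2 HA u v) as H.
    pose proof (DM Cu Cu Cu u v) as E0. pose proof (DM Cu Cu Cv u v) as E2. unfold dform_A, dw1, dw2 in E0, E2.
    assert (E1 : - (partial Cu a u v * partial Cu (partial Cu a) u v) + partial Cu b u v * partial Cu (partial Cu b) u v
      = Derive w1 u * sin (2 * w1 u)) by lra.
    destruct (Huv u v) as [Za Zb]. rewrite Za, Zb in E2.
    pose proof (HE u v) as F1. pose proof (HF u v) as F2. pose proof (HG u v) as F3.
    destruct (ND u v (partial Cu (partial Cu a) u v - Derive w1 u * (cos (w1 u + w2 v) * partial Cu a u v - partial Cv a u v) / sin (w1 u + w2 v))
      (partial Cu (partial Cu b) u v - Derive w1 u * (cos (w1 u + w2 v) * partial Cu b u v - partial Cv b u v) / sin (w1 u + w2 v))) as [G1 G2].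
    - transitivity ((- (partial Cu a u v * partial Cu (partial Cu a) u v) + partial Cu b u v * partial Cu (partial Cu b) u v)
        - Derive w1 u * (cos (w1 u + w2 v) * (- (partial Cu a u v * partial Cu a u v) + partial Cu b u v * partial Cu b u v)
          - (- (partial Cu a u v * partial Cv a u v) + partial Cu b u v * partial Cv b u v)) / sin (w1 u + w2 v)).
      + field; exact H.
      + rewrite E1, F1, F2.
        replace (w1 u - w2 v) with (2 * w1 u - (w1 u + w2 v)) by ring. rewrite (cos_minus (2 * w1 u)). field; exact H.
    - transitivity ((- (partial Cu (partial Cu a) u v * partial Cv a u v + partial Cu a u v * 0)
         + (partial Cu (partial Cu b) u v * partial Cv b u v + partial Cu b u v * 0))
        - Derive w1 u * (cos (w1 u + w2 v) * (- (partial Cu a u v * partial Cv a u v) + partial Cu b u v * partial Cv b u v)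
          - (- (partial Cv a u v * partial Cv a u v) + partial Cv b u v * partial Cv b u v)) / sin (w1 u + w2 v)).
      + field; exact H.
      + rewrite E2, F3, F2.
        replace (2 * w2 v) with ((w1 u + w2 v) - (w1 u - w2 v)) by ring. rewrite (cos_minus (w1 u + w2 v)). field; exact H.
    - split; lra. }
  assert (Hvv : forall u v,
    partial Cv (partial Cv a) u v = Derive w2 v * (cos (w1 u + w2 v) * partial Cv a u v - partial Cu a u v) / sin (w1 u + w2 v) /\
    partial Cv (partial Cv b) u v = Derive w2 v * (cos (w1 u + w2 v) * partial Cv b u v - partial Cu b u v) / sin (w1 u + w2 v)).
  { intros u v. pose proof (sin_sum_neq w1 w2 HA u v) as H.
    pose proof (DM Cv Cv Cv u v) as E0. pose proof (DM Cv Cu Cv u v) as E2. unfold dform_A, dw1, dw2 in E0, E2.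
    assert (E1 : - (partial Cv a u v * partial Cv (partial Cv a) u v) + partial Cv b u v * partial Cv (partial Cv b) u v
      = Derive w2 v * sin (2 * w2 v)) by lra.
    destruct (Hvu u v) as [Za Zb]. rewrite Za, Zb in E2.
    pose proof (HE u v) as F1. pose proof (HF u v) as F2. pose proof (HG u v) as F3.
    destruct (ND u v (partial Cv (partial Cv a) u v - Derive w2 v * (cos (w1 u + w2 v) * partial Cv a u v - partial Cu a u v) / sin (w1 u + w2 v))
      (partial Cv (partial Cv b) u v - Derive w2 v * (cos (w1 u + w2 v) * partial Cv b u v - partial Cu b u v) / sin (w1 u + w2 v))) as [G1 G2].
    - transitivity ((- (0 * partial Cv a u v + partial Cu a u v * partial Cv (partial Cv a) u v)
         + (0 * partial Cv b u v + partial Cu b u v * partial Cv (partial Cv b) u v))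
        - Derive w2 v * (cos (w1 u + w2 v) * (- (partial Cu a u v * partial Cv a u v) + partial Cu b u v * partial Cv b u v)
          - (- (partial Cu a u v * partial Cu a u v) + partial Cu b u v * partial Cu b u v)) / sin (w1 u + w2 v)).
      + field; exact H.
      + rewrite E2, F1, F2.
        replace (2 * w1 u) with ((w1 u + w2 v) + (w1 u - w2 v)) by ring. rewrite (cos_plus (w1 u + w2 v)). field; exact H.
    - transitivity ((- (partial Cv a u v * partial Cv (partial Cv a) u v) + partial Cv b u v * partial Cv (partial Cv b) u v)
        - Derive w2 v * (cos (w1 u + w2 v) * (- (partial Cv a u v * partial Cv a u v) + partial Cv b u v * partial Cv b u v)
          - (- (partial Cu a u v * partial Cv a u v) + partial Cu b u v * partial Cv b u v)) / sin (w1 u + w2 v)).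
      + field; exact H.
      + rewrite E1, F3, F2.
        replace (w1 u - w2 v) with ((w1 u + w2 v) - 2 * w2 v) by ring. rewrite (cos_minus (w1 u + w2 v)). field; exact H.
    - split; lra. }
  destruct (frame_coefficients_constant a Sa (fun u v => proj1 (Huv u v))
    (fun u v => proj1 (Huu u v)) (fun u v => proj1 (Hvv u v))) as (l & m & Ha).
  destruct (frame_coefficients_constant b Sb (fun u v => proj2 (Huv u v))
    (fun u v => proj2 (Huu u v)) (fun u v => proj2 (Hvv u v))) as (l' & m' & Hb).
  assert (C1 : forall t, continuous w1 t) by (intro; apply smooth1_continuous, S1).
  assert (C2 : forall t, continuous w2 t) by (intro; apply smooth1_continuous, S2).
  assert (Haff : forall (h : R -> R -> R) l m, Cinf everywhere h ->
     (forall u v, partial Cu h u v = l * cos (w1 u) + m * sin (w1 u) /\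
                  partial Cv h u v = l * cos (w2 v) - m * sin (w2 v)) ->
     forall u v, h u v = l * map_x w1 w2 c1 u v + m * map_y w1 w2 c2 u v
        + (h 0 0 - (l * map_x w1 w2 c1 0 0 + m * map_y w1 w2 c2 0 0))).
  { intros h e f Sh Hh u v.
    pose proof (const_of_partials_zero (fun u v => h u v - (e * map_x w1 w2 c1 u v + f * map_y w1 w2 c2 u v))) as K.
    assert (E : h u v - (e * map_x w1 w2 c1 u v + f * map_y w1 w2 c2 u v)
       = h 0 0 - (e * map_x w1 w2 c1 0 0 + f * map_y w1 w2 c2 0 0)); [| lra].
    apply K. intros i x y. evar_last.
    - apply is_partial_minus; [apply Cinf_part, Sh |].
      apply is_partial_plus; (apply is_partial_mult; [apply is_partial_const |]).
      + apply (map_x_partial w1 w2 C1 C2).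
      + apply (map_y_partial w1 w2 C1 C2).
    - destruct (Hh x y) as [h1 h2]. destruct i; [rewrite h1 | rewrite h2]; ring. }
  exists l, m, (a 0 0 - (l * map_x w1 w2 c1 0 0 + m * map_y w1 w2 c2 0 0)),
    l', m', (b 0 0 - (l' * map_x w1 w2 c1 0 0 + m' * map_y w1 w2 c2 0 0)).
  destruct (Ha 0 0) as [a1 a2], (Hb 0 0) as [b1 b2].
  pose proof (HE 0 0) as F1. pose proof (HF 0 0) as F2. pose proof (HG 0 0) as F3.
  rewrite a1, b1 in F1, F2. rewrite a2, b2 in F2, F3.
  pose proof (sin_sum_neq w1 w2 HA 0 0) as H. rewrite cos_2a in F1, F3. rewrite cos_minus in F2. rewrite sin_plus in H.
  set (x1 := cos (w1 0)) in *. set (y1 := sin (w1 0)) in *. set (x2 := cos (w2 0)) in *. set (y2 := sin (w2 0)) in *.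
  set (d := y1 * x2 + x1 * y2) in *.
  assert (Hd : d * d <> 0) by (apply Rmult_integral_contrapositive; auto).
  split; [| split; [| split]].
  - apply Rmult_eq_reg_l with (d * d); auto.
    transitivity (y2 * y2 * (- ((l * x1 + m * y1) * (l * x1 + m * y1)) + (l' * x1 + m' * y1) * (l' * x1 + m' * y1))
      + 2 * y1 * y2 * (- ((l * x1 + m * y1) * (l * x2 - m * y2)) + (l' * x1 + m' * y1) * (l' * x2 - m' * y2))
      + y1 * y1 * (- ((l * x2 - m * y2) * (l * x2 - m * y2)) + (l' * x2 - m' * y2) * (l' * x2 - m' * y2)));
      [unfold d; ring | rewrite F1, F2, F3; unfold d; ring].
  - apply Rmult_eq_reg_l with (d * d); auto.
    transitivity (y2 * x2 * (- ((l * x1 + m * y1) * (l * x1 + m * y1)) + (l' * x1 + m' * y1) * (l' * x1 + m' * y1))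
      + (y1 * x2 - x1 * y2) * (- ((l * x1 + m * y1) * (l * x2 - m * y2)) + (l' * x1 + m' * y1) * (l' * x2 - m' * y2))
      - y1 * x1 * (- ((l * x2 - m * y2) * (l * x2 - m * y2)) + (l' * x2 - m' * y2) * (l' * x2 - m' * y2)));
      [unfold d; ring | rewrite F1, F2, F3; unfold d; ring].
  - apply Rmult_eq_reg_l with (d * d); auto.
    transitivity (x2 * x2 * (- ((l * x1 + m * y1) * (l * x1 + m * y1)) + (l' * x1 + m' * y1) * (l' * x1 + m' * y1))
      - 2 * x1 * x2 * (- ((l * x1 + m * y1) * (l * x2 - m * y2)) + (l' * x1 + m' * y1) * (l' * x2 - m' * y2))
      + x1 * x1 * (- ((l * x2 - m * y2) * (l * x2 - m * y2)) + (l' * x2 - m' * y2) * (l' * x2 - m' * y2)));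
      [unfold d; ring | rewrite F1, F2, F3; unfold d; ring].
  - intros u v. unfold compose, affine, map_B; simpl. fold (map_x w1 w2 c1 u v) (map_y w1 w2 c2 u v).
    f_equal; apply Haff; assumption.
Qed.
End Consequences.

(** * Isometries and asymptotic curves *)

Lemma lorentz_det l m l' m' :
  - (l * l) + l' * l' = -1 -> - (l * m) + l' * m' = 0 -> - (m * m) + m' * m' = 1 ->
  l * m' - m * l' <> 0.
Proof.
  intros H1 H2 H3 E. assert (X : (l * m' - m * l') * (l * m' - m * l') = 1); [| rewrite E in X; lra].
  transitivity (- (- (l * l) + l' * l') * (- (m * m) + m' * m') + (- (l * m) + l' * m') * (- (l * m) + l' * m'));
    [ring | rewrite H1, H2, H3; ring].
Qed.

Lemma affine_isometry l m t l' m' t' :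
  - (l * l) + l' * l' = -1 -> - (l * m) + l' * m' = 0 -> - (m * m) + m' * m' = 1 ->
  isometry gL2 gL2 (affine l m t l' m' t').
Proof.
  intros H1 H2 H3. split.
  - destruct (affine_diffeo l m t l' m' t' (lorentz_det l m l' m' H1 H2 H3)) as (a & b & s & c & d & s' & _ & Hg & _).
    exact Hg.
  - intros u v.
    assert (P : forall i e f g, is_partial i (fun x y => e * x + f * y + g) u v (match i with Cu => e | Cv => f end)).
    { intros i e f g. destruct i; unfold is_partial, slice, at_coord; auto_derive; auto; ring. }
    assert (Q : forall i, partial_map i (affine l m t l' m' t') u v =
      (match i with Cu => l | Cv => m end, match i with Cu => l' | Cv => m' end))
      by (intros i; unfold partial_map; f_equal; apply is_partial_unique, P).
    unfold pullback. rewrite !Q.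
    unfold bil, gL2; simpl. f_equal; lra.
Qed.

(** By rigidity an isometry is (B) followed by a Lorentz transformation. *)
Lemma isometry_iff_map_B w1 w2 : angle_pair w1 w2 -> forall g,
  (forall u v, g u v = form_A w1 w2 u v) -> forall c1 c2,
  (exists phi, isometry g gL2 phi) <-> global_diffeo (map_B w1 w2 c1 c2).
Proof.
  intros HA g Hg c1 c2. split.
  - intros (phi & Hphi & Hpull).
    destruct (global_diffeo_inverse phi Hphi) as (_ & [Sa Sb] & _).
    destruct (rigidity w1 w2 HA _ _ c1 c2 Sa Sb) as (l & m & t & l' & m' & t' & H1 & H2 & H3 & E).
    { intros u v. rewrite <- Hg, <- Hpull.
      replace (fun u v => (fst (phi u v), snd (phi u v))) with phi; [reflexivity |].
      apply plane_ext; intros x y.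
      apply surjective_pairing. }
    destruct (affine_diffeo l m t l' m' t' (lorentz_det l m l' m' H1 H2 H3)) as (a & b & s & c & d & s' & Hi & _ & Ei).
    assert (EB : map_B w1 w2 c1 c2 = compose (affine a b s c d s') phi).
    { apply plane_ext; intros x y.
      specialize (E x y). rewrite <- surjective_pairing in E.
      unfold compose in *. rewrite E. rewrite Ei. apply surjective_pairing. }
    rewrite EB. apply global_diffeo_comp; assumption.
  - intros H. exists (map_B w1 w2 c1 c2). split; [exact H |].
    intros u v. rewrite Hg. apply pullback_map_B; apply HA.
Qed.

Lemma locally_nonzero (f : R -> R) t : continuous f t -> f t <> 0 -> locally t (fun s => f s <> 0).
Proof. intros Hf Hn. exact (Hf (fun z => z <> 0) (locally_neq0 _ Hn)). Qed.

(** For a curve (p, q) the condition reads p' q' = 0. As the velocity never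
    vanishes, the sets of times where p' and q' are nonzero are complementary and
    both open, so one of them is empty. *)
Lemma asymptotic_iff_coordinate f N (lam : R -> R -> R) :
  (forall u v, form_II f N u v = Sym2 0 (lam u v) 0) -> (forall u v, lam u v <> 0) ->
  forall (a b : Rbar) (c : R -> R * R), regular_curve a b c ->
  (asymptotic_curve f N a b c <-> in_coordinate_curve a b c).
Proof.
  intros HII Hlam a b c Hreg.
  set (p := fun t => fst (c t)). set (q := fun t => snd (c t)).
  assert (Hder : forall t : R, Rbar_lt a t -> Rbar_lt t b ->
    is_derive p t (Derive p t) /\ is_derive q t (Derive q t) /\
    continuous (Derive p) t /\ continuous (Derive q) t /\ (Derive p t <> 0 \/ Derive q t <> 0)).
  { intros t Ha Hb. destruct (Hreg t Ha Hb) as (E1 & E2 & E3).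
    split; [apply Derive_correct, (E1 1%nat) |]. split; [apply Derive_correct, (E2 1%nat) |].
    split; [apply (ex_derive_continuous (Derive p)), (E1 2%nat) |].
    split; [apply (ex_derive_continuous (Derive q)), (E2 2%nat) |].
    destruct (Req_dec (Derive p t) 0) as [Z1|Z1]; [| left; exact Z1].
    right. intros Z2. apply E3. unfold velocity. f_equal; assumption. }
  assert (Hbil : forall t, bil (form_II f N (fst (c t)) (snd (c t))) (velocity c t) (velocity c t)
     = 2 * lam (p t) (q t) * (Derive p t * Derive q t)).
  { intros t. rewrite HII. unfold bil, velocity; simpl. fold p q. fold (p t) (q t). ring. }
  unfold asymptotic_curve. split.
  - intros Has.
    assert (Hprod : forall t : R, Rbar_lt a t -> Rbar_lt t b -> Derive p t = 0 \/ Derive q t = 0).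
    { intros t Ha Hb. specialize (Has t Ha Hb). rewrite Hbil in Has.
      apply Rmult_integral in Has. destruct Has as [Z|Z].
      - exfalso. apply (Hlam (p t) (q t)). lra.
      - apply Rmult_integral, Z. }
    assert (Hclop : forall s t : R, Rbar_lt a s -> Rbar_lt s b -> Rbar_lt a t -> Rbar_lt t b ->
       Derive p s <> 0 -> Derive p t <> 0).
    { apply clopen_interval.
      - intros t Ha Hb Hp. apply locally_nonzero; [apply (Hder t Ha Hb) | exact Hp].
      - intros t Ha Hb Hp. destruct (Hder t Ha Hb) as (_ & _ & _ & Cq & [Z|Z]); [contradiction |].
        generalize (filter_and _ _ (open_interval a b t Ha Hb) (locally_nonzero _ _ Cq Z)).
        apply filter_imp. intros s [[Ha' Hb'] Hs]. intros Hps.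
        destruct (Hprod s Ha' Hb'); contradiction. }
    destruct (excluded_middle_informative (exists t : R, Rbar_lt a t /\ Rbar_lt t b /\ Derive p t <> 0))
      as [(t0 & Ha0 & Hb0 & H0)|Hno].
    + left. exists (q t0). intros t Ha Hb.
      apply (const_on_interval a b q); auto. intros z Hz1 Hz2.
      destruct (Hder z Hz1 Hz2) as (_ & Dq & _).
      destruct (Hprod z Hz1 Hz2) as [Z|Z]; [| rewrite Z in Dq; exact Dq].
      exfalso. apply (Hclop t0 z Ha0 Hb0 Hz1 Hz2 H0 Z).
    + right.
      assert (Z : forall t : R, Rbar_lt a t -> Rbar_lt t b -> is_derive p t 0).
      { intros t Ha Hb. destruct (Hder t Ha Hb) as (Dp & _).
        replace 0 with (Derive p t); [exact Dp |]. apply NNPP. intros Hn. apply Hno. exists t. auto. }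
      destruct (excluded_middle_informative (exists t : R, Rbar_lt a t /\ Rbar_lt t b)) as [(t0 & Ha0 & Hb0)|He].
      * exists (p t0). intros t Ha Hb. apply (const_on_interval a b p); auto.
      * exists 0. intros t Ha Hb. exfalso. apply He. exists t. auto.
  - assert (Hz : forall (r : R -> R) k, (forall t : R, Rbar_lt a t -> Rbar_lt t b -> r t = k) ->
      forall t : R, Rbar_lt a t -> Rbar_lt t b -> Derive r t = 0).
    { intros r k Hk t Ha Hb. apply is_derive_unique.
      apply is_derive_ext_loc with (fun _ => k); [| apply (is_derive_const k)].
      generalize (open_interval a b t Ha Hb). apply filter_imp. intros s [Ha' Hb']. symmetry. apply Hk; assumption. }
    intros [(v & Hv)|(u & Hu)] t Ha Hb; rewrite Hbil.
    + rewrite (Hz q v Hv t Ha Hb). ring.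
    + rewrite (Hz p u Hu t Ha Hb). ring.
Qed.

Definition is_partial4 (i : coord) (f : R -> R -> R4) (u v : R) (d : R4) : Prop :=
  is_partial i (fun s t => x0 (f s t)) u v (x0 d) /\ is_partial i (fun s t => x1 (f s t)) u v (x1 d) /\
  is_partial i (fun s t => x2 (f s t)) u v (x2 d) /\ is_partial i (fun s t => x3 (f s t)) u v (x3 d).

Lemma is_partial4_unique i f u v d : is_partial4 i f u v d -> partial4 i f u v = d.
Proof.
  intros (H0 & H1 & H2 & H3). unfold partial4.
  rewrite (is_partial_unique _ _ _ _ _ H0), (is_partial_unique _ _ _ _ _ H1),
    (is_partial_unique _ _ _ _ _ H2), (is_partial_unique _ _ _ _ _ H3).
  destruct d as [[[d0 d1] d2] d3]. reflexivity.
Qed.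

Lemma independent_of_gram (X Y : R4) a b :
  ip X X * ip Y Y - ip X Y * ip X Y <> 0 -> plus (scal a X) (scal b Y) = zero -> a = 0 /\ b = 0.
Proof.
  intros Hd E.
  assert (Z : forall V, a * ip X V + b * ip Y V = 0).
  { intros V. transitivity (ip (plus (scal a X) (scal b Y)) V).
    - unfold ip, x0, x1, x2, x3, plus, scal; simpl. unfold prod_plus, prod_scal; simpl.
      unfold plus, scal; simpl. unfold mult; simpl. ring.
    - rewrite E. change (ip (0, 0, 0, 0) V = 0). unfold ip, x0, x1, x2, x3; simpl. ring. }
  pose proof (Z X) as ZX. pose proof (Z Y) as ZY.
  assert (Sym : ip Y X = ip X Y) by (unfold ip; ring). rewrite Sym in ZX.
  split; apply Rmult_eq_reg_l with (ip X X * ip Y Y - ip X Y * ip X Y); auto; rewrite Rmult_0_r.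
  - transitivity (ip Y Y * (a * ip X X + b * ip X Y) - ip X Y * (a * ip X Y + b * ip Y Y)); [ring |].
    rewrite ZX, ZY. ring.
  - transitivity (ip X X * (a * ip X Y + b * ip Y Y) - ip X Y * (a * ip X X + b * ip X Y)); [ring |].
    rewrite ZX, ZY. ring.
Qed.

Lemma independent_of_form_A w1 w2 : angle_pair w1 w2 -> forall f u v,
  form_I f u v = form_A w1 w2 u v -> forall a b,
  plus (scal a (partial4 Cu f u v)) (scal b (partial4 Cv f u v)) = zero -> a = 0 /\ b = 0.
Proof.
  intros HA f u v HI a b. apply independent_of_gram.
  pose proof (f_equal cE HI) as h1. pose proof (f_equal cF HI) as h2.
  pose proof (f_equal cG HI) as h3. unfold form_I, ip_d in h1, h2, h3. simpl in h1, h2, h3.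
  assert (Sym : ip (partial4 Cv f u v) (partial4 Cu f u v) = ip (partial4 Cu f u v) (partial4 Cv f u v))
    by (unfold ip; ring).
  rewrite Sym in h2.
  replace (ip (partial4 Cu f u v) (partial4 Cv f u v)) with (- cos (w1 u - w2 v)) by lra.
  rewrite h1, h3. pose proof (sin_sum_pos w1 w2 HA u v) as P.
  rewrite !cos_2a, cos_minus. rewrite sin_plus in P.
  intros E. assert (X := Rmult_lt_0_compat _ _ P P). lra.
Qed.

(** * Existence of the immersion *)

(** The right-hand sides are as smooth as the solutions, so the order of
    smoothness can be raised step by step. *)
Lemma Ck_system n (al be p q : R -> R) : smooth1 al -> smooth1 be ->
  (forall t, is_derive p t (al t * q t)) -> (forall t, is_derive q t (be t * p t)) ->
  Ck n everywhere (fun x _ => p x) /\ Ck n everywhere (fun x _ => q x).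
Proof.
  intros Sa Sb Dp Dq. induction n as [|n [IHp IHq]].
  - assert (C : forall (f : R -> R) l, (forall t, is_derive f t (l t)) -> Ck 0 everywhere (fun x _ => f x)).
    { intros f l Hf. split; [| exact I]. intros x y _.
      apply (continuity_1d_2d_pt_comp f (fun x _ => x)); [| apply continuity_2d_pt_id1].
      apply continuity_pt_filterlim. apply (is_derive_continuous f x (l x)), Hf. }
    split; [apply (C p _ Dp) | apply (C q _ Dq)].
  - split.
    + apply (Ck_lift n p (fun t => al t * q t) (fun _ => True)); auto using locally_true.
      apply (Ck_mult n everywhere (fun x _ => al x) (fun x _ => q x)); [apply smooth1_Cinf, Sa | exact IHq].
    + apply (Ck_lift n q (fun t => be t * p t) (fun _ => True)); auto using locally_true.
      apply (Ck_mult n everywhere (fun x _ => be x) (fun x _ => p x)); [apply smooth1_Cinf, Sb | exact IHp].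
Qed.

Lemma linear_system (al be : R -> R) B a b : smooth1 al -> smooth1 be ->
  (forall t, Rabs (al t) <= B) -> (forall t, Rabs (be t) <= B) ->
  exists p q, p 0 = a /\ q 0 = b /\
    (forall t, is_derive p t (al t * q t)) /\ (forall t, is_derive q t (be t * p t)).
Proof.
  intros Sa Sb Ba Bb.
  assert (HB : 0 <= B) by (eapply Rle_trans; [apply Rabs_pos | apply (Ba 0)]).
  apply (ode_solution (fun t _ y => al t * y) (fun t x _ => be t * x) (B + 1)
    (B * (Rabs a + Rabs b)) a b).
  - lra.
  - intros x y _ Cy t. apply continuous_Rmult; [apply smooth1_continuous, Sa | apply Cy].
  - intros x y Cx _ t. apply continuous_Rmult; [apply smooth1_continuous, Sb | apply Cx].
  - intros t x y x' y'. replace (al t * y - al t * y') with (al t * (y - y')) by ring.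
    rewrite Rabs_mult. specialize (Ba t). pose proof (Rabs_pos (x - x')). pose proof (Rabs_pos (y - y')). nra.
  - intros t x y x' y'. replace (be t * x - be t * x') with (be t * (x - x')) by ring.
    rewrite Rabs_mult. specialize (Bb t). pose proof (Rabs_pos (x - x')). pose proof (Rabs_pos (y - y')). nra.
  - intros t. rewrite Rabs_mult. specialize (Ba t). pose proof (Rabs_pos a). pose proof (Rabs_pos b). nra.
  - intros t. rewrite Rabs_mult. specialize (Bb t). pose proof (Rabs_pos a). pose proof (Rabs_pos b). nra.
Qed.

(** The matrix of the system has trace zero, so the Wronskian is constant. *)
Lemma SL2_frame (al be : R -> R) B : smooth1 al -> smooth1 be ->
  (forall t, Rabs (al t) <= B) -> (forall t, Rabs (be t) <= B) ->
  exists p q r s, smooth1 p /\ smooth1 q /\ smooth1 r /\ smooth1 s /\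
    (forall t, is_derive p t (al t * q t)) /\ (forall t, is_derive q t (be t * p t)) /\
    (forall t, is_derive r t (al t * s t)) /\ (forall t, is_derive s t (be t * r t)) /\
    (forall t, p t * s t - q t * r t = 1).
Proof.
  intros Sa Sb Ba Bb.
  destruct (linear_system al be B 1 0 Sa Sb Ba Bb) as (p & q & p0 & q0 & Dp & Dq).
  destruct (linear_system al be B 0 1 Sa Sb Ba Bb) as (r & s & r0 & s0 & Dr & Ds).
  assert (S : forall p q, (forall t, is_derive p t (al t * q t)) -> (forall t, is_derive q t (be t * p t)) ->
     smooth1 p /\ smooth1 q).
  { intros f g Df Dg. split; apply Cinf_smooth1; intros n; apply (Ck_system n al be f g Sa Sb Df Dg). }
  destruct (S p q Dp Dq) as [Sp Sq]. destruct (S r s Dr Ds) as [Sr Ss].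
  exists p, q, r, s. do 8 (split; [assumption |]). intros t.
  assert (E := const_of_derive_zero (fun t => p t * s t - q t * r t)). simpl in E.
  rewrite (E ltac:(intros z; evar_last;
    [apply @is_derive_minus; apply is_derive_Rmult; auto | unfold minus, plus, opp; simpl; ring]) t 0).
  rewrite p0, q0, r0, s0. ring.
Qed.

(** This linear isomorphism carries [- det] to the quadratic form of R^4_2. *)
Definition R4_of_mat (m11 m12 m21 m22 : R) : R4 :=
  ((m11 + m22) / 2, (m12 - m21) / 2, (m11 - m22) / 2, (m12 + m21) / 2).

Lemma is_partial_half i h u v l : is_partial i h u v l -> is_partial i (fun x y => h x y / 2) u v (l / 2).
Proof.
  intros H. evar_last; [apply (is_partial_mult i h (fun _ _ => / 2)); [exact H | apply is_partial_const] |].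
  unfold Rdiv. ring.
Qed.

Lemma is_partial4_mat i (m11 m12 m21 m22 : R -> R -> R) u v d11 d12 d21 d22 :
  is_partial i m11 u v d11 -> is_partial i m12 u v d12 -> is_partial i m21 u v d21 -> is_partial i m22 u v d22 ->
  is_partial4 i (fun s t => R4_of_mat (m11 s t) (m12 s t) (m21 s t) (m22 s t)) u v (R4_of_mat d11 d12 d21 d22).
Proof.
  intros H1 H2 H3 H4. unfold is_partial4, R4_of_mat; simpl. unfold x0, x1, x2, x3; simpl.
  split; [| split; [| split]]; apply is_partial_half;
    first [apply is_partial_plus; assumption | apply is_partial_minus; assumption].
Qed.

Lemma smooth4_mat (m11 m12 m21 m22 : R -> R -> R) :
  Cinf everywhere m11 -> Cinf everywhere m12 -> Cinf everywhere m21 -> Cinf everywhere m22 ->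
  smooth4 (fun s t => R4_of_mat (m11 s t) (m12 s t) (m21 s t) (m22 s t)).
Proof.
  intros H1 H2 H3 H4. unfold smooth4, R4_of_mat, x0, x1, x2, x3; simpl.
  split; [| split; [| split]]; apply Cinf_smooth; cinf.
Qed.

(** [f] and [N] are the matrix products a1 a2 and - a1 xi a2. All scalar products
    of their derivatives are multiples of det a1 * det a2 = 1. *)
Theorem immersion_A_exists w1 w2 : angle_pair w1 w2 -> exists f N, immersion_A w1 w2 f N.
Proof.
  intros HA. pose proof (proj1 HA) as S1. pose proof (proj1 (proj2 HA)) as S2.
  set (al1 := fun t => sin (w1 t) - cos (w1 t)). set (be1 := fun t => cos (w1 t) + sin (w1 t)).
  set (al2 := fun t => cos (w2 t) - sin (w2 t)). set (be2 := fun t => - (sin (w2 t) + cos (w2 t))).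
  assert (SW1 : Cinf everywhere (fun x _ => w1 x)) by (apply smooth1_Cinf, S1).
  assert (SW2 : Cinf everywhere (fun x _ => w2 x)) by (apply smooth1_Cinf, S2).
  assert (Sal1 : smooth1 al1) by (apply Cinf_smooth1; unfold al1; cinf).
  assert (Sbe1 : smooth1 be1) by (apply Cinf_smooth1; unfold be1; cinf).
  assert (Sal2 : smooth1 al2) by (apply Cinf_smooth1; unfold al2; cinf).
  assert (Sbe2 : smooth1 be2) by (apply Cinf_smooth1; unfold be2; cinf).
  destruct (SL2_frame al1 be1 2) as (p1 & q1 & r1 & s1 & Sp1 & Sq1 & Sr1 & Ss1 & Dp1 & Dq1 & Dr1 & Ds1 & E1); auto.
  { intros t. unfold al1. pose proof (SIN_bound (w1 t)). pose proof (COS_bound (w1 t)). apply Rabs_le_between. lra. }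
  { intros t. unfold be1. pose proof (SIN_bound (w1 t)). pose proof (COS_bound (w1 t)). apply Rabs_le_between. lra. }
  destruct (SL2_frame al2 be2 2) as (p2 & q2 & r2 & s2 & Sp2 & Sq2 & Sr2 & Ss2 & Dp2 & Dq2 & Dr2 & Ds2 & E2); auto.
  { intros t. unfold al2. pose proof (SIN_bound (w2 t)). pose proof (COS_bound (w2 t)). apply Rabs_le_between. lra. }
  { intros t. unfold be2. pose proof (SIN_bound (w2 t)). pose proof (COS_bound (w2 t)). apply Rabs_le_between. lra. }
  set (f := fun u v => R4_of_mat (p1 u * p2 v + q1 u * q2 v) (p1 u * r2 v + q1 u * s2 v)
                                 (r1 u * p2 v + s1 u * q2 v) (r1 u * r2 v + s1 u * s2 v)).
  set (N := fun u v => R4_of_mat (q1 u * q2 v - p1 u * p2 v) (q1 u * s2 v - p1 u * r2 v)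
                                 (s1 u * q2 v - r1 u * p2 v) (s1 u * s2 v - r1 u * r2 v)).
  assert (SB : forall a b, smooth1 a -> smooth1 b -> Cinf everywhere (fun u v => a u * b v)).
  { intros a b Ha Hb. apply (Cinf_mult _ (fun u _ => a u) (fun _ v => b v)); [apply Cinf_fun_fst | apply Cinf_snd_fun]; assumption. }
  assert (PB : forall i (a b : R -> R) u v da db, is_derive a u da -> is_derive b v db ->
     is_partial i (fun u v => a u * b v) u v (match i with Cu => da * b v | Cv => a u * db end)).
  { intros i a b u v da db Ha Hb. evar_last.
    - apply (is_partial_mult i (fun u _ => a u) (fun _ v => b v));
        [apply is_partial_of_fst, Ha | apply is_partial_of_snd, Hb].
    - destruct i; ring. }
  assert (Pf : forall i u v, partial4 i f u v = match i with
    | Cu => R4_of_mat (al1 u * q1 u * p2 v + be1 u * p1 u * q2 v) (al1 u * q1 u * r2 v + be1 u * p1 u * s2 v)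
              (al1 u * s1 u * p2 v + be1 u * r1 u * q2 v) (al1 u * s1 u * r2 v + be1 u * r1 u * s2 v)
    | Cv => R4_of_mat (p1 u * (al2 v * q2 v) + q1 u * (be2 v * p2 v)) (p1 u * (al2 v * s2 v) + q1 u * (be2 v * r2 v))
              (r1 u * (al2 v * q2 v) + s1 u * (be2 v * p2 v)) (r1 u * (al2 v * s2 v) + s1 u * (be2 v * r2 v))
    end).
  { intros i u v. destruct i; apply is_partial4_unique, is_partial4_mat; apply is_partial_plus;
      (evar_last; [apply PB; auto | reflexivity]). }
  assert (PN : forall i u v, partial4 i N u v = match i with
    | Cu => R4_of_mat (be1 u * p1 u * q2 v - al1 u * q1 u * p2 v) (be1 u * p1 u * s2 v - al1 u * q1 u * r2 v)
              (be1 u * r1 u * q2 v - al1 u * s1 u * p2 v) (be1 u * r1 u * s2 v - al1 u * s1 u * r2 v)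
    | Cv => R4_of_mat (q1 u * (be2 v * p2 v) - p1 u * (al2 v * q2 v)) (q1 u * (be2 v * r2 v) - p1 u * (al2 v * s2 v))
              (s1 u * (be2 v * p2 v) - r1 u * (al2 v * q2 v)) (s1 u * (be2 v * r2 v) - r1 u * (al2 v * s2 v))
    end).
  { intros i u v. destruct i; apply is_partial4_unique, is_partial4_mat; apply is_partial_minus;
      (evar_last; [apply PB; auto | reflexivity]). }
  assert (HF : forms_A w1 w2 f N).
  { intros u v. unfold form_I, form_II, form_III, ip_d. rewrite !Pf, !PN.
    pose proof (E1 u) as e1. pose proof (E2 v) as e2.
    assert (De : (p1 u * s1 u - q1 u * r1 u) * (p2 v * s2 v - q2 v * r2 v) = 1) by (rewrite e1, e2; ring).
    assert (Hx : forall a b, a = b * ((p1 u * s1 u - q1 u * r1 u) * (p2 v * s2 v - q2 v * r2 v)) -> a = b)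
      by (intros a b Hab; rewrite Hab, De; ring).
    unfold opp_sym2; simpl.
    split; [| split]; f_equal; apply Hx; rewrite ?cos_2a, ?cos_minus, ?sin_plus;
      unfold ip, R4_of_mat, x0, x1, x2, x3, al1, be1, al2, be2; simpl; field. }
  exists f, N. split; [| split; [| exact HF]].
  - split; [| split].
    + apply smooth4_mat; apply Cinf_plus; apply SB; assumption.
    + intros u v. pose proof (E1 u) as e1. pose proof (E2 v) as e2.
      transitivity (- ((p1 u * s1 u - q1 u * r1 u) * (p2 v * s2 v - q2 v * r2 v))); [| rewrite e1, e2; ring].
      unfold ip, f, R4_of_mat, x0, x1, x2, x3; simpl; field.
    + intros u v a b. apply (independent_of_form_A w1 w2 HA f u v). exact (proj1 (HF u v)).
  - split.
    + apply smooth4_mat; apply Cinf_minus; apply SB; assumption.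
    + intros u v. pose proof (E1 u) as e1. pose proof (E2 v) as e2. split; [| split].
      * transitivity ((p1 u * s1 u - q1 u * r1 u) * (p2 v * s2 v - q2 v * r2 v)); [| rewrite e1, e2; ring].
        unfold ip, N, R4_of_mat, x0, x1, x2, x3; simpl; field.
      * unfold ip, f, N, R4_of_mat, x0, x1, x2, x3; simpl; field.
      * intros i. rewrite Pf. destruct i; unfold ip, N, R4_of_mat, x0, x1, x2, x3; simpl; field.
Qed.

Theorem immersion_A_geometry w1 w2 : angle_pair w1 w2 -> forall f N, immersion_A w1 w2 f N ->
  flat (form_I f) /\ timelike f /\
  (forall (a b : Rbar) (c : R -> R * R), regular_curve a b c ->
     (asymptotic_curve f N a b c <-> in_coordinate_curve a b c)) /\
  (forall c1 c2 : R,
     (exists phi : plane_map, isometry (form_I f) gL2 phi) <-> global_diffeo (map_B w1 w2 c1 c2)).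
Proof.
  intros HA f N (_ & _ & HF).
  assert (EI : form_I f = form_A w1 w2).
  { apply plane_ext; intros u v. exact (proj1 (HF u v)). }
  split; [rewrite EI; apply form_A_flat, HA |].
  split; [intros u v; rewrite EI; apply form_A_lorentzian, HA |].
  split.
  - apply (asymptotic_iff_coordinate f N (fun u v => sin (w1 u + w2 v))).
    + intros u v. exact (proj1 (proj2 (HF u v))).
    + intros u v. apply sin_sum_neq, HA.
  - apply isometry_iff_map_B; [exact HA |]. intros u v. rewrite EI. reflexivity.
Qed.

(** * Vector calculus in R^4_2 *)

Definition Cinf4 (f : R -> R -> R4) : Prop :=
  Cinf everywhere (fun u v => x0 (f u v)) /\ Cinf everywhere (fun u v => x1 (f u v)) /\
  Cinf everywhere (fun u v => x2 (f u v)) /\ Cinf everywhere (fun u v => x3 (f u v)).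

Lemma smooth4_Cinf4 f : smooth4 f -> Cinf4 f.
Proof. intros (H0 & H1 & H2 & H3). split; [| split; [| split]]; apply smooth_Cinf; assumption. Qed.

Lemma Cinf4_smooth4 f : Cinf4 f -> smooth4 f.
Proof. intros (H0 & H1 & H2 & H3). split; [| split; [| split]]; apply Cinf_smooth; assumption. Qed.

Lemma Cinf4_partial4 f i : Cinf4 f -> Cinf4 (partial4 i f).
Proof.
  intros (H0 & H1 & H2 & H3). split; [| split; [| split]].
  - apply (Cinf_partial everywhere _ open_everywhere H0 i).
  - apply (Cinf_partial everywhere _ open_everywhere H1 i).
  - apply (Cinf_partial everywhere _ open_everywhere H2 i).
  - apply (Cinf_partial everywhere _ open_everywhere H3 i).
Qed.

Lemma Cinf4_is_partial4 f i u v : Cinf4 f -> is_partial4 i f u v (partial4 i f u v).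
Proof.
  intros (H0 & H1 & H2 & H3). split; [| split; [| split]].
  - apply (Cinf_part _ i u v H0).
  - apply (Cinf_part _ i u v H1).
  - apply (Cinf_part _ i u v H2).
  - apply (Cinf_part _ i u v H3).
Qed.

Lemma schwarz4 f : Cinf4 f -> partial4 Cu (partial4 Cv f) = partial4 Cv (partial4 Cu f).
Proof.
  intros (H0 & H1 & H2 & H3).
  apply plane_ext; intros u v.
  pose proof (Cinf_schwarz everywhere _ open_everywhere H0 u v I) as E0.
  pose proof (Cinf_schwarz everywhere _ open_everywhere H1 u v I) as E1.
  pose proof (Cinf_schwarz everywhere _ open_everywhere H2 u v I) as E2.
  pose proof (Cinf_schwarz everywhere _ open_everywhere H3 u v I) as E3.
  symmetry. exact (f_equal2 pair (f_equal2 pair (f_equal2 pair E0 E1) E2) E3).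
Qed.

Lemma Cinf_ip f g : Cinf4 f -> Cinf4 g -> Cinf everywhere (fun u v => ip (f u v) (g u v)).
Proof.
  intros (H0 & H1 & H2 & H3) (K0 & K1 & K2 & K3). unfold ip. cinf.
Qed.

Lemma is_partial_ip i f g u v d e : is_partial4 i f u v d -> is_partial4 i g u v e ->
  is_partial i (fun s t => ip (f s t) (g s t)) u v (ip d (g u v) + ip (f u v) e).
Proof.
  intros (H0 & H1 & H2 & H3) (K0 & K1 & K2 & K3). unfold ip. evar_last.
  - partials.
  - cbv beta. ring.
Qed.

Lemma partial_ip i f g u v : Cinf4 f -> Cinf4 g ->
  partial i (fun s t => ip (f s t) (g s t)) u v = ip (partial4 i f u v) (g u v) + ip (f u v) (partial4 i g u v).
Proof. intros Hf Hg. apply is_partial_unique, is_partial_ip; apply Cinf4_is_partial4; assumption. Qed.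

Lemma ip_sym X Y : ip X Y = ip Y X.
Proof. unfold ip. ring. Qed.

Lemma ip_constant i f g c u v : Cinf4 f -> Cinf4 g -> (forall s t, ip (f s t) (g s t) = c) ->
  ip (partial4 i f u v) (g u v) + ip (f u v) (partial4 i g u v) = 0.
Proof.
  intros Hf Hg Hc. rewrite <- (partial_ip i f g u v Hf Hg). apply is_partial_unique.
  apply (is_partial_ext i (fun _ _ => c)); [intros; symmetry; apply Hc | apply is_partial_const].
Qed.

Definition det3 (a1 a2 a3 b1 b2 b3 c1 c2 c3 : R) : R :=
  a1 * (b2 * c3 - b3 * c2) - a2 * (b1 * c3 - b3 * c1) + a3 * (b1 * c2 - b2 * c1).

(** [ip (cross A B C) D] is the determinant of [A], [B], [C], [D]. *)
Definition cross (A B C : R4) : R4 :=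
  (det3 (x1 A) (x2 A) (x3 A) (x1 B) (x2 B) (x3 B) (x1 C) (x2 C) (x3 C),
   - det3 (x0 A) (x2 A) (x3 A) (x0 B) (x2 B) (x3 B) (x0 C) (x2 C) (x3 C),
   - det3 (x0 A) (x1 A) (x3 A) (x0 B) (x1 B) (x3 B) (x0 C) (x1 C) (x3 C),
   det3 (x0 A) (x1 A) (x2 A) (x0 B) (x1 B) (x2 B) (x0 C) (x1 C) (x2 C)).

Lemma cross_orth A B C : ip (cross A B C) A = 0 /\ ip (cross A B C) B = 0 /\ ip (cross A B C) C = 0.
Proof. unfold ip, cross, det3; simpl. unfold x0, x1, x2, x3; simpl. split; [| split]; ring. Qed.

Lemma cross_norm A B C : ip (cross A B C) (cross A B C) =
  det3 (ip A A) (ip A B) (ip A C) (ip B A) (ip B B) (ip B C) (ip C A) (ip C B) (ip C C).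
Proof.
  destruct A as [[[a0 a1] a2] a3], B as [[[b0 b1] b2] b3], C as [[[c0 c1] c2] c3].
  unfold ip, cross, det3, x0, x1, x2, x3; simpl. ring.
Qed.

Lemma cramer A B C D V W :
  ip (cross A B C) D * ip V W =
  - ip V A * ip (cross B C D) W + ip V B * ip (cross A C D) W
  - ip V C * ip (cross A B D) W + ip V D * ip (cross A B C) W.
Proof.
  destruct A as [[[a0 a1] a2] a3], B as [[[b0 b1] b2] b3], C as [[[c0 c1] c2] c3],
    D as [[[d0 d1] d2] d3], V as [[[v0 v1] v2] v3], W as [[[w0 w1] w2] w3].
  unfold ip, cross, det3, x0, x1, x2, x3; simpl. ring.
Qed.

(** The difference between [V] and its expansion in the orthonormal frame [A], [B],
    [C], [cross A B C] is orthogonal to the frame, hence zero by Cramer's rule. *)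
Lemma parseval A B C V W :
  ip A A = -1 -> ip B B = -1 -> ip C C = 1 -> ip A B = 0 -> ip A C = 0 -> ip B C = 0 ->
  ip V W = - (ip V A * ip W A) - ip V B * ip W B + ip V C * ip W C
           + ip V (cross A B C) * ip W (cross A B C).
Proof.
  intros AA BB CC AB AC BC. set (D := cross A B C).
  destruct (cross_orth A B C) as (DA & DB & DC). fold D in DA, DB, DC.
  assert (DD : ip D D = 1).
  { unfold D. rewrite cross_norm, (ip_sym B A), (ip_sym C A), (ip_sym C B), AA, BB, CC, AB, AC, BC.
    unfold det3. ring. }
  set (lin := fun a b c d : R =>
    ((a * x0 A + b * x0 B + c * x0 C + d * x0 D, a * x1 A + b * x1 B + c * x1 C + d * x1 D,
      a * x2 A + b * x2 B + c * x2 C + d * x2 D, a * x3 A + b * x3 B + c * x3 C + d * x3 D) : R4)).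
  set (L := lin (ip V A) (ip V B) (- ip V C) (- ip V D)).
  assert (HL : forall X, ip L X = ip V A * ip A X + ip V B * ip B X - ip V C * ip C X - ip V D * ip D X).
  { intros X. unfold L, lin. generalize (ip V A) (ip V B) (ip V C) (ip V D).
    intros. unfold ip, x0, x1, x2, x3; simpl. ring. }
  set (V' := ((x0 V + x0 L, x1 V + x1 L, x2 V + x2 L, x3 V + x3 L) : R4)).
  assert (HV' : forall X, ip V' X = ip V X + ip L X).
  { intros X. unfold V'. unfold ip, x0, x1, x2, x3; simpl. ring. }
  assert (ZA : ip V' A = 0) by (rewrite HV', HL, AA, DA, (ip_sym B A), (ip_sym C A), AB, AC; ring).
  assert (ZB : ip V' B = 0) by (rewrite HV', HL, BB, DB, AB, (ip_sym C B), BC; ring).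
  assert (ZC : ip V' C = 0) by (rewrite HV', HL, CC, DC, AC, BC; ring).
  assert (ZD : ip V' D = 0)
    by (rewrite HV', HL, DD, (ip_sym A D), (ip_sym B D), (ip_sym C D), DA, DB, DC; ring).
  pose proof (cramer A B C D V' W) as K. fold D in K. rewrite ZA, ZB, ZC, ZD, DD in K.
  rewrite HV', HL in K. rewrite (ip_sym W A), (ip_sym W B), (ip_sym W C), (ip_sym W D). lra.
Qed.

Lemma Cinf4_cross f g h : Cinf4 f -> Cinf4 g -> Cinf4 h -> Cinf4 (fun u v => cross (f u v) (g u v) (h u v)).
Proof.
  intros (F0 & F1 & F2 & F3) (G0 & G1 & G2 & G3) (H0 & H1 & H2 & H3).
  assert (K : forall a1 a2 a3 b1 b2 b3 c1 c2 c3 : R -> R -> R,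
    Cinf everywhere a1 -> Cinf everywhere a2 -> Cinf everywhere a3 -> Cinf everywhere b1 -> Cinf everywhere b2 ->
    Cinf everywhere b3 -> Cinf everywhere c1 -> Cinf everywhere c2 -> Cinf everywhere c3 ->
    Cinf everywhere (fun u v => det3 (a1 u v) (a2 u v) (a3 u v) (b1 u v) (b2 u v) (b3 u v) (c1 u v) (c2 u v) (c3 u v))).
  { intros. unfold det3. cinf. }
  split; [| split; [| split]]; unfold cross; cbn [x0 x1 x2 x3 fst snd].
  - apply (K _ _ _ _ _ _ _ _ _ F1 F2 F3 G1 G2 G3 H1 H2 H3).
  - apply (Cinf_opp everywhere _ (K _ _ _ _ _ _ _ _ _ F0 F2 F3 G0 G2 G3 H0 H2 H3)).
  - apply (Cinf_opp everywhere _ (K _ _ _ _ _ _ _ _ _ F0 F1 F3 G0 G1 G3 H0 H1 H3)).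
  - apply (K _ _ _ _ _ _ _ _ _ F0 F1 F2 G0 G1 G2 H0 H1 H2).
Qed.

(** * Isometric immersions of the Lorentz plane *)

(** As the induced metric is constant, the second derivatives of [f] have no
    tangential part. The Gauss and Codazzi equations then follow from the equality
    of mixed third derivatives. *)
Theorem gauss_codazzi f : immersion_H31 f -> (forall x y, form_I f x y = gL2 x y) ->
  exists (N : R -> R -> R4) (a b c : R -> R -> R),
    unit_normal f N /\ Cinf everywhere a /\ Cinf everywhere b /\ Cinf everywhere c /\
    (forall u v, a u v * c u v - b u v * b u v = -1) /\
    (forall u v, partial Cv a u v = partial Cu b u v) /\
    (forall u v, partial Cv b u v = partial Cu c u v) /\
    (forall u v, form_II f N u v = Sym2 (a u v) (b u v) (c u v)) /\
    (forall u v, ip (partial4 Cu f u v) (partial4 Cv N u v) = ip (partial4 Cv f u v) (partial4 Cu N u v)) /\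
    (forall u v, form_III N u v = Sym2 (b u v * b u v - a u v * a u v) (b u v * c u v - a u v * b u v)
                                       (c u v * c u v - b u v * b u v)).
Proof.
  intros (Hsm & H1 & _) HI.
  pose proof (smooth4_Cinf4 f Hsm) as Sf.
  set (fd := fun i => partial4 i f).
  assert (Sd : forall i, Cinf4 (fd i)) by (intro i; apply Cinf4_partial4, Sf).
  set (N := fun u v => cross (f u v) (fd Cu u v) (fd Cv u v)).
  assert (SN : Cinf4 N) by (apply Cinf4_cross; auto).
  assert (Guu : forall u v, ip (fd Cu u v) (fd Cu u v) = -1) by (intros u v; apply (f_equal cE (HI u v))).
  assert (Gvv : forall u v, ip (fd Cv u v) (fd Cv u v) = 1) by (intros u v; apply (f_equal cG (HI u v))).
  assert (Guv : forall u v, ip (fd Cu u v) (fd Cv u v) = 0).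
  { intros u v. pose proof (f_equal cF (HI u v)) as E. unfold form_I, ip_d in E; simpl in E.
    rewrite (ip_sym (partial4 Cv f u v)) in E. unfold fd. lra. }
  assert (G0 : forall i u v, ip (f u v) (fd i u v) = 0).
  { intros i u v. pose proof (ip_constant i f f (-1) u v Sf Sf H1) as E.
    rewrite (ip_sym (partial4 i f u v)) in E. unfold fd. lra. }
  assert (PV : forall u v V W, ip V W = - (ip V (f u v) * ip W (f u v)) - ip V (fd Cu u v) * ip W (fd Cu u v)
     + ip V (fd Cv u v) * ip W (fd Cv u v) + ip V (N u v) * ip W (N u v)).
  { intros u v V W. apply parseval; auto. }
  assert (Nf : forall u v, ip (N u v) (f u v) = 0) by (intros u v; apply cross_orth).
  assert (Nd : forall i u v, ip (N u v) (fd i u v) = 0) by (intros i u v; destruct i; apply cross_orth).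
  assert (NN : forall u v, ip (N u v) (N u v) = 1).
  { intros u v. unfold N. rewrite cross_norm.
    rewrite (ip_sym (fd Cu u v) (f u v)), (ip_sym (fd Cv u v) (f u v)), (ip_sym (fd Cv u v) (fd Cu u v)),
      H1, Guu, Gvv, Guv, !G0. unfold det3. ring. }
  set (dd := fun i j => partial4 j (fd i)).
  assert (Sdd : forall i j, Cinf4 (dd i j)) by (intros; apply Cinf4_partial4, Sd).
  assert (Edd : dd Cv Cu = dd Cu Cv) by (apply schwarz4, Sf).
  assert (ddf : forall i j u v, ip (dd i j u v) (f u v) = - ip (fd i u v) (fd j u v)).
  { intros i j u v. assert (Z : forall s t, ip (fd i s t) (f s t) = 0) by (intros; rewrite ip_sym; apply G0).
    pose proof (ip_constant j (fd i) f 0 u v (Sd i) Sf Z) as E. unfold dd, fd in *. lra. }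
  assert (T1 : forall i u v, ip (dd Cu i u v) (fd Cu u v) = 0).
  { intros i u v. pose proof (ip_constant i (fd Cu) (fd Cu) (-1) u v (Sd Cu) (Sd Cu) Guu) as E.
    rewrite (ip_sym (fd Cu u v)) in E. unfold dd. lra. }
  assert (T2 : forall i u v, ip (dd Cv i u v) (fd Cv u v) = 0).
  { intros i u v. pose proof (ip_constant i (fd Cv) (fd Cv) 1 u v (Sd Cv) (Sd Cv) Gvv) as E.
    rewrite (ip_sym (fd Cv u v)) in E. unfold dd. lra. }
  assert (T3 : forall i u v, ip (dd Cu i u v) (fd Cv u v) + ip (dd Cv i u v) (fd Cu u v) = 0).
  { intros i u v. pose proof (ip_constant i (fd Cu) (fd Cv) 0 u v (Sd Cu) (Sd Cv) Guv) as E.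
    rewrite (ip_sym (fd Cu u v)) in E. exact E. }
  assert (T : forall i j k u v, ip (dd i j u v) (fd k u v) = 0).
  { intros i j k u v. pose proof (T1 Cu u v) as q1. pose proof (T1 Cv u v) as q2. pose proof (T2 Cu u v) as q3.
    pose proof (T2 Cv u v) as q4. pose proof (T3 Cu u v) as q5. pose proof (T3 Cv u v) as q6.
    rewrite Edd in *. destruct i, j, k; try rewrite Edd; lra. }
  set (h := fun i j u v => ip (dd i j u v) (N u v)).
  assert (Sh : forall i j, Cinf everywhere (h i j)) by (intros; apply Cinf_ip; auto).
  assert (NiN : forall i u v, ip (partial4 i N u v) (N u v) = 0).
  { intros i u v. pose proof (ip_constant i N N 1 u v SN SN NN) as E. rewrite (ip_sym (N u v)) in E. lra. }
  assert (Nif : forall i u v, ip (partial4 i N u v) (f u v) = 0).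
  { intros i u v. pose proof (ip_constant i N f 0 u v SN Sf Nf) as E. pose proof (Nd i u v) as E'. unfold fd in E'. lra. }
  assert (Nid : forall i j u v, ip (partial4 i N u v) (fd j u v) = - h j i u v).
  { intros i j u v. pose proof (ip_constant i N (fd j) 0 u v SN (Sd j) (Nd j)) as E. unfold h.
    rewrite (ip_sym (dd j i u v)). unfold dd. lra. }
  (* the second derivatives of f are orthogonal to the derivatives of N *)
  assert (dh : forall i j k u v, partial k (h i j) u v = ip (partial4 k (dd i j) u v) (N u v)).
  { intros i j k u v. unfold h. rewrite (partial_ip k (dd i j) N u v (Sdd i j) SN).
    rewrite (PV u v (dd i j u v) (partial4 k N u v)), !T, Nif, NiN. ring. }
  assert (Third : forall i, partial4 Cv (dd i Cu) = partial4 Cu (dd i Cv))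
    by (intro i; symmetry; apply schwarz4, Sd).
  exists N, (h Cu Cu), (h Cu Cv), (h Cv Cv).
  split; [| do 3 (split; [apply Sh |])].
  { split; [apply Cinf4_smooth4, SN |]. intros u v. split; [apply NN |]. split; [apply Nf |]. intro i; apply Nd. }
  split; [| split; [| split; [| split; [| split]]]]; intros u v.
  - assert (X1 : ip (dd Cu Cu u v) (dd Cv Cv u v) = ip (dd Cu Cv u v) (dd Cu Cv u v)).
    { pose proof (ip_constant Cv (dd Cu Cu) (fd Cv) 0 u v (Sdd Cu Cu) (Sd Cv) (T Cu Cu Cv)) as E1.
      pose proof (ip_constant Cu (dd Cu Cv) (fd Cv) 0 u v (Sdd Cu Cv) (Sd Cv) (T Cu Cv Cv)) as E2.
      rewrite (Third Cu) in E1. change (partial4 Cv (fd Cv)) with (dd Cv Cv) in E1.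
      change (partial4 Cu (fd Cv)) with (dd Cv Cu) in E2. rewrite Edd in E2. lra. }
    rewrite (PV u v (dd Cu Cu u v)), (PV u v (dd Cu Cv u v)), !ddf, !T, Guu, Gvv, Guv in X1.
    fold (h Cu Cu u v) (h Cv Cv u v) (h Cu Cv u v) in X1. lra.
  - rewrite !dh, Third. reflexivity.
  - rewrite !dh, <- Third, Edd. reflexivity.
  - unfold form_II, ip_d, opp_sym2; simpl.
    rewrite (ip_sym (partial4 Cu f u v) (partial4 Cu N u v)), (ip_sym (partial4 Cu f u v) (partial4 Cv N u v)),
      (ip_sym (partial4 Cv f u v) (partial4 Cu N u v)), (ip_sym (partial4 Cv f u v) (partial4 Cv N u v)).
    change (partial4 Cu f) with (fd Cu). change (partial4 Cv f) with (fd Cv).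
    rewrite !Nid. unfold h at 3. rewrite Edd. fold (h Cu Cv u v). f_equal; lra.
  - change (partial4 Cu f) with (fd Cu). change (partial4 Cv f) with (fd Cv).
    rewrite (ip_sym (fd Cu u v)), (ip_sym (fd Cv u v)), !Nid. unfold h. rewrite Edd. reflexivity.
  - unfold form_III, ip_d; simpl.
    assert (E : forall i j, ip (partial4 i N u v) (partial4 j N u v) = - (h Cu i u v * h Cu j u v) + h Cv i u v * h Cv j u v).
    { intros i j. rewrite (PV u v), !Nif, !NiN, !Nid. ring. }
    rewrite !E. assert (Eh : h Cv Cu u v = h Cu Cv u v) by (unfold h; rewrite Edd; reflexivity).
    rewrite Eh. f_equal; lra.
Qed.

(** For sg = W1 + W2 and al = W1 - W2 one must have (a + c) / 2 = - cot sg,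
    (a - c) / 2 = cos al / sin sg and b = sin al / sin sg. The first equation
    defines sg in (0, PI). By the Gauss equation the other two prescribe a point of
    the unit circle, whose angle lifts to the simply connected plane. *)
Theorem asymptotic_angles a b c :
  Cinf everywhere a -> Cinf everywhere b -> Cinf everywhere c ->
  (forall u v, a u v * c u v - b u v * b u v = -1) ->
  (forall u v, partial Cv a u v = partial Cu b u v) ->
  (forall u v, partial Cv b u v = partial Cu c u v) ->
  exists W1 W2, Cinf everywhere W1 /\ Cinf everywhere W2 /\
    (forall u v, 0 < W1 u v + W2 u v < PI) /\
    (forall u v, a u v = 2 * sin (W1 u v) * sin (W2 u v) / sin (W1 u v + W2 u v) /\
                 b u v = sin (W1 u v - W2 u v) / sin (W1 u v + W2 u v) /\
                 c u v = - 2 * cos (W1 u v) * cos (W2 u v) / sin (W1 u v + W2 u v)) /\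
    (forall u v, cos (W2 u v) * partial Cu W1 u v - sin (W2 u v) * partial Cv W1 u v = 0) /\
    (forall u v, cos (W1 u v) * partial Cu W2 u v + sin (W1 u v) * partial Cv W2 u v = 0).
Proof.
  intros Sa Sb Sc HG HC1 HC2.
  set (k := fun u v => (a u v + c u v) / 2).
  set (sg := fun u v => PI / 2 + atan (k u v)).
  assert (Ssg : Cinf everywhere sg) by (unfold sg, k; cinf).
  assert (Rsg : forall u v, 0 < sg u v < PI).
  { intros u v. unfold sg. pose proof (atan_bound (k u v)). lra. }
  assert (Psg : forall u v, 0 < sin (sg u v)) by (intros u v; apply sin_gt_0; apply Rsg).
  assert (Csg : forall u v, cos (sg u v) = - k u v * sin (sg u v)).
  { intros u v. unfold sg. rewrite cos_plus, sin_plus, cos_PI2, sin_PI2.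
    pose proof (atan_bound (k u v)) as B.
    assert (P : 0 < cos (atan (k u v))) by (apply cos_gt_0; lra).
    pose proof (tan_atan (k u v)) as E. unfold tan in E.
    assert (E' : sin (atan (k u v)) = k u v * cos (atan (k u v))) by (rewrite <- E at 2; field; lra).
    rewrite E'. ring. }
  assert (Nsg : forall u v, sin (sg u v) * sin (sg u v) * (1 + k u v * k u v) = 1).
  { intros u v. pose proof (pythagoras (sg u v)) as E. rewrite Csg in E. lra. }
  destruct (angle_lift (fun u v => (a u v - c u v) / 2 * sin (sg u v)) (fun u v => b u v * sin (sg u v)))
    as (al & Sal & Eal).
  { cinf. } { cinf. }
  { intros u v. rewrite <- (Nsg u v). unfold k. specialize (HG u v).
    transitivity (sin (sg u v) * sin (sg u v) * (- (a u v * c u v - b u v * b u v) + (a u v + c u v) / 2 * ((a u v + c u v) / 2))).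
    - field. - rewrite HG. ring. }
  set (W1 := fun u v => (sg u v + al u v) / 2). set (W2 := fun u v => (sg u v - al u v) / 2).
  assert (SW1 : Cinf everywhere W1) by (unfold W1; cinf).
  assert (SW2 : Cinf everywhere W2) by (unfold W2; cinf).
  assert (Esum : forall u v, W1 u v + W2 u v = sg u v) by (intros; unfold W1, W2; field).
  assert (Edif : forall u v, W1 u v - W2 u v = al u v) by (intros; unfold W1, W2; field).
  assert (Hs : forall u v, sin (W1 u v + W2 u v) <> 0) by (intros; rewrite Esum; apply Rgt_not_eq, Psg).
  assert (Ea : forall u v, a u v = 2 * sin (W1 u v) * sin (W2 u v) / sin (W1 u v + W2 u v)).
  { intros u v. replace (2 * sin (W1 u v) * sin (W2 u v)) with (cos (W1 u v - W2 u v) - cos (W1 u v + W2 u v))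
      by (rewrite cos_minus, cos_plus; ring).
    rewrite Edif, Esum, Csg. destruct (Eal u v) as [E _]. rewrite <- E. unfold k. field. apply Rgt_not_eq, Psg. }
  assert (Ec : forall u v, c u v = - 2 * cos (W1 u v) * cos (W2 u v) / sin (W1 u v + W2 u v)).
  { intros u v. replace (- 2 * cos (W1 u v) * cos (W2 u v)) with (- cos (W1 u v - W2 u v) - cos (W1 u v + W2 u v))
      by (rewrite cos_minus, cos_plus; ring).
    rewrite Edif, Esum, Csg. destruct (Eal u v) as [E _]. rewrite <- E. unfold k. field. apply Rgt_not_eq, Psg. }
  assert (Eb : forall u v, b u v = sin (W1 u v - W2 u v) / sin (W1 u v + W2 u v)).
  { intros u v. rewrite Edif, Esum. destruct (Eal u v) as [_ E]. rewrite <- E. field. apply Rgt_not_eq, Psg. }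
  assert (PW1 : forall i u v, is_partial i W1 u v (partial i W1 u v)) by (intros; apply Cinf_part, SW1).
  assert (PW2 : forall i u v, is_partial i W2 u v (partial i W2 u v)) by (intros; apply Cinf_part, SW2).
  (* II(e_th, e_ph) for Euclidean unit vectors e_th, e_ph of angles th, ph; the
     coefficients of II are its values at the angles 0 and PI / 2 *)
  set (II := fun th ph u v => (sin (W2 u v + th) * sin (W1 u v - ph) + sin (W2 u v + ph) * sin (W1 u v - th))
     / sin (W1 u v + W2 u v)).
  clearbody W1 W2.
  assert (DII : forall th ph i u v, is_partial i (II th ph) u v
     (2 * (sin (W2 u v + th) * sin (W2 u v + ph) * partial i W1 u v
         + sin (W1 u v - th) * sin (W1 u v - ph) * partial i W2 u v) / (sin (W1 u v + W2 u v) * sin (W1 u v + W2 u v)))).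
  { intros th ph i u v. evar_last; [unfold II; partials; apply Hs | cbv beta].
    set (S := sin (W1 u v + W2 u v)). set (C := cos (W1 u v + W2 u v)).
    assert (e1 : forall t, sin (W2 u v + t) = S * cos (W1 u v - t) - C * sin (W1 u v - t))
      by (intros t; unfold S, C; rewrite <- sin_minus; f_equal; ring).
    assert (e2 : forall t, cos (W2 u v + t) = C * cos (W1 u v - t) + S * sin (W1 u v - t))
      by (intros t; unfold S, C; rewrite <- cos_minus; f_equal; ring).
    f_equal. rewrite !e1, !e2.
    pose proof (pythagoras (W1 u v + W2 u v)) as p. fold S C in p.
    set (A := cos (W1 u v - th)). set (A' := sin (W1 u v - th)).
    set (B := cos (W1 u v - ph)). set (B' := sin (W1 u v - ph)).
    transitivity (2 * ((S * A - C * A') * (S * B - C * B') * partial i W1 u v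
      + A' * B' * (S * S + C * C) * partial i W2 u v)); [ring | rewrite p; ring]. }
  assert (Q : forall t, sin (t + PI / 2) = cos t /\ sin (t - PI / 2) = - cos t)
    by (intros t; rewrite sin_plus, sin_minus, sin_PI2, cos_PI2; split; ring).
  assert (Da : forall i u v, is_partial i a u v (2 * (sin (W2 u v) * sin (W2 u v) * partial i W1 u v
      + sin (W1 u v) * sin (W1 u v) * partial i W2 u v) / (sin (W1 u v + W2 u v) * sin (W1 u v + W2 u v)))).
  { intros i u v. apply (is_partial_ext i (II 0 0)).
    - intros x y. unfold II. rewrite Ea, !Rplus_0_r, !Rminus_0_r. f_equal. ring.
    - evar_last; [apply DII | rewrite !Rplus_0_r, !Rminus_0_r; reflexivity]. }
  assert (Dc : forall i u v, is_partial i c u v (2 * (cos (W2 u v) * cos (W2 u v) * partial i W1 u v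
      + cos (W1 u v) * cos (W1 u v) * partial i W2 u v) / (sin (W1 u v + W2 u v) * sin (W1 u v + W2 u v)))).
  { intros i u v. apply (is_partial_ext i (II (PI / 2) (PI / 2))).
    - intros x y. unfold II. rewrite Ec, !(proj1 (Q _)), !(proj2 (Q _)). f_equal. ring.
    - evar_last; [apply DII | rewrite !(proj1 (Q _)), !(proj2 (Q _)); f_equal; ring]. }
  assert (Db : forall i u v, is_partial i b u v (2 * (sin (W2 u v) * cos (W2 u v) * partial i W1 u v
      - sin (W1 u v) * cos (W1 u v) * partial i W2 u v) / (sin (W1 u v + W2 u v) * sin (W1 u v + W2 u v)))).
  { intros i u v. apply (is_partial_ext i (II 0 (PI / 2))).
    - intros x y. unfold II. rewrite Eb, (proj1 (Q _)), (proj2 (Q _)), Rplus_0_r, Rminus_0_r, sin_minus. f_equal. ring.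
    - evar_last; [apply DII | rewrite (proj1 (Q _)), (proj2 (Q _)), Rplus_0_r, Rminus_0_r; f_equal; ring]. }
  (* the Codazzi equations form an invertible linear system in the two derivatives *)
  assert (Hsys : forall u v,
    cos (W2 u v) * partial Cu W1 u v - sin (W2 u v) * partial Cv W1 u v = 0 /\
    cos (W1 u v) * partial Cu W2 u v + sin (W1 u v) * partial Cv W2 u v = 0).
  { intros u v. pose proof (HC1 u v) as e1. pose proof (HC2 u v) as e2.
    rewrite (is_partial_unique _ _ _ _ _ (Da Cv u v)), (is_partial_unique _ _ _ _ _ (Db Cu u v)) in e1.
    rewrite (is_partial_unique _ _ _ _ _ (Db Cv u v)), (is_partial_unique _ _ _ _ _ (Dc Cu u v)) in e2.
    pose proof (Hs u v) as H.
    set (S := sin (W1 u v + W2 u v)) in *.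
    assert (HSS : S * S <> 0) by (apply Rmult_integral_contrapositive; auto).
    assert (e1' : sin (W2 u v) * (cos (W2 u v) * partial Cu W1 u v - sin (W2 u v) * partial Cv W1 u v) -
        sin (W1 u v) * (cos (W1 u v) * partial Cu W2 u v + sin (W1 u v) * partial Cv W2 u v) = 0).
    { apply (f_equal (fun z => z * (S * S) / 2)) in e1. field_simplify in e1; [| exact H | exact H]. lra. }
    assert (e2' : cos (W2 u v) * (cos (W2 u v) * partial Cu W1 u v - sin (W2 u v) * partial Cv W1 u v) +
        cos (W1 u v) * (cos (W1 u v) * partial Cu W2 u v + sin (W1 u v) * partial Cv W2 u v) = 0).
    { apply (f_equal (fun z => z * (S * S) / 2)) in e2. field_simplify in e2; [| exact H | exact H]. lra. }
    set (A := cos (W2 u v) * partial Cu W1 u v - sin (W2 u v) * partial Cv W1 u v) in *.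
    set (B := cos (W1 u v) * partial Cu W2 u v + sin (W1 u v) * partial Cv W2 u v) in *.
    assert (ES : S = sin (W1 u v) * cos (W2 u v) + cos (W1 u v) * sin (W2 u v)) by (unfold S; apply sin_plus).
    split; apply Rmult_eq_reg_l with S; auto; rewrite ES, Rmult_0_r.
    - transitivity (cos (W1 u v) * (sin (W2 u v) * A - sin (W1 u v) * B) + sin (W1 u v) * (cos (W2 u v) * A + cos (W1 u v) * B));
        [ring | rewrite e1', e2'; ring].
    - transitivity (sin (W2 u v) * (cos (W2 u v) * A + cos (W1 u v) * B) - cos (W2 u v) * (sin (W2 u v) * A - sin (W1 u v) * B));
        [ring | rewrite e1', e2'; ring]. }
  exists W1, W2. split; [exact SW1 |]. split; [exact SW2 |].
  split; [intros u v; rewrite Esum; apply Rsg |].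
  split; [intros u v; split; [apply Ea | split; [apply Eb | apply Ec]] |].
  split; intros u v; apply Hsys.
Qed.

Lemma is_partial_smooth_compose i h p q u v dp dq : Cinf everywhere h ->
  is_partial i p u v dp -> is_partial i q u v dq ->
  is_partial i (fun s t => h (p s t) (q s t)) u v
    (partial Cu h (p u v) (q u v) * dp + partial Cv h (p u v) (q u v) * dq).
Proof.
  intros Hh. apply (is_partial_compose everywhere h (fun j => partial j h)); try exact I.
  - apply open_everywhere.
  - apply Cinf_is_partial, Hh.
  - apply Cinf_cont, Cinf_partial; [apply open_everywhere | exact Hh].
Qed.

(** The fields (cos W1, sin W1) and (cos W2, - sin W2) commute, so the dual forms
    have potentials [U] and [V]. The fields being bounded, (U, V) has a global
    inverse, in whose coordinates each angle depends on one variable. *)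
Theorem asymptotic_coordinates W1 W2 : Cinf everywhere W1 -> Cinf everywhere W2 ->
  (forall u v, 0 < W1 u v + W2 u v < PI) ->
  (forall u v, cos (W2 u v) * partial Cu W1 u v - sin (W2 u v) * partial Cv W1 u v = 0) ->
  (forall u v, cos (W1 u v) * partial Cu W2 u v + sin (W1 u v) * partial Cv W2 u v = 0) ->
  exists w1 w2 c1 c2, angle_pair w1 w2 /\ global_diffeo (map_B w1 w2 c1 c2) /\
    (forall u v, compose W1 (map_B w1 w2 c1 c2) u v = w1 u) /\
    (forall u v, compose W2 (map_B w1 w2 c1 c2) u v = w2 v).
Proof.
  intros S1 S2 HW H1 H2.
  assert (Hs : forall u v, sin (W1 u v + W2 u v) <> 0) by (intros; apply Rgt_not_eq, sin_gt_0; apply HW).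
  assert (PW1 : forall i u v, is_partial i W1 u v (partial i W1 u v)) by (intros; apply Cinf_part, S1).
  assert (PW2 : forall i u v, is_partial i W2 u v (partial i W2 u v)) by (intros; apply Cinf_part, S2).
  assert (PS : forall i u v, is_partial i (fun u v => sin (W1 u v + W2 u v)) u v
     (cos (W1 u v + W2 u v) * (partial i W1 u v + partial i W2 u v))).
  { intros. apply (is_partial_sin i (fun u v => W1 u v + W2 u v)), is_partial_plus; [apply PW1 | apply PW2]. }
  destruct (poincare (fun u v => sin (W2 u v) / sin (W1 u v + W2 u v)) (fun u v => cos (W2 u v) / sin (W1 u v + W2 u v)))
    as (U & SU & Uu & Uv).
  { cinf. } { cinf. }
  { intros u v. pose proof (Hs u v) as H.
    assert (P1 := is_partial_div Cv _ _ u v _ _ H (is_partial_sin Cv W2 u v _ (PW2 Cv u v)) (PS Cv u v)).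
    assert (P2 := is_partial_div Cu _ _ u v _ _ H (is_partial_cos Cu W2 u v _ (PW2 Cu u v)) (PS Cu u v)).
    rewrite (is_partial_unique _ _ _ _ _ P1), (is_partial_unique _ _ _ _ _ P2). cbv beta. f_equal.
    pose proof (pythagoras (W2 u v)) as p2. rewrite sin_plus, cos_plus.
    apply Rminus_diag_uniq.
    transitivity ((sin (W2 u v) * sin (W2 u v) + cos (W2 u v) * cos (W2 u v)) *
        (cos (W1 u v) * partial Cu W2 u v + sin (W1 u v) * partial Cv W2 u v)
      + (cos (W1 u v) * cos (W2 u v) - sin (W1 u v) * sin (W2 u v)) *
        (cos (W2 u v) * partial Cu W1 u v - sin (W2 u v) * partial Cv W1 u v));
      [ring | rewrite H1, H2; ring]. }
  destruct (poincare (fun u v => sin (W1 u v) / sin (W1 u v + W2 u v)) (fun u v => - cos (W1 u v) / sin (W1 u v + W2 u v)))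
    as (V & SV & Vu & Vv).
  { cinf. } { cinf. }
  { intros u v. pose proof (Hs u v) as H.
    assert (P1 := is_partial_div Cv _ _ u v _ _ H (is_partial_sin Cv W1 u v _ (PW1 Cv u v)) (PS Cv u v)).
    assert (P2 := is_partial_div Cu _ _ u v _ _ H (is_partial_opp _ _ _ _ _ (is_partial_cos Cu W1 u v _ (PW1 Cu u v))) (PS Cu u v)).
    rewrite (is_partial_unique _ _ _ _ _ P1), (is_partial_unique _ _ _ _ _ P2). cbv beta. f_equal.
    pose proof (pythagoras (W1 u v)) as p1. rewrite sin_plus, cos_plus.
    apply Rminus_diag_uniq.
    transitivity (- ((sin (W1 u v) * sin (W1 u v) + cos (W1 u v) * cos (W1 u v)) *
        (cos (W2 u v) * partial Cu W1 u v - sin (W2 u v) * partial Cv W1 u v))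
      - (cos (W1 u v) * cos (W2 u v) - sin (W1 u v) * sin (W2 u v)) *
        (cos (W1 u v) * partial Cu W2 u v + sin (W1 u v) * partial Cv W2 u v));
      [ring | rewrite H1, H2; ring]. }
  assert (Cont : forall h, Cinf everywhere h -> forall x y, continuity_2d_pt h x y)
    by (intros h Hh x y; apply (Cinf_cont everywhere h Hh x y I)).
  destruct (hadamard U V
    (fun u v => sin (W2 u v) / sin (W1 u v + W2 u v)) (fun u v => cos (W2 u v) / sin (W1 u v + W2 u v))
    (fun u v => sin (W1 u v) / sin (W1 u v + W2 u v)) (fun u v => - cos (W1 u v) / sin (W1 u v + W2 u v))
    (fun u v => cos (W1 u v)) (fun u v => sin (W1 u v)) (fun u v => cos (W2 u v)) (fun u v => - sin (W2 u v)) 1)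
    as (r & s & Cr & Cs & E1 & E2);
    try (apply Cont; cinf); try (apply Cinf_lipschitz_on_boxes; cinf);
    try (intros u v; pose proof (Hs u v) as H; rewrite sin_plus in *; field; exact H);
    try (intros u v; apply Rabs_le_between; pose proof (COS_bound (W1 u v)); pose proof (SIN_bound (W1 u v));
      pose proof (COS_bound (W2 u v)); pose proof (SIN_bound (W2 u v)); lra).
  { exact Uu. } { exact Uv. } { exact Vu. } { exact Vv. }
  assert (HJ : forall x y, partial Cu U x y * partial Cv V x y - partial Cv U x y * partial Cu V x y
     = - / sin (W1 x y + W2 x y)).
  { intros x y. rewrite (is_partial_unique _ _ _ _ _ (Uu x y)), (is_partial_unique _ _ _ _ _ (Uv x y)),
      (is_partial_unique _ _ _ _ _ (Vu x y)), (is_partial_unique _ _ _ _ _ (Vv x y)).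
    pose proof (Hs x y) as H. rewrite sin_plus in *. field. exact H. }
  assert (HJ0 : forall x y, everywhere x y ->
     partial Cu U x y * partial Cv V x y - partial Cv U x y * partial Cu V x y <> 0).
  { intros x y _. rewrite HJ. apply Ropp_neq_0_compat, Rinv_neq_0_compat, Hs. }
  destruct (inverse_smooth everywhere everywhere open_everywhere open_everywhere U V r s SU SV HJ0
    (fun _ _ _ => I) (fun x y _ => Cr x y) (fun x y _ => Cs x y) (fun x y _ => E1 x y)) as [Sr Ss].
  assert (HD : forall u v,
    is_partial Cu r u v (cos (W1 (r u v) (s u v))) /\ is_partial Cu s u v (sin (W1 (r u v) (s u v))) /\
    is_partial Cv r u v (cos (W2 (r u v) (s u v))) /\ is_partial Cv s u v (- sin (W2 (r u v) (s u v)))).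
  { intros u v.
    assert (IP := fun i => inverse_partials everywhere everywhere open_everywhere open_everywhere U V r s SU SV HJ0
      (fun _ _ _ => I) (fun x y _ => Cr x y) (fun x y _ => Cs x y) (fun x y _ => E1 x y) i u v I).
    destruct (IP Cu) as [D1 D2], (IP Cv) as [D3 D4]. clear IP.
    cbn [inverse_column fst snd] in D1, D2, D3, D4. rewrite HJ in D1, D2, D3, D4.
    rewrite (is_partial_unique _ _ _ _ _ (Vv _ _)) in D1. rewrite (is_partial_unique _ _ _ _ _ (Vu _ _)) in D2.
    rewrite (is_partial_unique _ _ _ _ _ (Uv _ _)) in D3. rewrite (is_partial_unique _ _ _ _ _ (Uu _ _)) in D4.
    pose proof (Hs (r u v) (s u v)) as H.
    split; [| split; [| split]].
    - evar_last; [exact D1 | field; exact H].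
    - evar_last; [exact D2 | field; exact H].
    - evar_last; [exact D3 | field; exact H].
    - evar_last; [exact D4 | field; exact H]. }
  set (w1 := fun u => W1 (r u 0) (s u 0)). set (w2 := fun v => W2 (r 0 v) (s 0 v)).
  assert (K1 : forall u v, W1 (r u v) (s u v) = w1 u).
  { intros u v. unfold w1.
    apply (const_of_derive_zero (fun t => W1 (r u t) (s u t))). intros t.
    destruct (HD u t) as (_ & _ & D3 & D4).
    evar_last; [apply (is_partial_smooth_compose Cv W1 r s u t _ _ S1 D3 D4) |].
    rewrite <- (H1 (r u t) (s u t)). ring. }
  assert (K2 : forall u v, W2 (r u v) (s u v) = w2 v).
  { intros u v. unfold w2.
    apply (const_of_derive_zero (fun t => W2 (r t v) (s t v))). intros t.
    destruct (HD t v) as (D1 & D2 & _ & _).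
    evar_last; [apply (is_partial_smooth_compose Cu W2 r s t v _ _ S2 D1 D2) |].
    rewrite <- (H2 (r t v) (s t v)). ring. }
  assert (Sline : forall W p q, Cinf everywhere W -> Cinf everywhere p -> Cinf everywhere q ->
     Cinf everywhere (fun u v => W (r (p u v) (q u v)) (s (p u v) (q u v)))).
  { intros W p q SW Sp Sqq. apply (Cinf_comp everywhere everywhere W); auto using open_everywhere.
    - apply (Cinf_comp everywhere everywhere r); auto using open_everywhere.
    - apply (Cinf_comp everywhere everywhere s); auto using open_everywhere. }
  assert (HA : angle_pair w1 w2).
  { split; [| split].
    - apply Cinf_smooth1. apply (Sline W1 (fun x _ => x) (fun _ _ => 0) S1); [apply Cinf_fst | apply Cinf_const].
    - apply Cinf_smooth1. apply (Sline W2 (fun _ _ => 0) (fun x _ => x) S2); [apply Cinf_const | apply Cinf_fst].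
    - intros u v. rewrite <- (K1 u v), <- (K2 u v). apply HW. }
  assert (C1 : forall t, continuous w1 t) by (intro; apply smooth1_continuous, HA).
  assert (C2 : forall t, continuous w2 t) by (intro; apply smooth1_continuous, HA).
  assert (EB : map_B w1 w2 (r 0 0) (s 0 0) = fun u v => (r u v, s u v)).
  { apply plane_ext; intros u v.
    change ((map_x w1 w2 (r 0 0) u v, map_y w1 w2 (s 0 0) u v) = (r u v, s u v)).
    assert (Ex : map_x w1 w2 (r 0 0) u v - r u v = map_x w1 w2 (r 0 0) 0 0 - r 0 0).
    { apply (const_of_partials_zero (fun u v => map_x w1 w2 (r 0 0) u v - r u v)). intros i x y.
      evar_last.
      - apply is_partial_minus; [apply (map_x_partial w1 w2 C1 C2) | apply (Cinf_part r i x y Sr)].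
      - destruct (HD x y) as (D1 & _ & D3 & _).
        destruct i; [rewrite (is_partial_unique _ _ _ _ _ D1), K1 | rewrite (is_partial_unique _ _ _ _ _ D3), K2]; ring. }
    assert (Ey : map_y w1 w2 (s 0 0) u v - s u v = map_y w1 w2 (s 0 0) 0 0 - s 0 0).
    { apply (const_of_partials_zero (fun u v => map_y w1 w2 (s 0 0) u v - s u v)). intros i x y.
      evar_last.
      - apply is_partial_minus; [apply (map_y_partial w1 w2 C1 C2) | apply (Cinf_part s i x y Ss)].
      - destruct (HD x y) as (_ & D2 & _ & D4).
        destruct i; [rewrite (is_partial_unique _ _ _ _ _ D2), K1 | rewrite (is_partial_unique _ _ _ _ _ D4), K2]; ring. }
    unfold map_x at 2 in Ex. unfold map_y at 2 in Ey. rewrite !RInt_point in Ex, Ey.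
    unfold zero in Ex, Ey; simpl in Ex, Ey. f_equal; lra. }
  exists w1, w2, (r 0 0), (s 0 0). split; [exact HA |]. rewrite EB.
  split; [| split; [intros u v; apply K1 | intros u v; apply K2]].
  apply global_diffeo_intro with (fun x y => (U x y, V x y)).
  - split; assumption.
  - split; assumption.
  - intros u v. unfold compose; simpl. destruct (E1 u v) as [-> ->]. reflexivity.
  - intros u v. unfold compose; simpl. destruct (E2 u v) as [-> ->]. reflexivity.
Qed.

(** * Reparametrization *)

Definition lin (a : R) (X : R4) (b : R) (Y : R4) : R4 :=
  (a * x0 X + b * x0 Y, a * x1 X + b * x1 Y, a * x2 X + b * x2 Y, a * x3 X + b * x3 Y).

Lemma ip_lin_l a X b Y Z : ip (lin a X b Y) Z = a * ip X Z + b * ip Y Z.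
Proof. unfold ip, lin, x0, x1, x2, x3; simpl. ring. Qed.

Lemma ip_lin_r a X b Y Z : ip Z (lin a X b Y) = a * ip Z X + b * ip Z Y.
Proof. unfold ip, lin, x0, x1, x2, x3; simpl. ring. Qed.

Lemma partial4_compose f phi i u v : Cinf4 f -> smooth_map phi ->
  partial4 i (compose f phi) u v =
  lin (fst (partial_map i phi u v)) (compose (partial4 Cu f) phi u v)
      (snd (partial_map i phi u v)) (compose (partial4 Cv f) phi u v).
Proof.
  intros (H0 & H1 & H2 & H3) [P Q]. apply is_partial4_unique.
  assert (K : forall h, Cinf everywhere h -> is_partial i (compose h phi) u v
     (fst (partial_map i phi u v) * compose (partial Cu h) phi u v + snd (partial_map i phi u v) * compose (partial Cv h) phi u v)).
  { intros h Hh. evar_last.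
    - apply (is_partial_smooth_compose i h (fun u v => fst (phi u v)) (fun u v => snd (phi u v)) u v
        (fst (partial_map i phi u v)) (snd (partial_map i phi u v)) Hh); apply Cinf_part; assumption.
    - unfold compose. ring. }
  split; [| split; [| split]]; [apply (K _ H0) | apply (K _ H1) | apply (K _ H2) | apply (K _ H3)].
Qed.

Lemma Cinf4_compose f phi : Cinf4 f -> smooth_map phi -> Cinf4 (compose f phi).
Proof.
  intros (H0 & H1 & H2 & H3) [P Q].
  assert (K : forall h, Cinf everywhere h -> Cinf everywhere (compose h phi)).
  { intros h Hh. apply (Cinf_comp everywhere everywhere h); auto using open_everywhere. }
  split; [| split; [| split]]; [apply (K _ H0) | apply (K _ H1) | apply (K _ H2) | apply (K _ H3)].
Qed.

Lemma form_I_compose f phi u v : Cinf4 f -> smooth_map phi ->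
  form_I (compose f phi) u v = pullback phi (form_I f) u v.
Proof.
  intros Sf Sphi. unfold form_I, ip_d, pullback. rewrite !(partial4_compose f phi _ u v Sf Sphi).
  unfold compose, bil; simpl. rewrite !ip_lin_l, !ip_lin_r.
  rewrite (ip_sym (partial4 Cv f _ _) (partial4 Cu f _ _)). f_equal; field.
Qed.

Theorem asymptotic_parametrization f : immersion_H31 f -> (forall x y, form_I f x y = gL2 x y) ->
  exists w1 w2 c1 c2, angle_pair w1 w2 /\ global_diffeo (map_B w1 w2 c1 c2) /\
    exists N, immersion_A w1 w2 (compose f (map_B w1 w2 c1 c2)) N.
Proof.
  intros Hf HI.
  destruct (gauss_codazzi f Hf HI) as (N & a & b & c & [SN HN] & Sa & Sb & Sc & HG & HC1 & HC2 & HII & Hsym & HIII).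
  destruct (asymptotic_angles a b c Sa Sb Sc HG HC1 HC2) as (W1 & W2 & SW1 & SW2 & HW & Eabc & K1 & K2).
  destruct (asymptotic_coordinates W1 W2 SW1 SW2 HW K1 K2) as (w1 & w2 & c1 & c2 & HA & Hg & E1 & E2).
  exists w1, w2, c1, c2. split; [exact HA |]. split; [exact Hg |].
  destruct Hf as (Sf & H1 & _).
  apply smooth4_Cinf4 in Sf. apply smooth4_Cinf4 in SN.
  set (phi := map_B w1 w2 c1 c2) in *.
  assert (Sphi : smooth_map phi) by (destruct (global_diffeo_inverse phi Hg) as (_ & S & _); exact S).
  assert (C1 : forall t, continuous w1 t) by (intro; apply smooth1_continuous, HA).
  assert (C2 : forall t, continuous w2 t) by (intro; apply smooth1_continuous, HA).
  assert (Pphi : forall i u v, partial_map i phi u v =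
    (match i with Cu => cos (w1 u) | Cv => cos (w2 v) end, match i with Cu => sin (w1 u) | Cv => - sin (w2 v) end)).
  { intros i u v. unfold partial_map. f_equal; apply is_partial_unique.
    - apply (map_x_partial w1 w2 C1 C2 c1). - apply (map_y_partial w1 w2 C1 C2 c2). }
  assert (HFI : forall u v, form_I (compose f phi) u v = form_A w1 w2 u v).
  { intros u v. rewrite form_I_compose by assumption. rewrite <- (pullback_map_B w1 w2 (proj1 HA) (proj1 (proj2 HA)) c1 c2).
    unfold pullback, compose. rewrite HI. reflexivity. }
  clearbody phi. exists (compose N phi). split; [| split].
  - split; [apply Cinf4_smooth4, Cinf4_compose; assumption |]. split; [intros u v; apply H1 |].
    intros u v x y. apply (independent_of_form_A w1 w2 HA (compose f phi) u v (HFI u v)).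
  - split; [apply Cinf4_smooth4, Cinf4_compose; assumption |]. intros u v.
    destruct (HN (fst (phi u v)) (snd (phi u v))) as (n1 & n2 & n3).
    split; [exact n1 |]. split; [exact n2 |]. intros i. rewrite partial4_compose by assumption.
    rewrite ip_lin_r. unfold compose. rewrite !n3. ring.
  - intros u v. split; [exact (HFI u v) |].
    specialize (E1 u v). specialize (E2 u v). unfold compose in E1, E2.
    pose proof (HII (fst (phi u v)) (snd (phi u v))) as FII.
    pose proof (HIII (fst (phi u v)) (snd (phi u v))) as FIII.
    pose proof (Hsym (fst (phi u v)) (snd (phi u v))) as FS.
    destruct (Eabc (fst (phi u v)) (snd (phi u v))) as (Ea & Eb & Ec).
    rewrite E1, E2 in Ea, Eb, Ec.
    pose proof (sin_sum_neq w1 w2 HA u v) as H.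
    unfold form_II, form_III, ip_d, opp_sym2 in *. rewrite !(partial4_compose _ phi _ u v) by assumption.
    rewrite !Pphi. simpl in *. rewrite !ip_lin_l, !ip_lin_r. unfold compose in *.
    pose proof (f_equal cE FII) as II1. pose proof (f_equal cF FII) as II2. pose proof (f_equal cG FII) as II3.
    pose proof (f_equal cE FIII) as III1. pose proof (f_equal cF FIII) as III2. pose proof (f_equal cG FIII) as III3.
    simpl in *. rewrite (ip_sym (partial4 Cv N _ _) (partial4 Cu N _ _)) in *.
    set (X := partial4 Cu f (fst (phi u v)) (snd (phi u v))) in *.
    set (Y := partial4 Cv f (fst (phi u v)) (snd (phi u v))) in *.
    set (Nx := partial4 Cu N (fst (phi u v)) (snd (phi u v))) in *.
    set (Ny := partial4 Cv N (fst (phi u v)) (snd (phi u v))) in *.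
    assert (j1 : ip X Nx = - a (fst (phi u v)) (snd (phi u v))) by lra.
    assert (j2 : ip X Ny = - b (fst (phi u v)) (snd (phi u v))) by lra.
    assert (j3 : ip Y Nx = - b (fst (phi u v)) (snd (phi u v))) by lra.
    assert (j4 : ip Y Ny = - c (fst (phi u v)) (snd (phi u v))) by lra.
    assert (j5 : ip Nx Ny = b (fst (phi u v)) (snd (phi u v)) * c (fst (phi u v)) (snd (phi u v))
       - a (fst (phi u v)) (snd (phi u v)) * b (fst (phi u v)) (snd (phi u v))) by lra.
    rewrite j1, j2, j3, j4, j5, III1, III3, Ea, Eb, Ec.
    rewrite ?cos_2a, ?cos_minus, ?sin_minus, sin_plus in *.
    split; f_equal; field; exact H.
Qed.

(** Both [phi] and (B) pull the Lorentz metric back to the form I of (A). *)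
Theorem parametrization_unique f : immersion_H31 f -> (forall x y, form_I f x y = gL2 x y) ->
  forall w1 w2 phi, angle_pair w1 w2 -> global_diffeo phi ->
  (forall u v, form_I (compose f phi) u v = form_A w1 w2 u v) ->
  forall c1 c2, exists T, isometry gL2 gL2 T /\
    forall u v, phi u v = compose T (map_B w1 w2 c1 c2) u v.
Proof.
  intros Hf HI w1 w2 phi HA Hphi HF c1 c2.
  destruct (global_diffeo_inverse phi Hphi) as (_ & Sphi & _).
  assert (Ephi : (fun u v => (fst (phi u v), snd (phi u v))) = phi).
  { apply plane_ext; intros u v. symmetry. apply surjective_pairing. }
  destruct (rigidity w1 w2 HA _ _ c1 c2 (proj1 Sphi) (proj2 Sphi))
    as (l & m & t & l' & m' & t' & H1 & H2 & H3 & E).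
  { intros u v. rewrite Ephi, <- HF, form_I_compose by (try apply smooth4_Cinf4, Hf; exact Sphi).
    unfold pullback, compose. rewrite HI. reflexivity. }
  exists (affine l m t l' m' t'). split; [apply affine_isometry; assumption |].
  intros u v. rewrite <- E. apply surjective_pairing.
Qed.

Theorem proposition5 :
  (forall w1 w2 : R -> R, angle_pair w1 w2 ->
     (exists f N : R -> R -> R4, immersion_A w1 w2 f N) /\
     (forall f N : R -> R -> R4, immersion_A w1 w2 f N ->
        flat (form_I f) /\ timelike f /\
        (forall (a b : Rbar) (c : R -> R * R), regular_curve a b c ->
           (asymptotic_curve f N a b c <-> in_coordinate_curve a b c)) /\
        (forall c1 c2 : R,
           (exists phi : plane_map, isometry (form_I f) gL2 phi) <->
           global_diffeo (map_B w1 w2 c1 c2))) /\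
     (forall c1 c2 : R, local_diffeo (map_B w1 w2 c1 c2)) /\
     ((exists m1 m2 : R, 0 < m1 /\ m2 < PI /\
         forall u v : R, m1 <= w1 u + w2 v <= m2) ->
      forall c1 c2 : R, global_diffeo (map_B w1 w2 c1 c2))) /\
  (forall f : R -> R -> R4,
     immersion_H31 f -> (forall x y : R, form_I f x y = gL2 x y) ->
     (exists (w1 w2 : R -> R) (c1 c2 : R),
        angle_pair w1 w2 /\
        global_diffeo (map_B w1 w2 c1 c2) /\
        exists N : R -> R -> R4,
          immersion_A w1 w2 (compose f (map_B w1 w2 c1 c2)) N) /\
     (forall (w1 w2 : R -> R) (phi : plane_map),
        angle_pair w1 w2 -> global_diffeo phi ->
        (exists N : R -> R -> R4, immersion_A w1 w2 (compose f phi) N) ->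
        forall c1 c2 : R, exists T : plane_map,
          isometry gL2 gL2 T /\
          forall u v : R, phi u v = compose T (map_B w1 w2 c1 c2) u v)).
Proof.
  split.
  - intros w1 w2 HA.
    split; [apply immersion_A_exists, HA |].
    split; [apply immersion_A_geometry, HA |].
    split; [intros c1 c2; apply map_B_local, HA |].
    intros (m1 & m2 & H1 & H2 & Hb) c1 c2. apply (map_B_global_of_bounds w1 w2 HA m1 m2); assumption.
  - intros f Hf HI. split; [apply asymptotic_parametrization; assumption |].
    intros w1 w2 phi HA Hphi (N & _ & _ & HF).
    apply (parametrization_unique f Hf HI w1 w2 phi HA Hphi).
    intros u v. exact (proj1 (HF u v)).
Qed.
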